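(* Let $\mathcal X=\{x_{n,k}\}$ be a Marcinkiewicz–Zygmund family on $\mathbb T$ with weights $\tau_{n,k}$ and constants $A,B>0$, let $\kappa=B/A$, and let $I_n$ be the associated quadrature rules (as in the context); write $I(f)=\int_{-1/2}^{1/2}f(x)\,dx$. (i) If $f\in C(\mathbb T)$, then $|I(f)-I_n(f)|\le(1+\sqrt\kappa)\inf_{p\in\mathcal T_n}\|f-p\|_\infty$. Consequently, if $f\in C^\sigma(\mathbb T)$, then $|I(f)-I_n(f)|=\mathcal O(n^{-\sigma})$. (ii) If $f\in H^\sigma(\mathbb T)$ with $\sigma>1/2$, then $|I(f)-I_n(f)|\le(1+\sqrt\kappa)\|f\|_{H^\sigma}\phi_\sigma(n)$ with $\phi_\sigma(n)=(\sigma-1/2)^{-1/2}n^{-\sigma+1/2}$. (iii) If $f$ extends to an analytic function on a strip $\{z\in\mathbb C:|\operatorname{Im}z|<\rho_0\}$, then for every $\rho<\rho_0$, $|I(f)-I_n(f)|=\mathcal O(e^{-\rho n})$.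
   Context: $\mathbb T=\mathbb R/\mathbb Z\cong(-1/2,1/2]$ with Lebesgue measure; $\langle f,g\rangle=\int_{-1/2}^{1/2}f\bar g\,dx$. $\mathcal T_n$ = trigonometric polynomials $\sum_{|k|\le n}c_ke^{2\pi ikx}$. $H^\sigma(\mathbb T)$ = functions with $\|f\|_{H^\sigma}^2=\sum_{k\in\mathbb Z}|\hat f(k)|^2(1+k^2)^\sigma<\infty$, $\hat f(k)=\int_0^1f(x)e^{-2\pi ikx}dx$. $C^\sigma(\mathbb T)$ denotes the standard space of functions of smoothness order $\sigma$ on $\mathbb T$. A Marcinkiewicz–Zygmund family is a set $\{x_{n,k}: n\in\mathbb N,k=1,\dots,L_n\}\subseteq\mathbb T$ with weights $\tau_{n,k}>0$ and constants $A,B>0$ independent of $n$ such that $A\|p\|_2^2\le\sum_{k=1}^{L_n}|p(x_{n,k})|^2\tau_{n,k}\le B\|p\|_2^2$ for all $p\in\mathcal T_n$. Let $k^{(n)}_x$ be the reproducing kernel of $\mathcal T_n$ ($p(x)=\langle p,k^{(n)}_x\rangle$, $p\in\mathcal T_n$), $S_np=\sum_{k=1}^{L_n}\tau_{n,k}\langle p,k^{(n)}_{x_{n,k}}\rangle k^{(n)}_{x_{n,k}}$ on $\mathcal T_n$, $e_{n,k}=S_n^{-1}(\tau_{n,k}^{1/2}k^{(n)}_{x_{n,k}})$, $w_{n,k}=\tau_{n,k}^{1/2}\int_{-1/2}^{1/2}e_{n,k}(x)dx$, and $I_n(f)=\sum_{k=1}^{L_n}f(x_{n,k})w_{n,k}$.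 *)

(* Defs.v *)
From Stdlib Require Import Reals ZArith ClassicalEpsilon.
From Coquelicot Require Import Coquelicot.
Open Scope R_scope.

Fixpoint csum (F : nat -> C) (N : nat) : C :=
  match N with
  | O => RtoC 0
  | S N' => Cplus (csum F N') (F N')
  end.

Fixpoint rsum (F : nat -> R) (N : nat) : R :=
  match N with
  | O => 0
  | S N' => rsum F N' + F N'
  end.

Definition cexp2pi (m : Z) (x : R) : C :=
  (cos (2 * PI * IZR m * x), sin (2 * PI * IZR m * x)).

Definition trig_poly (n : nat) (p : R -> C) : Prop :=
  exists c : Z -> C, forall x,
    p x = csum (fun j => Cmult (c (Z.of_nat j - Z.of_nat n)%Z)
                               (cexp2pi (Z.of_nat j - Z.of_nat n)%Z x)) (2 * n + 1).

(* functions on T = R/Z are 1-periodic functions on R *)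
Definition periodic1 (f : R -> C) : Prop := forall x, f (x + 1) = f x.

Definition inner (f g : R -> C) : C :=
  RInt (V := C_R_CompleteNormedModule) (fun x => Cmult (f x) (Cconj (g x))) (-1/2) (1/2).

Definition L2sq (p : R -> C) : R :=
  RInt (fun x => Cmod (p x) ^ 2) (-1/2) (1/2).

Definition Iint (f : R -> C) : C := RInt (V := C_R_CompleteNormedModule) f (-1/2) (1/2).

(* Marcinkiewicz-Zygmund family {x_{n,k} : n >= 1, k < L n} with weights tau
   (indices k = 0..L_n-1 stand for k = 1..L_n of the paper) *)
Definition MZ_family (L : nat -> nat) (xs tau : nat -> nat -> R) (A B : R) : Prop :=
  0 < A /\ 0 < B /\
  (forall n k, (1 <= n)%nat -> (k < L n)%nat -> 0 < tau n k) /\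
  (forall n p, (1 <= n)%nat -> trig_poly n p ->
     A * L2sq p <= rsum (fun k => Cmod (p (xs n k)) ^ 2 * tau n k) (L n)
     /\ rsum (fun k => Cmod (p (xs n k)) ^ 2 * tau n k) (L n) <= B * L2sq p).

Definition zero_fun : R -> C := fun _ => RtoC 0.

Definition repr_kernel (n : nat) (x : R) : R -> C :=
  epsilon (inhabits zero_fun)
    (fun k => trig_poly n k /\ forall p, trig_poly n p -> p x = inner p k).

Definition frame_op (L : nat -> nat) (xs tau : nat -> nat -> R) (n : nat)
  (p : R -> C) : R -> C :=
  fun y => csum (fun k => Cmult (Cmult (RtoC (tau n k)) (inner p (repr_kernel n (xs n k))))
                               (repr_kernel n (xs n k) y)) (L n).

Definition dual_frame (L : nat -> nat) (xs tau : nat -> nat -> R) (n k : nat) : R -> C :=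
  epsilon (inhabits zero_fun)
    (fun g => trig_poly n g /\
       forall y, frame_op L xs tau n g y
                 = Cmult (RtoC (sqrt (tau n k))) (repr_kernel n (xs n k) y)).

Definition qweight (L : nat -> nat) (xs tau : nat -> nat -> R) (n k : nat) : C :=
  Cmult (RtoC (sqrt (tau n k))) (RInt (V := C_R_CompleteNormedModule) (dual_frame L xs tau n k) (-1/2) (1/2)).

Definition quad (L : nat -> nat) (xs tau : nat -> nat -> R) (n : nat) (f : R -> C) : C :=
  csum (fun k => Cmult (f (xs n k)) (qweight L xs tau n k)) (L n).

Definition sup_norm (g : R -> C) : Rbar :=
  Lub_Rbar (fun r => exists x, r = Cmod (g x)).

Definition best_approx (n : nat) (f : R -> C) : Rbar :=
  Glb_Rbar (fun r => exists p, trig_poly n p /\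
                      sup_norm (fun x => Cminus (f x) (p x)) = Finite r).

Definition cont_periodic (f : R -> C) : Prop :=
  periodic1 f /\ forall x, continuous f x.

Definition holder_r (r : nat) (alpha : R) (g : R -> R) : Prop :=
  (forall j x, (j <= r)%nat -> ex_derive_n g j x) /\
  exists M, forall x y, x <> y ->
    Rabs (Derive_n g r x - Derive_n g r y) <= M * Rpower (Rabs (x - y)) alpha.

Definition C_sigma (sigma : R) (f : R -> C) : Prop :=
  cont_periodic f /\
  exists (r : nat) (alpha : R), 0 < alpha <= 1 /\ sigma = INR r + alpha /\
    holder_r r alpha (fun x => fst (f x)) /\ holder_r r alpha (fun x => snd (f x)).

Definition fhat (f : R -> C) (m : Z) : C :=
  RInt (V := C_R_CompleteNormedModule) (fun x => Cmult (f x) (Cconj (cexp2pi m x))) 0 1.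

(* terms of sum_{m in Z} |hat f(m)|^2 (1+m^2)^sigma, grouping m and -m *)
Definition sob_term (sigma : R) (f : R -> C) (j : nat) : R :=
  match j with
  | O => Cmod (fhat f 0%Z) ^ 2
  | S _ => (Cmod (fhat f (Z.of_nat j)) ^ 2 + Cmod (fhat f (- Z.of_nat j)%Z) ^ 2)
           * Rpower (1 + INR j ^ 2) sigma
  end.

Definition in_H_sigma (sigma : R) (f : R -> C) : Prop := ex_series (sob_term sigma f).

Definition H_norm (sigma : R) (f : R -> C) : R := sqrt (Series (sob_term sigma f)).

Definition analytic_strip (rho0 : R) (f : R -> C) : Prop :=
  exists F : C -> C,
    (forall z : C, Rabs (Im z) < rho0 -> ex_derive (K := C_AbsRing) (V := C_NormedModule) F z)
    /\ forall t : R, F (RtoC t) = f t.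

(* Main.v *)
(** The dual frame enters the weights only through [u = S_n^-1 1]: one finds
    [w_k = tau_k * conj (u x_k)], hence [I_n p = <p, 1>] on trigonometric polynomials of degree [n],
    while Cauchy-Schwarz and the Marcinkiewicz-Zygmund inequalities for [1] and [u] give
    [sum_k |w_k| <= sqrt (B / A)].  So the error is at most [(1 + sqrt (B / A)) * |f - p|_oo] for every such [p].
    Good [p] come from Korovkin's kernel [|sum_j a_j e_j|^2] with [a_j] proportional to
    [sin ((j + 1) pi / (n + 2))], whose second moment is [O(n^-2)]; smoothness of higher order is reached by
    approximating the derivative and integrating.  The same kernel shows that [f] differs from its Fourier
    partial sum by at most the tail of its Fourier coefficients, which yields the Sobolev estimate.
    For analytic [f] the coefficients decay exponentially by shifting the contour.  The shift needs the
    extension [F] itself to be periodic: [F (z + 1) - F z] vanishes on the real line, and comparing its Fourier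
    coefficients on small and large circles about real points shows that it vanishes on the whole strip. *)

Require Import Defs.
From Stdlib Require Import Reals ZArith.
From Coquelicot Require Import Coquelicot.
From Stdlib Require Import Lra Lia Classical ClassicalEpsilon FunctionalExtensionality.
Open Scope R_scope.

(** Both [repr_kernel] and [dual_frame] are picked by [epsilon], so their properties rest on
    existence. For the first, the Dirichlet kernel is exhibited. For the second, [S_n] has to be
    onto; this is Riesz representation for the Hermitian form [<S_n g, h>], a weighted sum over the
    nodes, which the lower Marcinkiewicz-Zygmund inequality makes definite on trigonometric
    polynomials. All integrals are Riemann integrals of continuous functions, and Korovkin's
    operator does the work of a summation theorem for Fourier series: it is a finite sum, and its
    error at [x] is read off from any majorant [E + D * y ^ 2] of [|f (x + y) - f x|]. A Hölder
    modulus rescaled by [n] gives rates; plain continuity, with small [E] and large [D], gives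
    convergence. The analytic extension is only assumed complex differentiable at each point, with
    no continuity of the derivative, hence Goursat's bisection. Rectangles suffice: circles become
    vertical segments in a logarithmic coordinate, and Taylor coefficients appear as Fourier
    coefficients on circles. *)

(** * Finite sums of real and complex numbers *)

Lemma csum_ext (F G : nat -> C) (N : nat) :
  (forall k, (k < N)%nat -> F k = G k) -> csum F N = csum G N.
Proof.
induction N as [|N IH]; intros H; simpl; [reflexivity|].
rewrite IH by (intros; apply H; lia); rewrite H by lia; reflexivity.
Qed.

Lemma csum_0 (N : nat) : csum (fun _ => RtoC 0) N = RtoC 0.
Proof. induction N as [|N IH]; simpl; [reflexivity|]; rewrite IH; ring. Qed.

Lemma csum_plus (F G : nat -> C) (N : nat) :
  csum (fun k => F k + G k)%C N = (csum F N + csum G N)%C.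
Proof. induction N as [|N IH]; simpl; [ring|]; rewrite IH; ring. Qed.

Lemma csum_scal (c : C) (F : nat -> C) (N : nat) :
  csum (fun k => c * F k)%C N = (c * csum F N)%C.
Proof. induction N as [|N IH]; simpl; [ring|]; rewrite IH; ring. Qed.

Lemma csum_conj (F : nat -> C) (N : nat) :
  Cconj (csum F N) = csum (fun k => Cconj (F k)) N.
Proof.
induction N as [|N IH]; simpl.
- unfold Cconj, RtoC; simpl; f_equal; ring.
- rewrite Cplus_conj, IH; reflexivity.
Qed.

Lemma csum_delta (F : nat -> C) (N i : nat) :
  (i < N)%nat -> (forall k, (k < N)%nat -> k <> i -> F k = RtoC 0) -> csum F N = F i.
Proof.
induction N as [|N IH]; intros Hi H; [lia|]; simpl.
destruct (Nat.eq_dec i N) as [->|Hne].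
- rewrite (csum_ext F (fun _ => RtoC 0)) by (intros; apply H; lia); rewrite csum_0; ring.
- rewrite IH by (try lia; intros; apply H; lia); rewrite (H N) by lia; ring.
Qed.

Lemma rsum_ext (F G : nat -> R) (N : nat) :
  (forall k, (k < N)%nat -> F k = G k) -> rsum F N = rsum G N.
Proof.
induction N as [|N IH]; intros H; simpl; [reflexivity|].
rewrite IH by (intros; apply H; lia); rewrite H by lia; reflexivity.
Qed.

Lemma rsum_le (F G : nat -> R) (N : nat) :
  (forall k, (k < N)%nat -> F k <= G k) -> rsum F N <= rsum G N.
Proof.
induction N as [|N IH]; intros H; simpl; [lra|].
apply Rplus_le_compat; [apply IH; intros; apply H|apply H]; lia.
Qed.

Lemma rsum_plus (F G : nat -> R) (N : nat) :
  rsum (fun k => F k + G k) N = rsum F N + rsum G N.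
Proof. induction N as [|N IH]; simpl; [ring|]; rewrite IH; ring. Qed.

Lemma rsum_scal (c : R) (F : nat -> R) (N : nat) :
  rsum (fun k => c * F k) N = c * rsum F N.
Proof. induction N as [|N IH]; simpl; [ring|]; rewrite IH; ring. Qed.

Lemma rsum_0 (N : nat) : rsum (fun _ => 0) N = 0.
Proof. induction N as [|N IH]; simpl; [reflexivity|]; rewrite IH; ring. Qed.

Lemma rsum_nonneg (F : nat -> R) (N : nat) :
  (forall k, (k < N)%nat -> 0 <= F k) -> 0 <= rsum F N.
Proof. intros H; rewrite <- (rsum_0 N); apply rsum_le, H. Qed.

Lemma rsum_swap (F : nat -> nat -> R) (N M : nat) :
  rsum (fun i => rsum (fun j => F i j) M) N = rsum (fun j => rsum (fun i => F i j) N) M.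
Proof.
induction N as [|N IH]; simpl.
- symmetry; apply rsum_0.
- rewrite IH, rsum_plus; reflexivity.
Qed.

Lemma csum_RtoC (F : nat -> R) (N : nat) :
  csum (fun k => RtoC (F k)) N = RtoC (rsum F N).
Proof. induction N as [|N IH]; simpl; [reflexivity|]; rewrite IH, RtoC_plus; reflexivity. Qed.

Lemma Cmod_csum_le (F : nat -> C) (N : nat) :
  Cmod (csum F N) <= rsum (fun k => Cmod (F k)) N.
Proof.
induction N as [|N IH]; simpl; [rewrite Cmod_0; lra|].
eapply Rle_trans; [apply Cmod_triangle|]; lra.
Qed.

Lemma rsum_Cauchy_Schwarz (F G : nat -> R) (N : nat) :
  rsum (fun k => F k * G k) N <= sqrt (rsum (fun k => F k ^ 2) N) * sqrt (rsum (fun k => G k ^ 2) N).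
Proof.
set (P := rsum (fun k => F k ^ 2) N); set (Q := rsum (fun k => G k ^ 2) N).
assert (HP : 0 <= P) by (apply rsum_nonneg; intros; apply pow2_ge_0).
assert (HQ : 0 <= Q) by (apply rsum_nonneg; intros; apply pow2_ge_0).
set (X := rsum (fun k => F k * G k) N).
assert (H : forall t, 0 <= P - 2 * t * X + t ^ 2 * Q).
{ intros t.
  replace (P - 2 * t * X + t ^ 2 * Q) with (rsum (fun k => (F k - t * G k) ^ 2) N).
  - apply rsum_nonneg; intros; apply pow2_ge_0.
  - unfold P, Q, X; clear; induction N as [|N IH]; simpl in *; [ring|]; rewrite IH; ring. }
rewrite <- sqrt_mult by assumption.
destruct (Rle_dec X 0) as [HX|HX]; [apply Rle_trans with 0; [lra|apply sqrt_pos]|].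
apply Rnot_le_lt in HX.
rewrite <- (sqrt_pow2 X) by lra; apply sqrt_le_1_alt.
destruct (Req_dec Q 0) as [HQ0|HQ0].
(* With [Q = 0] the quadratic is affine in [t], and this [t] gives it the value [- P - 2]. *)
- exfalso; specialize (H ((P + 1) / X)); rewrite HQ0 in H.
  replace (2 * ((P + 1) / X) * X) with (2 * (P + 1)) in H by (field; lra); lra.
- specialize (H (X / Q)).
  assert (E : (P - 2 * (X / Q) * X + (X / Q) ^ 2 * Q) * Q = P * Q - X ^ 2) by (field; lra).
  assert (0 <= (P - 2 * (X / Q) * X + (X / Q) ^ 2 * Q) * Q) by (apply Rmult_le_pos; lra).
  lra.
Qed.

(** * Complex-valued integrals on the real line *)

(** Continuity is kept componentwise so that products, conjugates and integrals reduce to the real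
    theory; [continuous_ccont] and [ccont_continuous] show that it agrees with continuity into
    [C]. *)
Definition ccont (f : R -> C) (x : R) : Prop :=
  continuous (fun t => fst (f t)) x /\ continuous (fun t => snd (f t)) x.

Definition ccont_on (f : R -> C) (a b : R) : Prop := forall x, a <= x <= b -> ccont f x.

(** Fixes [C] as a normed space over the reals once and for all; [Iint], [inner] and [fhat] are
    convertible to instances of it. *)
Definition CInt (f : R -> C) (a b : R) : C := RInt (V := C_R_CompleteNormedModule) f a b.

Lemma continuous_ccont (f : R -> C) (x : R) : continuous f x -> ccont f x.
Proof.
intros H; split.
- apply (continuous_comp f fst); [exact H|]; destruct (f x) as [u v]; apply continuous_fst.
- apply (continuous_comp f snd); [exact H|]; destruct (f x) as [u v]; apply continuous_snd.
Qed.

Lemma ccont_continuous (f : R -> C) (x : R) : ccont f x -> continuous f x.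
Proof.
intros [H1 H2].
apply (continuous_ext (fun t => (fst (f t), snd (f t)))).
- intros t; destruct (f t); reflexivity.
- refine (continuous_comp_2 (fun t => fst (f t)) (fun t => snd (f t)) (fun u v => (u, v)) x H1 H2 _).
  apply (continuous_ext (fun p => p)); [intros [u v]; reflexivity|apply continuous_id].
Qed.

Lemma ccont_const (c : C) (x : R) : ccont (fun _ => c) x.
Proof. split; apply continuous_const. Qed.

Lemma ccont_plus (f g : R -> C) (x : R) :
  ccont f x -> ccont g x -> ccont (fun t => f t + g t)%C x.
Proof.
intros [f1 f2] [g1 g2]; split; simpl.
- apply (continuous_plus (fun t => fst (f t)) (fun t => fst (g t))); assumption.
- apply (continuous_plus (fun t => snd (f t)) (fun t => snd (g t))); assumption.
Qed.

Lemma ccont_opp (f : R -> C) (x : R) : ccont f x -> ccont (fun t => - f t)%C x.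
Proof.
intros [f1 f2]; split; simpl.
- apply (continuous_opp (fun t => fst (f t))); assumption.
- apply (continuous_opp (fun t => snd (f t))); assumption.
Qed.

Lemma ccont_minus (f g : R -> C) (x : R) :
  ccont f x -> ccont g x -> ccont (fun t => f t - g t)%C x.
Proof. intros Hf Hg; apply ccont_plus; [exact Hf|apply ccont_opp, Hg]. Qed.

Lemma ccont_mult (f g : R -> C) (x : R) :
  ccont f x -> ccont g x -> ccont (fun t => f t * g t)%C x.
Proof.
intros [f1 f2] [g1 g2]; split; simpl.
- apply (continuous_minus (fun t => fst (f t) * fst (g t)) (fun t => snd (f t) * snd (g t)));
    apply (continuous_mult (K := R_AbsRing)); assumption.
- apply (continuous_plus (fun t => fst (f t) * snd (g t)) (fun t => snd (f t) * fst (g t)));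
    apply (continuous_mult (K := R_AbsRing)); assumption.
Qed.

Lemma ccont_conj (f : R -> C) (x : R) : ccont f x -> ccont (fun t => Cconj (f t)) x.
Proof.
intros [f1 f2]; split; simpl; [exact f1|].
apply (continuous_opp (fun t => snd (f t))); assumption.
Qed.

Lemma ccont_csum (F : nat -> R -> C) (N : nat) (x : R) :
  (forall k, (k < N)%nat -> ccont (F k) x) -> ccont (fun t => csum (fun k => F k t) N) x.
Proof.
induction N as [|N IH]; intros H; simpl; [apply ccont_const|].
apply (ccont_plus (fun t => csum (fun k => F k t) N) (F N)); [apply IH; intros; apply H; lia|apply H; lia].
Qed.

Lemma ccont_RtoC (g : R -> R) (x : R) : continuous g x -> ccont (fun t => RtoC (g t)) x.
Proof. intros H; split; simpl; [exact H|apply continuous_const]. Qed.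

Lemma ccont_comp (f : R -> C) (g : R -> R) (x : R) :
  ccont f (g x) -> continuous g x -> ccont (fun t => f (g t)) x.
Proof.
intros [f1 f2] Hg; split.
- apply (continuous_comp g (fun t => fst (f t))); assumption.
- apply (continuous_comp g (fun t => snd (f t))); assumption.
Qed.

Lemma Cmod_R_norm (z : C) : Cmod z = @norm R_AbsRing C_R_NormedModule z.
Proof.
destruct z as [u v]; unfold Cmod, norm; simpl; unfold prod_norm; simpl.
unfold norm; simpl; unfold abs; simpl.
f_equal; rewrite !Rmult_1_r, <- !Rabs_mult, !Rabs_pos_eq; try reflexivity; apply Rle_0_sqr.
Qed.

Lemma continuous_Cmod (f : R -> C) (x : R) : ccont f x -> continuous (fun t => Cmod (f t)) x.
Proof.
intros H; apply ccont_continuous in H.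
apply (continuous_ext (fun t => @norm R_AbsRing C_R_NormedModule (f t))).
{ intros t; symmetry; apply Cmod_R_norm. }
apply (continuous_comp (V := C_R_NormedModule) f (fun z => @norm R_AbsRing C_R_NormedModule z) x H).
exact (filterlim_norm (V := C_R_NormedModule) (f x)).
Qed.

Lemma ccont_on_fst (f : R -> C) (a b : R) : a <= b -> ccont_on f a b ->
  ex_RInt (fun t => fst (f t)) a b.
Proof.
intros Hab H; apply (ex_RInt_continuous (V := R_CompleteNormedModule)).
rewrite Rmin_left, Rmax_right by assumption; intros z Hz; apply H, Hz.
Qed.

Lemma ccont_on_snd (f : R -> C) (a b : R) : a <= b -> ccont_on f a b ->
  ex_RInt (fun t => snd (f t)) a b.
Proof.
intros Hab H; apply (ex_RInt_continuous (V := R_CompleteNormedModule)).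
rewrite Rmin_left, Rmax_right by assumption; intros z Hz; apply H, Hz.
Qed.

Lemma CInt_pair (f : R -> C) (a b : R) : a <= b -> ccont_on f a b ->
  CInt f a b = (RInt (fun t => fst (f t)) a b, RInt (fun t => snd (f t)) a b).
Proof.
intros Hab H; apply (is_RInt_unique (V := C_R_CompleteNormedModule)), is_RInt_fct_extend_pair;
  apply (RInt_correct (V := R_CompleteNormedModule)).
- apply ccont_on_fst; assumption.
- apply ccont_on_snd; assumption.
Qed.

Lemma CInt_ext (f g : R -> C) (a b : R) : a <= b ->
  (forall x, a <= x <= b -> f x = g x) -> CInt f a b = CInt g a b.
Proof.
intros Hab H; apply (RInt_ext (V := C_R_CompleteNormedModule)); rewrite Rmin_left, Rmax_right by assumption.
intros x Hx; apply H; lra.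
Qed.

Lemma CInt_plus (f g : R -> C) (a b : R) : a <= b -> ccont_on f a b -> ccont_on g a b ->
  CInt (fun x => f x + g x)%C a b = (CInt f a b + CInt g a b)%C.
Proof.
intros Hab Hf Hg; rewrite !CInt_pair; try assumption.
- unfold Cplus; simpl; f_equal.
  + apply (RInt_plus (V := R_CompleteNormedModule)); apply ccont_on_fst; assumption.
  + apply (RInt_plus (V := R_CompleteNormedModule)); apply ccont_on_snd; assumption.
- intros x Hx; apply ccont_plus; auto.
Qed.

Lemma CInt_scal (c : C) (f : R -> C) (a b : R) : a <= b -> ccont_on f a b ->
  CInt (fun x => c * f x)%C a b = (c * CInt f a b)%C.
Proof.
intros Hab Hf; rewrite !CInt_pair; try assumption.
- assert (E1 := ccont_on_fst f a b Hab Hf); assert (E2 := ccont_on_snd f a b Hab Hf).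
  unfold Cmult; simpl; f_equal.
  + rewrite (RInt_minus (V := R_CompleteNormedModule)
      (fun x => fst c * fst (f x)) (fun x => snd c * snd (f x))).
    * unfold minus, plus, opp; simpl; unfold Rminus; f_equal; [|f_equal];
        apply (RInt_scal (V := R_CompleteNormedModule)); assumption.
    * apply (ex_RInt_scal (V := R_NormedModule)); assumption.
    * apply (ex_RInt_scal (V := R_NormedModule)); assumption.
  + rewrite (RInt_plus (V := R_CompleteNormedModule)
      (fun x => fst c * snd (f x)) (fun x => snd c * fst (f x))).
    * unfold plus; simpl; f_equal;
        apply (RInt_scal (V := R_CompleteNormedModule)); assumption.
    * apply (ex_RInt_scal (V := R_NormedModule)); assumption.
    * apply (ex_RInt_scal (V := R_NormedModule)); assumption.
- intros x Hx; apply ccont_mult; [apply ccont_const|auto].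
Qed.

Lemma CInt_minus (f g : R -> C) (a b : R) : a <= b -> ccont_on f a b -> ccont_on g a b ->
  CInt (fun x => f x - g x)%C a b = (CInt f a b - CInt g a b)%C.
Proof.
intros Hab Hf Hg.
rewrite (CInt_ext _ (fun x => f x + RtoC (-1) * g x)%C) by (try assumption; intros; simpl; ring).
rewrite CInt_plus, CInt_scal; try assumption; [ring|].
intros x Hx; apply ccont_mult; [apply ccont_const|auto].
Qed.

Lemma CInt_conj (f : R -> C) (a b : R) : a <= b -> ccont_on f a b ->
  CInt (fun x => Cconj (f x)) a b = Cconj (CInt f a b).
Proof.
intros Hab Hf; rewrite !CInt_pair; try assumption.
- unfold Cconj; simpl; f_equal.
  apply (RInt_opp (V := R_CompleteNormedModule)), ccont_on_snd; assumption.
- intros x Hx; apply ccont_conj; auto.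
Qed.

Lemma CInt_RtoC (g : R -> R) (a b : R) : a <= b ->
  (forall x, a <= x <= b -> continuous g x) ->
  CInt (fun x => RtoC (g x)) a b = RtoC (RInt g a b).
Proof.
intros Hab Hg; rewrite CInt_pair; try assumption.
- unfold RtoC; simpl; f_equal; rewrite RInt_const; unfold scal; simpl; unfold mult; simpl; ring.
- intros x Hx; apply ccont_RtoC; auto.
Qed.

Lemma CInt_const (c : C) (a b : R) : a <= b -> CInt (fun _ => c) a b = (RtoC (b - a) * c)%C.
Proof.
intros Hab; rewrite CInt_pair; [|assumption|intros x _; apply ccont_const].
rewrite !RInt_const; unfold scal; simpl; unfold mult; simpl.
unfold Cmult, RtoC; simpl; f_equal; ring.
Qed.

Lemma CInt_csum (F : nat -> R -> C) (N : nat) (a b : R) : a <= b ->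
  (forall k, (k < N)%nat -> ccont_on (F k) a b) ->
  CInt (fun x => csum (fun k => F k x) N) a b = csum (fun k => CInt (F k) a b) N.
Proof.
intros Hab; induction N as [|N IH]; intros H; simpl.
- rewrite CInt_const by assumption; ring.
- rewrite CInt_plus, IH; try assumption; try reflexivity; intros; try (apply H; lia).
  intros x Hx; apply ccont_csum; intros; apply H; [lia|assumption].
Qed.

Lemma CInt_ex (f : R -> C) (a b : R) : a <= b -> ccont_on f a b ->
  ex_RInt (V := C_R_CompleteNormedModule) f a b.
Proof.
intros Hab Hf; apply (ex_RInt_continuous (V := C_R_CompleteNormedModule)).
rewrite Rmin_left, Rmax_right by assumption.
intros z Hz; apply ccont_continuous, Hf, Hz.
Qed.

Lemma Cmod_CInt_le (f : R -> C) (g : R -> R) (a b : R) : a <= b -> ccont_on f a b ->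
  (forall x, a <= x <= b -> continuous g x) ->
  (forall x, a <= x <= b -> Cmod (f x) <= g x) -> Cmod (CInt f a b) <= RInt g a b.
Proof.
intros Hab Hf Hg H; rewrite Cmod_R_norm.
apply (norm_RInt_le (V := C_R_NormedModule) f g a b).
- assumption.
- intros x Hx; rewrite <- Cmod_R_norm; auto.
- apply (RInt_correct (V := C_R_CompleteNormedModule)), CInt_ex; assumption.
- apply (RInt_correct (V := R_CompleteNormedModule)), (ex_RInt_continuous (V := R_CompleteNormedModule)).
  rewrite Rmin_left, Rmax_right by assumption; auto.
Qed.

Lemma Cmod_CInt_le_const (f : R -> C) (M a b : R) : a <= b -> ccont_on f a b ->
  (forall x, a <= x <= b -> Cmod (f x) <= M) -> Cmod (CInt f a b) <= (b - a) * M.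
Proof.
intros Hab Hf H.
eapply Rle_trans; [apply (Cmod_CInt_le f (fun _ => M)); auto; intros; apply continuous_const|].
rewrite RInt_const; unfold scal; simpl; unfold mult; simpl; lra.
Qed.

Lemma CInt_Chasles (f : R -> C) (a b c : R) : a <= b -> b <= c -> ccont_on f a c ->
  CInt f a c = (CInt f a b + CInt f b c)%C.
Proof.
intros Hab Hbc Hf; symmetry.
apply (RInt_Chasles (V := C_R_CompleteNormedModule) f a b c);
  apply CInt_ex; auto; intros x Hx; apply Hf; lra.
Qed.

Lemma CInt_derive (f df : R -> C) (a b : R) : a <= b ->
  (forall x, a <= x <= b -> is_derive (fun t => fst (f t)) x (fst (df x))) ->
  (forall x, a <= x <= b -> is_derive (fun t => snd (f t)) x (snd (df x))) ->
  ccont_on df a b -> CInt df a b = (f b - f a)%C.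
Proof.
intros Hab H1 H2 Hc; rewrite CInt_pair by assumption.
unfold Cminus, Cplus, Copp; simpl; f_equal; apply is_RInt_unique.
- apply (is_RInt_derive (V := R_CompleteNormedModule) (fun t => fst (f t)) (fun t => fst (df t)));
    rewrite Rmin_left, Rmax_right by assumption; intros x Hx; [auto|apply Hc, Hx].
- apply (is_RInt_derive (V := R_CompleteNormedModule) (fun t => snd (f t)) (fun t => snd (df t)));
    rewrite Rmin_left, Rmax_right by assumption; intros x Hx; [auto|apply Hc, Hx].
Qed.

(** * The characters of the circle *)

Lemma cexp2pi_add (m : Z) (x y : R) : cexp2pi m (x + y) = (cexp2pi m x * cexp2pi m y)%C.
Proof.
unfold cexp2pi, Cmult; simpl; rewrite Rmult_plus_distr_l, cos_plus, sin_plus; f_equal; ring.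
Qed.

Lemma cexp2pi_addz (m k : Z) (x : R) : cexp2pi (m + k) x = (cexp2pi m x * cexp2pi k x)%C.
Proof.
unfold cexp2pi, Cmult; simpl; rewrite plus_IZR, Rmult_plus_distr_l, Rmult_plus_distr_r, cos_plus, sin_plus.
f_equal; ring.
Qed.

Lemma cexp2pi_conj (m : Z) (x : R) : Cconj (cexp2pi m x) = cexp2pi (- m) x.
Proof.
unfold cexp2pi, Cconj; simpl; rewrite opp_IZR.
replace (2 * PI * - IZR m * x) with (- (2 * PI * IZR m * x)) by ring.
rewrite cos_neg, sin_neg; reflexivity.
Qed.

Lemma cexp2pi_opp (m : Z) (x : R) : cexp2pi m (- x) = cexp2pi (- m) x.
Proof. unfold cexp2pi; rewrite opp_IZR; f_equal; f_equal; ring. Qed.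

Lemma cexp2pi_0 (x : R) : cexp2pi 0 x = RtoC 1.
Proof.
unfold cexp2pi, RtoC; replace (2 * PI * 0 * x) with 0 by ring; rewrite cos_0, sin_0; reflexivity.
Qed.

Lemma cexp2pi_at0 (m : Z) : cexp2pi m 0 = RtoC 1.
Proof.
unfold cexp2pi, RtoC; rewrite Rmult_0_r, cos_0, sin_0; reflexivity.
Qed.

Lemma Cmod_cexp2pi (m : Z) (x : R) : Cmod (cexp2pi m x) = 1.
Proof.
unfold cexp2pi, Cmod; simpl.
replace (_ + _) with 1; [apply sqrt_1|].
generalize (sin2_cos2 (2 * PI * IZR m * x)); unfold Rsqr; lra.
Qed.

Lemma cexp2pi_1 (m : Z) : cexp2pi m 1 = RtoC 1.
Proof.
assert (H : forall k : nat, cexp2pi (Z.of_nat k) 1 = RtoC 1).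
{ intros k; unfold cexp2pi, RtoC; rewrite <- INR_IZR_INZ.
  replace (2 * PI * INR k * 1) with (0 + 2 * INR k * PI) by ring.
  rewrite cos_period, sin_period, cos_0, sin_0; reflexivity. }
destruct (Z_le_dec 0 m) as [Hm|Hm].
- rewrite <- (Z2Nat.id m) by assumption; apply H.
- replace m with (- Z.of_nat (Z.to_nat (- m)))%Z by lia.
  rewrite <- cexp2pi_conj, H; unfold Cconj, RtoC; simpl; f_equal; ring.
Qed.

Lemma cexp2pi_periodic (m : Z) : periodic1 (cexp2pi m).
Proof. intros x; rewrite cexp2pi_add, cexp2pi_1; ring. Qed.

Lemma is_derive_cexp2pi_fst (m : Z) (x : R) :
  is_derive (fun t => fst (cexp2pi m t)) x (- (2 * PI * IZR m) * snd (cexp2pi m x)).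
Proof. unfold cexp2pi; simpl; auto_derive; [trivial|ring]. Qed.

Lemma is_derive_cexp2pi_snd (m : Z) (x : R) :
  is_derive (fun t => snd (cexp2pi m t)) x (2 * PI * IZR m * fst (cexp2pi m x)).
Proof. unfold cexp2pi; simpl; auto_derive; [trivial|ring]. Qed.

Lemma ccont_cexp2pi (m : Z) (x : R) : ccont (cexp2pi m) x.
Proof.
split.
- apply (ex_derive_continuous (V := R_NormedModule)); eexists; apply is_derive_cexp2pi_fst.
- apply (ex_derive_continuous (V := R_NormedModule)); eexists; apply is_derive_cexp2pi_snd.
Qed.

Lemma CInt_cexp2pi (m : Z) (a : R) : m <> 0%Z -> CInt (cexp2pi m) a (a + 1) = RtoC 0.
Proof.
intros Hm.
assert (Hw : 2 * PI * IZR m <> 0).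
{ apply Rmult_integral_contrapositive_currified;
    [generalize PI_RGT_0; lra|apply not_0_IZR, Hm]. }
assert (H : CInt (fun x => (0, 2 * PI * IZR m)%R * cexp2pi m x)%C a (a + 1) = RtoC 0).
{ rewrite (CInt_derive (cexp2pi m)); try lra.
  - rewrite cexp2pi_periodic; ring.
  - intros x _; simpl.
    evar_last; [apply is_derive_cexp2pi_fst|unfold cexp2pi; simpl; ring].
  - intros x _; simpl.
    evar_last; [apply is_derive_cexp2pi_snd|unfold cexp2pi; simpl; ring].
  - intros x _; apply ccont_mult; [apply ccont_const|apply ccont_cexp2pi]. }
rewrite CInt_scal in H by (try lra; intros x _; apply ccont_cexp2pi).
assert (Hnz : ((0, 2 * PI * IZR m)%R : C) <> RtoC 0) by (intros E; inversion E; lra).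
replace (CInt (cexp2pi m) a (a + 1)) with
  (/ (0, 2 * PI * IZR m)%R * ((0, 2 * PI * IZR m)%R * CInt (cexp2pi m) a (a + 1)))%C by (field; exact Hnz).
rewrite H; ring.
Qed.

(** The base point [a] is free because [inner] integrates over [-1/2, 1/2] and [fhat] over
    [0, 1]. *)
Lemma cexp2pi_orthonormal (j k : Z) (a : R) :
  CInt (fun x => cexp2pi j x * Cconj (cexp2pi k x))%C a (a + 1)
  = if Z.eq_dec j k then RtoC 1 else RtoC 0.
Proof.
rewrite (CInt_ext _ (cexp2pi (j - k))) by
  (try lra; intros; rewrite cexp2pi_conj, <- cexp2pi_addz; reflexivity).
destruct (Z.eq_dec j k) as [->|H].
- rewrite (CInt_ext _ (fun _ => RtoC 1)) by
    (try lra; intros; replace (k - k)%Z with 0%Z by lia; apply cexp2pi_0).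
  rewrite CInt_const by lra; replace (a + 1 - a) with 1 by ring; ring.
- apply CInt_cexp2pi; lia.
Qed.

(** * Trigonometric polynomials *)

(** Indexing the coefficients by [nat] presents trigonometric polynomials as the span of a finite
    sequence, the form in which [fspan] and [riesz_span] work. *)
Lemma trig_poly_nat (n : nat) (p : R -> C) :
  trig_poly n p <-> exists c : nat -> C, forall x,
    p x = csum (fun j => c j * cexp2pi (Z.of_nat j - Z.of_nat n) x)%C (2 * n + 1).
Proof.
split.
- intros [c Hc]; exists (fun j => c (Z.of_nat j - Z.of_nat n)%Z); exact Hc.
- intros [c Hc]; exists (fun z => c (Z.to_nat (z + Z.of_nat n))); intros x.
  rewrite Hc; apply csum_ext; intros k _; do 3 f_equal; lia.
Qed.

Lemma trig_poly_plus (n : nat) (p q : R -> C) :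
  trig_poly n p -> trig_poly n q -> trig_poly n (fun x => p x + q x)%C.
Proof.
intros [c Hc] [d Hd]; exists (fun z => c z + d z)%C; intros x.
rewrite Hc, Hd, <- csum_plus; apply csum_ext; intros; ring.
Qed.

Lemma trig_poly_scal (n : nat) (a : C) (p : R -> C) :
  trig_poly n p -> trig_poly n (fun x => a * p x)%C.
Proof.
intros [c Hc]; exists (fun z => a * c z)%C; intros x.
rewrite Hc, <- csum_scal; apply csum_ext; intros; ring.
Qed.

Lemma trig_poly_cexp2pi (n : nat) (m : Z) :
  (- Z.of_nat n <= m <= Z.of_nat n)%Z -> trig_poly n (cexp2pi m).
Proof.
intros Hm; exists (fun z => if Z.eq_dec z m then RtoC 1 else RtoC 0); intros x.
rewrite (csum_delta _ _ (Z.to_nat (m + Z.of_nat n))); [|lia|].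
- replace (Z.of_nat (Z.to_nat (m + Z.of_nat n)) - Z.of_nat n)%Z with m by lia.
  destruct (Z.eq_dec m m); [ring|contradiction].
- intros k Hk Hne; destruct (Z.eq_dec (Z.of_nat k - Z.of_nat n) m); [lia|ring].
Qed.

Lemma trig_poly_zero (n : nat) : trig_poly n (fun _ => RtoC 0).
Proof. exists (fun _ => RtoC 0); intros x; rewrite csum_scal; ring. Qed.

Lemma trig_poly_one (n : nat) : trig_poly n (fun _ => RtoC 1).
Proof.
replace (fun _ : R => RtoC 1) with (cexp2pi 0) by (extensionality x; apply cexp2pi_0).
apply trig_poly_cexp2pi; lia.
Qed.

Lemma trig_poly_csum (n : nat) (F : nat -> R -> C) (N : nat) :
  (forall k, (k < N)%nat -> trig_poly n (F k)) -> trig_poly n (fun x => csum (fun k => F k x) N).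
Proof.
induction N as [|N IH]; intros H; simpl; [apply trig_poly_zero|].
apply (trig_poly_plus n (fun x => csum (fun k => F k x) N) (F N)); [apply IH; intros|]; apply H; lia.
Qed.

Lemma ccont_trig_poly (n : nat) (p : R -> C) (x : R) : trig_poly n p -> ccont p x.
Proof.
intros [c Hc].
replace p with (fun x => csum (fun j => c (Z.of_nat j - Z.of_nat n)%Z * cexp2pi (Z.of_nat j - Z.of_nat n) x)%C (2 * n + 1))
  by (extensionality y; symmetry; apply Hc).
apply ccont_csum; intros; apply ccont_mult; [apply ccont_const|apply ccont_cexp2pi].
Qed.

Lemma trig_poly_periodic (n : nat) (p : R -> C) : trig_poly n p -> periodic1 p.
Proof.
intros [c Hc] x; rewrite !Hc; apply csum_ext; intros; rewrite cexp2pi_periodic; reflexivity.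
Qed.

(** The witness is the Dirichlet kernel [sum_j conj (e_j x) e_j]; orthonormality leaves only the
    terms [i = j] of the double sum. *)
Lemma trig_poly_repr (n : nat) (x : R) :
  exists k, trig_poly n k /\ forall p, trig_poly n p -> p x = inner p k.
Proof.
exists (fun y => csum (fun j => Cconj (cexp2pi (Z.of_nat j - Z.of_nat n) x) * cexp2pi (Z.of_nat j - Z.of_nat n) y)%C (2 * n + 1)).
split; [exists (fun z => Cconj (cexp2pi z x)); reflexivity|].
intros p Hp; assert (Hc := Hp); destruct Hc as [c Hc]; rewrite Hc.
change (inner p) with (fun g => CInt (fun x => p x * Cconj (g x))%C (-1/2) (1/2)); cbv beta.
replace (1/2) with (-1/2 + 1) by field.
rewrite (CInt_ext _ (fun y => csum (fun j => csum (fun i =>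
   (c (Z.of_nat i - Z.of_nat n)%Z * cexp2pi (Z.of_nat j - Z.of_nat n) x) *
   (cexp2pi (Z.of_nat i - Z.of_nat n) y * Cconj (cexp2pi (Z.of_nat j - Z.of_nat n) y)))%C (2 * n + 1)) (2 * n + 1))).
- rewrite CInt_csum; [|lra|].
  + apply csum_ext; intros j Hj.
    rewrite CInt_csum; [|lra|].
    * rewrite (csum_delta _ _ j Hj).
      -- rewrite CInt_scal, cexp2pi_orthonormal; [|lra|].
         ++ destruct (Z.eq_dec _ _); [ring|lia].
         ++ intros y _; apply ccont_mult; [|apply ccont_conj]; apply ccont_cexp2pi.
      -- intros i Hi Hne; rewrite CInt_scal, cexp2pi_orthonormal; [|lra|].
         ++ destruct (Z.eq_dec _ _); [lia|ring].
         ++ intros y _; apply ccont_mult; [|apply ccont_conj]; apply ccont_cexp2pi.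
    * intros i Hi y _; apply ccont_mult; [apply ccont_const|].
      apply ccont_mult; [|apply ccont_conj]; apply ccont_cexp2pi.
  + intros j Hj y _; apply ccont_csum; intros i Hi; apply ccont_mult; [apply ccont_const|].
    apply ccont_mult; [|apply ccont_conj]; apply ccont_cexp2pi.
- lra.
- intros y _; rewrite csum_conj, Hc, <- csum_scal; apply csum_ext; intros j Hj.
  rewrite Cmult_comm, <- csum_scal; apply csum_ext; intros i Hi.
  rewrite Cmult_conj, Cconj_conj; ring.
Qed.

Lemma repr_kernel_spec (n : nat) (x : R) :
  trig_poly n (repr_kernel n x) /\ forall p, trig_poly n p -> p x = inner p (repr_kernel n x).
Proof. unfold repr_kernel; apply epsilon_spec, trig_poly_repr. Qed.

(** * Riesz representation on a finite-dimensional span *)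

(** The generators may be linearly dependent; the cut at [m] is what the induction in [riesz_span]
    runs on. *)
Definition fspan (e : nat -> R -> C) (m : nat) (g : R -> C) : Prop :=
  exists c : nat -> C, forall x, g x = csum (fun j => c j * e j x)%C m.

Lemma fspan_S (e : nat -> R -> C) (m : nat) (g : R -> C) :
  fspan e m g -> fspan e (S m) g.
Proof.
intros [c Hc]; exists (fun j => if Nat.eq_dec j m then RtoC 0 else c j); intros x; simpl.
destruct (Nat.eq_dec m m); [|contradiction].
rewrite Hc, (csum_ext _ (fun j => (if Nat.eq_dec j m then RtoC 0 else c j) * e j x)%C); [ring|].
intros k Hk; destruct (Nat.eq_dec k m); [lia|reflexivity].
Qed.

Lemma fspan_le (e : nat -> R -> C) (m M : nat) (g : R -> C) :
  (m <= M)%nat -> fspan e m g -> fspan e M g.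
Proof. induction 1; intros; [assumption|]; apply fspan_S; auto. Qed.

Lemma fspan_lin (e : nat -> R -> C) (m : nat) (a : C) (g h : R -> C) :
  fspan e m g -> fspan e m h -> fspan e m (fun x => a * g x + h x)%C.
Proof.
intros [c Hc] [d Hd]; exists (fun j => a * c j + d j)%C; intros x.
rewrite Hc, Hd, <- csum_scal, <- csum_plus; apply csum_ext; intros; ring.
Qed.

Lemma fspan_gen (e : nat -> R -> C) (m j : nat) : (j < m)%nat -> fspan e m (e j).
Proof.
intros Hj; exists (fun i => if Nat.eq_dec i j then RtoC 1 else RtoC 0); intros x.
rewrite (csum_delta _ _ j Hj).
- destruct (Nat.eq_dec j j); [ring|contradiction].
- intros k _ Hk; destruct (Nat.eq_dec k j); [contradiction|ring].
Qed.

Lemma fspan_zero (e : nat -> R -> C) (m : nat) : fspan e m (fun _ => RtoC 0).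
Proof. exists (fun _ => RtoC 0); intros x; rewrite csum_scal; ring. Qed.

Definition conj_linear (V : (R -> C) -> Prop) (l : (R -> C) -> C) : Prop :=
  forall c g h, V g -> V h -> l (fun x => c * g x + h x)%C = (Cconj c * l g + l h)%C.

(** Gram-Schmidt, one generator at a time. Definiteness of [a] and conjugate linearity of [l] are
    required on the span of all [M] generators, while representation is proved on that of the first
    [m <= M]: the induction hypothesis is then available for the functional [a (e m)] as well as for
    [l]. *)
Lemma riesz_span (e : nat -> R -> C) (M : nat) (a : (R -> C) -> (R -> C) -> C)
  (a_lin : forall c g h k, a (fun x => c * g x + h x)%C k = (c * a g k + a h k)%C)
  (a_sym : forall g h, a g h = Cconj (a h g))
  (a_def : forall g, fspan e M g -> a g g = RtoC 0 -> forall x, g x = RtoC 0) :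
  forall m, (m <= M)%nat -> forall l, conj_linear (fspan e M) l ->
  exists g, fspan e m g /\ forall h, fspan e m h -> a g h = l h.
Proof.
assert (l_zero : forall l, conj_linear (fspan e M) l -> l (fun _ => RtoC 0) = RtoC 0).
{ intros l Hl.
  assert (H := Hl (RtoC (-1)) _ _ (fspan_zero e M) (fspan_zero e M)); cbv beta in H.
  replace (fun _ : R => (RtoC (-1) * RtoC 0 + RtoC 0)%C) with (fun _ : R => RtoC 0) in H
    by (extensionality x; ring).
  rewrite H; replace (Cconj (RtoC (-1))) with (RtoC (-1)) by (unfold Cconj, RtoC; simpl; f_equal; ring); ring. }
assert (a_clin : forall g, conj_linear (fspan e M) (a g)).
{ intros g c h k _ _; rewrite a_sym, a_lin, Cplus_conj, Cmult_conj, <- !a_sym; reflexivity. }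
induction m as [|m IH]; intros Hm l Hl.
- exists (fun _ => RtoC 0); split; [apply fspan_zero|]; intros h [c Hc].
  replace h with (fun _ : R => RtoC 0) by (extensionality x; symmetry; apply (Hc x)).
  rewrite (l_zero l Hl); apply l_zero, a_clin.
- assert (Hup : forall g, fspan e m g -> fspan e M g) by (intros; apply (fspan_le e m); [lia|assumption]).
  assert (He : fspan e M (e m)) by (apply fspan_gen; lia).
  (* Representing [a (e m)] on the first [m] generators yields the orthogonal projection [P] of
     [e m], so [e' = e m - P] is orthogonal to all of them. *)
  destruct (IH ltac:(lia) (a (e m)) (a_clin _)) as [P [HP1 HP2]].
  destruct (IH ltac:(lia) l Hl) as [g0 [Hg1 Hg2]].
  set (e' := fun x => (RtoC (-1) * P x + e m x)%C).
  assert (He' : fspan e M e') by (apply fspan_lin; auto).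
  assert (Horth : forall h, fspan e m h -> a e' h = RtoC 0).
  { intros h Hh; unfold e'; rewrite a_lin, (HP2 h Hh); ring. }
  assert (Horth' : forall h, fspan e m h -> a h e' = RtoC 0).
  { intros h Hh; rewrite a_sym, (Horth h Hh); unfold Cconj, RtoC; simpl; f_equal; ring. }
  (* If [e m] depends on the earlier generators, [e'] is zero and so is [l e']; otherwise one
     divides. *)
  assert (Hlam : exists lam, (lam * a e' e' = l e')%C).
  { destruct (classic (a e' e' = RtoC 0)) as [E|E].
    - exists (RtoC 0); rewrite E.
      replace e' with (fun _ : R => RtoC 0)
        by (extensionality x; symmetry; apply (a_def e' He' E)).
      rewrite (l_zero l Hl); ring.
    - exists (l e' / a e' e')%C; field; exact E. }
  destruct Hlam as [lam Hlam].
  exists (fun x => lam * e' x + g0 x)%C; split.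
  + apply fspan_lin; [|apply fspan_S, Hg1].
    apply fspan_lin; [apply fspan_S, HP1|apply fspan_gen; lia].
  + intros h [c Hc].
    assert (Hh1 : fspan e m (fun x => c m * P x + csum (fun j => c j * e j x) m)%C).
    { apply fspan_lin; [exact HP1|exists c; reflexivity]. }
    replace h with (fun x => c m * e' x + (c m * P x + csum (fun j => c j * e j x) m))%C
      by (extensionality x; rewrite (Hc x); unfold e'; simpl; ring).
    rewrite (a_clin _ (c m) e' _ He' (Hup _ Hh1)), (Hl (c m) e' _ He' (Hup _ Hh1)).
    rewrite !a_lin, Hlam, (Horth' g0 Hg1), (Horth _ Hh1), (Hg2 _ Hh1); ring.
Qed.

(** * The inner product over one period *)

Lemma inner_CInt (f g : R -> C) : inner f g = CInt (fun x => f x * Cconj (g x))%C (-1/2) (1/2).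
Proof. reflexivity. Qed.

Lemma Cconj_RtoC (r : R) : Cconj (RtoC r) = RtoC r.
Proof. unfold Cconj, RtoC; simpl; f_equal; ring. Qed.

Lemma inner_sym (f g : R -> C) : (forall x, ccont f x) -> (forall x, ccont g x) ->
  inner f g = Cconj (inner g f).
Proof.
intros Hf Hg; rewrite !inner_CInt, <- CInt_conj; [|lra|].
- apply CInt_ext; [lra|]; intros; rewrite Cmult_conj, Cconj_conj; ring.
- intros x _; apply ccont_mult; [|apply ccont_conj]; auto.
Qed.

Lemma inner_lin (c : C) (f g h : R -> C) :
  (forall x, ccont f x) -> (forall x, ccont g x) -> (forall x, ccont h x) ->
  inner (fun x => c * f x + g x)%C h = (c * inner f h + inner g h)%C.
Proof.
intros Hf Hg Hh; rewrite !inner_CInt.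
rewrite (CInt_ext _ (fun x => c * (f x * Cconj (h x)) + g x * Cconj (h x))%C) by (lra || intros; ring).
assert (H1 : ccont_on (fun x => f x * Cconj (h x))%C (-1/2) (1/2))
  by (intros x _; apply ccont_mult; [|apply ccont_conj]; auto).
rewrite CInt_plus, CInt_scal; [reflexivity|lra|exact H1|lra| |].
- intros x Hx; apply ccont_mult; [apply ccont_const|apply H1, Hx].
- intros x _; apply ccont_mult; [|apply ccont_conj]; auto.
Qed.

Lemma inner_scal (c : C) (f h : R -> C) :
  (forall x, ccont f x) -> (forall x, ccont h x) ->
  inner (fun x => c * f x)%C h = (c * inner f h)%C.
Proof.
intros Hf Hh; rewrite !inner_CInt.
rewrite (CInt_ext _ (fun x => c * (f x * Cconj (h x)))%C) by (lra || intros; ring).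
apply CInt_scal; [lra|]; intros x _; apply ccont_mult; [|apply ccont_conj]; auto.
Qed.

Lemma inner_csum (F : nat -> R -> C) (N : nat) (h : R -> C) :
  (forall k x, ccont (F k) x) -> (forall x, ccont h x) ->
  inner (fun x => csum (fun k => F k x) N) h = csum (fun k => inner (F k) h) N.
Proof.
intros Hf Hh; rewrite inner_CInt.
rewrite (CInt_ext _ (fun x => csum (fun k => F k x * Cconj (h x)) N)%C); [|lra|].
- rewrite CInt_csum; [reflexivity|lra|].
  intros k _ x _; apply ccont_mult; [|apply ccont_conj]; auto.
- intros x _; rewrite Cmult_comm, <- csum_scal; apply csum_ext; intros; ring.
Qed.

Lemma continuous_Cmod2 (f : R -> C) (x : R) : ccont f x -> continuous (fun t => Cmod (f t) ^ 2) x.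
Proof.
intros H; apply (continuous_ext (fun t => Cmod (f t) * Cmod (f t))); [intros; simpl; ring|].
apply (continuous_mult (K := R_AbsRing)); apply continuous_Cmod, H.
Qed.

Lemma RInt_lin (c d : R) (f g : R -> R) (a b : R) : a <= b ->
  (forall x, a <= x <= b -> continuous f x) -> (forall x, a <= x <= b -> continuous g x) ->
  RInt (fun x => c * f x + d * g x) a b = c * RInt f a b + d * RInt g a b.
Proof.
intros Hab Hf Hg.
assert (E1 : ex_RInt f a b) by (apply (ex_RInt_continuous (V := R_CompleteNormedModule));
  rewrite Rmin_left, Rmax_right by assumption; auto).
assert (E2 : ex_RInt g a b) by (apply (ex_RInt_continuous (V := R_CompleteNormedModule));
  rewrite Rmin_left, Rmax_right by assumption; auto).
rewrite (RInt_plus (V := R_CompleteNormedModule) (fun x => c * f x) (fun x => d * g x)).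
- unfold plus; simpl; f_equal; apply (RInt_scal (V := R_CompleteNormedModule)); assumption.
- apply (ex_RInt_scal (V := R_NormedModule)); assumption.
- apply (ex_RInt_scal (V := R_NormedModule)); assumption.
Qed.

(* AM-GM with a free parameter [t] replaces the Cauchy-Schwarz inequality. *)
Lemma Cmod_inner_le (t : R) (f g : R -> C) : 0 < t ->
  (forall x, ccont f x) -> (forall x, ccont g x) ->
  Cmod (inner f g) <= t / 2 * L2sq f + / (2 * t) * L2sq g.
Proof.
intros Ht Hf Hg; rewrite inner_CInt; unfold L2sq.
rewrite <- RInt_lin by (lra || intros; apply continuous_Cmod2; auto).
apply Cmod_CInt_le.
- lra.
- intros x _; apply ccont_mult; [|apply ccont_conj]; auto.
- intros x _; apply (continuous_plus (fun y => t / 2 * Cmod (f y) ^ 2) (fun y => / (2 * t) * Cmod (g y) ^ 2));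
    apply (continuous_scal_r (V := R_NormedModule)), continuous_Cmod2; auto.
- intros x _; rewrite Cmod_mult, Cmod_conj.
  apply Rminus_le_0.
  replace (_ - _) with (/ (2 * t) * (t * Cmod (f x) - Cmod (g x)) ^ 2) by (field; lra).
  apply Rmult_le_pos; [left; apply Rinv_0_lt_compat; lra|apply pow2_ge_0].
Qed.

(** * The sampling form, the frame operator and the dual frame *)

(** This is [<S_n g, h>] on trigonometric polynomials, by [frame_op_samp_form]; its diagonal is the
    middle term of the Marcinkiewicz-Zygmund inequalities. *)
Definition samp_form (N : nat) (pts wts : nat -> R) (g h : R -> C) : C :=
  csum (fun k => RtoC (wts k) * (g (pts k) * Cconj (h (pts k))))%C N.

Lemma samp_form_diag (N : nat) (pts wts : nat -> R) (g : R -> C) :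
  samp_form N pts wts g g = RtoC (rsum (fun k => Cmod (g (pts k)) ^ 2 * wts k) N).
Proof.
unfold samp_form; rewrite <- csum_RtoC; apply csum_ext; intros.
rewrite RtoC_mult, <- Cmod2_conj; ring.
Qed.

(** By the reproducing property [g x = <g, k>], and [Cmod_inner_le] bounds this by [L2sq k / (2 t)]
    for every [t > 0]. If [<g, k>] were non-zero, [t = L2sq k / |<g, k>|] would bound it by half of
    itself. *)
Lemma trig_poly_L2_zero (n : nat) (g : R -> C) :
  trig_poly n g -> L2sq g <= 0 -> forall x, g x = RtoC 0.
Proof.
intros Hg H0 x; destruct (repr_kernel_spec n x) as [K1 K2].
apply Cmod_eq_0; rewrite (K2 g Hg).
set (k := repr_kernel n x) in *.
assert (Hle : forall t, 0 < t -> Cmod (inner g k) <= / (2 * t) * L2sq k).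
{ intros t Ht; eapply Rle_trans.
  - apply (Cmod_inner_le t); [assumption| |]; intros; eapply ccont_trig_poly; eassumption.
  - assert (t / 2 * L2sq g <= 0) by (apply Ropp_le_cancel; rewrite Ropp_0, Ropp_mult_distr_r;
      apply Rmult_le_pos; lra). lra. }
apply Rle_antisym; [|apply Cmod_ge_0].
apply Rnot_lt_le; intros Hpos.
assert (HL : 0 < L2sq k).
{ specialize (Hle 1 ltac:(lra)); lra. }
specialize (Hle (L2sq k / Cmod (inner g k)) ltac:(apply Rdiv_lt_0_compat; assumption)).
replace (/ (2 * (L2sq k / Cmod (inner g k))) * L2sq k) with (Cmod (inner g k) / 2) in Hle
  by (field; lra).
lra.
Qed.

Lemma trig_poly_fspan (n : nat) (p : R -> C) :
  trig_poly n p <-> fspan (fun j => cexp2pi (Z.of_nat j - Z.of_nat n)) (2 * n + 1) p.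
Proof. apply trig_poly_nat. Qed.

(** Weak solvability of [S_n g = P_n b], with [P_n] the orthogonal projection onto degree [n];
    definiteness comes from the lower inequality and [trig_poly_L2_zero]. It is applied to
    [b = sqrt tau_k * k_x] for the dual frame and to [b = 1] for [u]. *)
Lemma samp_form_riesz (L : nat -> nat) (xs tau : nat -> nat -> R) (A B : R)
  (hMZ : MZ_family L xs tau A B) (n : nat) (b : R -> C) : (1 <= n)%nat -> (forall x, ccont b x) ->
  exists g, trig_poly n g /\
    forall h, trig_poly n h -> samp_form (L n) (xs n) (tau n) g h = inner b h.
Proof.
intros Hn Hb; destruct hMZ as [HA [HB [Htau HMZ]]].
destruct (riesz_span (fun j => cexp2pi (Z.of_nat j - Z.of_nat n)) (2 * n + 1)
  (samp_form (L n) (xs n) (tau n))) with (m := (2 * n + 1)%nat) (l := inner b) as [g [G1 G2]].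
- intros c g h k; unfold samp_form; rewrite <- csum_scal, <- csum_plus.
  apply csum_ext; intros; ring.
- intros g h; unfold samp_form; rewrite csum_conj; apply csum_ext; intros.
  rewrite !Cmult_conj, Cconj_conj, Cconj_RtoC; ring.
- intros g Hg E; apply trig_poly_fspan in Hg.
  apply (trig_poly_L2_zero n); [assumption|].
  rewrite samp_form_diag in E; apply RtoC_inj in E.
  destruct (HMZ n g Hn Hg) as [H1 _]; rewrite E in H1.
  apply Rmult_le_reg_l with A; lra.
- lia.
- intros c g h Hg Hh; apply trig_poly_fspan in Hg; apply trig_poly_fspan in Hh.
  assert (Cg := fun x => ccont_trig_poly n g x Hg).
  assert (Ch := fun x => ccont_trig_poly n h x Hh).
  rewrite inner_sym, inner_lin, Cplus_conj, Cmult_conj, <- !inner_sym; auto.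
  intros x; apply ccont_plus; [apply ccont_mult; [apply ccont_const|]|]; auto.
- exists g; split; [apply trig_poly_fspan, G1|]; intros h Hh; apply G2, trig_poly_fspan, Hh.
Qed.

Lemma ccont_repr_kernel (n : nat) (x y : R) : ccont (repr_kernel n x) y.
Proof. apply (ccont_trig_poly n), repr_kernel_spec. Qed.

Lemma inner_repr_kernel (n : nat) (x : R) (h : R -> C) : trig_poly n h ->
  inner (repr_kernel n x) h = Cconj (h x).
Proof.
intros Hh; rewrite inner_sym.
- rewrite <- (proj2 (repr_kernel_spec n x) h Hh); reflexivity.
- apply ccont_repr_kernel.
- intros y; apply (ccont_trig_poly n), Hh.
Qed.

(** At each node the reproducing property is used twice, once for [g] and once for [h]. *)
Lemma frame_op_samp_form (L : nat -> nat) (xs tau : nat -> nat -> R) (n : nat) (g h : R -> C) :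
  trig_poly n g -> trig_poly n h ->
  inner (frame_op L xs tau n g) h = samp_form (L n) (xs n) (tau n) g h.
Proof.
intros Hg Hh; unfold frame_op.
assert (Ch := fun x => ccont_trig_poly n h x Hh).
rewrite inner_csum; [|intros k x; apply ccont_mult; [apply ccont_const|apply ccont_repr_kernel]|exact Ch].
apply csum_ext; intros k Hk.
rewrite inner_scal, inner_repr_kernel; [|assumption|apply ccont_repr_kernel|exact Ch].
rewrite <- (proj2 (repr_kernel_spec n (xs n k)) g Hg); ring.
Qed.

Lemma trig_poly_frame_op (L : nat -> nat) (xs tau : nat -> nat -> R) (n : nat) (g : R -> C) :
  trig_poly n (frame_op L xs tau n g).
Proof.
apply trig_poly_csum; intros k _; apply trig_poly_scal, repr_kernel_spec.
Qed.

(** Both sides of the equation are trigonometric polynomials of degree [n], so the weak equation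
    becomes a pointwise one on testing it against the kernel at [y]. *)
Lemma dual_frame_spec (L : nat -> nat) (xs tau : nat -> nat -> R) (A B : R)
  (hMZ : MZ_family L xs tau A B) (n k : nat) : (1 <= n)%nat ->
  trig_poly n (dual_frame L xs tau n k) /\
  forall y, frame_op L xs tau n (dual_frame L xs tau n k) y
            = Cmult (RtoC (sqrt (tau n k))) (repr_kernel n (xs n k) y).
Proof.
intros Hn; unfold dual_frame; apply epsilon_spec.
set (b := fun y => (RtoC (sqrt (tau n k)) * repr_kernel n (xs n k) y)%C).
assert (Hb : trig_poly n b) by (apply trig_poly_scal, repr_kernel_spec).
destruct (samp_form_riesz L xs tau A B hMZ n b Hn) as [g [G1 G2]].
{ intros x; apply (ccont_trig_poly n), Hb. }
exists g; split; [exact G1|]; intros y.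
rewrite (proj2 (repr_kernel_spec n y) _ (trig_poly_frame_op L xs tau n g)).
rewrite frame_op_samp_form, G2; try apply repr_kernel_spec; try assumption.
symmetry; apply (proj2 (repr_kernel_spec n y) b Hb).
Qed.

Lemma samp_form_dual_frame (L : nat -> nat) (xs tau : nat -> nat -> R) (A B : R)
  (hMZ : MZ_family L xs tau A B) (n k : nat) (h : R -> C) : (1 <= n)%nat -> trig_poly n h ->
  samp_form (L n) (xs n) (tau n) (dual_frame L xs tau n k) h
  = (RtoC (sqrt (tau n k)) * Cconj (h (xs n k)))%C.
Proof.
intros Hn Hh; destruct (dual_frame_spec L xs tau A B hMZ n k Hn) as [D1 D2].
rewrite <- frame_op_samp_form by assumption.
replace (frame_op L xs tau n (dual_frame L xs tau n k))
  with (fun y => RtoC (sqrt (tau n k)) * repr_kernel n (xs n k) y)%C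
  by (extensionality y; symmetry; apply D2).
rewrite inner_scal, inner_repr_kernel; auto.
- apply ccont_repr_kernel.
- intros y; apply (ccont_trig_poly n), Hh.
Qed.

(** * The quadrature weights and the error bound *)

Lemma L2sq_one : L2sq (fun _ => RtoC 1) = 1.
Proof.
unfold L2sq; rewrite RInt_const, Cmod_1; unfold scal; simpl; unfold mult; simpl; field.
Qed.

Lemma samp_form_sym (N : nat) (pts wts : nat -> R) (g h : R -> C) :
  samp_form N pts wts g h = Cconj (samp_form N pts wts h g).
Proof.
unfold samp_form; rewrite csum_conj; apply csum_ext; intros.
rewrite !Cmult_conj, Cconj_conj, Cconj_RtoC; ring.
Qed.

Lemma CInt_inner_one (f : R -> C) : CInt f (-1/2) (1/2) = inner f (fun _ => RtoC 1).
Proof. rewrite inner_CInt; apply CInt_ext; [lra|]; intros; rewrite Cconj_RtoC; ring. Qed.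

(** The hypothesis on [u] is the weak form of [S_n u = 1]. With [e_k] the dual frame, [<e_k, 1>] is
    the conjugate of [<1, e_k> = <S_n u, e_k>], hence equals
    [<S_n e_k, u> = sqrt tau_k * conj (u x_k)]. *)
Lemma qweight_eq (L : nat -> nat) (xs tau : nat -> nat -> R) (A B : R)
  (hMZ : MZ_family L xs tau A B) (n k : nat) (u : R -> C) : (1 <= n)%nat -> (k < L n)%nat ->
  trig_poly n u ->
  (forall h, trig_poly n h ->
     samp_form (L n) (xs n) (tau n) u h = inner (fun _ => RtoC 1) h) ->
  qweight L xs tau n k = (RtoC (tau n k) * Cconj (u (xs n k)))%C.
Proof.
intros Hn Hk Hu Hs; destruct (dual_frame_spec L xs tau A B hMZ n k Hn) as [D1 _].
unfold qweight.
change (RInt (V := C_R_CompleteNormedModule) ?f ?a ?b) with (CInt f a b).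
rewrite CInt_inner_one, inner_sym, <- Hs, <- samp_form_sym.
- rewrite (samp_form_dual_frame L xs tau A B) by assumption.
  rewrite Cmult_assoc, <- RtoC_mult, sqrt_sqrt; [reflexivity|].
  destruct hMZ as [_ [_ [Ht _]]]; left; auto.
- exact D1.
- intros y; apply (ccont_trig_poly n), D1.
- intros y; apply ccont_const.
Qed.

(** A numerical majorant [E] of [|f - p|], instead of an infimum, lets every estimate of the theorem
    use the same bound: the integral contributes [E], the quadrature rule [E] times the sum of the
    [|w_k|]. *)
Lemma quad_error (L : nat -> nat) (xs tau : nat -> nat -> R) (A B : R)
  (hMZ : MZ_family L xs tau A B) (n : nat) (f p : R -> C) (E : R) : (1 <= n)%nat ->
  (forall x, ccont f x) -> trig_poly n p -> (forall x, Cmod (f x - p x)%C <= E) ->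
  Cmod (Cminus (Iint f) (quad L xs tau n f)) <= (1 + sqrt (B / A)) * E.
Proof.
intros Hn Hf Hp HE.
destruct (samp_form_riesz L xs tau A B hMZ n (fun _ => RtoC 1) Hn) as [u [U1 U2]];
  [intros; apply ccont_const|].
assert (HA : 0 < A) by apply hMZ; assert (HB : 0 < B) by apply hMZ.
assert (Htau : forall k, (k < L n)%nat -> 0 < tau n k) by (intros; apply hMZ; assumption).
assert (HMZ := fun p => proj2 (proj2 (proj2 hMZ)) n p Hn).
assert (Cu := fun x => ccont_trig_poly n u x U1).
assert (Cp := fun x => ccont_trig_poly n p x Hp).
(* The rule pairs the samples with [u]; its exactness on [p], shown next, is then the equation
   defining [u]. *)
assert (Q : forall g, quad L xs tau n g = samp_form (L n) (xs n) (tau n) g u).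
{ intros g; unfold quad, samp_form; apply csum_ext; intros k Hk.
  rewrite (qweight_eq L xs tau A B hMZ n k u) by assumption; ring. }
assert (Qp : quad L xs tau n p = CInt p (-1/2) (1/2)).
{ rewrite Q, samp_form_sym, U2, CInt_inner_one by assumption.
  symmetry; apply inner_sym; [exact Cp|intros; apply ccont_const]. }
set (s := rsum (fun k => Cmod (u (xs n k)) ^ 2 * tau n k) (L n)).
assert (Hs0 : 0 <= s).
{ apply rsum_nonneg; intros k Hk; apply Rmult_le_pos; [apply pow2_ge_0|left; auto]. }
(* Here [s = <1, u>], so [Cmod_inner_le] with [t = / A] gives [s <= 1 / (2 A) + A / 2 * L2sq u], and
   the lower inequality bounds the last term by [s / 2]. *)
assert (Hs : s <= / A).
{ assert (Hs1 : s <= A / 2 * L2sq u + / (2 * A) * L2sq (fun _ => RtoC 1)).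
  { rewrite <- (Rabs_pos_eq s Hs0), <- Cmod_R; unfold s.
    rewrite <- samp_form_diag, samp_form_sym, U2, Cmod_conj by assumption.
    eapply Rle_trans; [apply (Cmod_inner_le (/ A)); [apply Rinv_0_lt_compat; lra|intros; apply ccont_const|exact Cu]|].
    right; field; lra. }
  rewrite L2sq_one in Hs1; destruct (HMZ u U1) as [H1 _]; fold s in H1.
  assert (/ (2 * A) = / A / 2) by (field; lra). lra. }
assert (Ht : rsum (tau n) (L n) <= B).
{ destruct (HMZ _ (trig_poly_one n)) as [_ H2]; rewrite L2sq_one, Rmult_1_r in H2.
  rewrite (rsum_ext _ (tau n)) in H2; [exact H2|]; intros; rewrite Cmod_1; ring. }
assert (HEp : 0 <= E) by (eapply Rle_trans; [apply Cmod_ge_0|apply (HE 0)]).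
(* Each weight is split as [sqrt tau * sqrt tau], so that Cauchy-Schwarz produces the two sums just
   bounded by [B] and [/ A]. *)
assert (Hst : rsum (fun k => tau n k * Cmod (u (xs n k))) (L n) <= sqrt (B / A)).
{ rewrite (rsum_ext _ (fun k => sqrt (tau n k) * (sqrt (tau n k) * Cmod (u (xs n k))))).
  - eapply Rle_trans; [apply rsum_Cauchy_Schwarz|].
    unfold Rdiv; rewrite sqrt_mult_alt by lra.
    apply Rmult_le_compat; try apply sqrt_pos; apply sqrt_le_1_alt.
    + rewrite (rsum_ext _ (tau n)); [exact Ht|]; intros; apply pow2_sqrt; left; auto.
    + rewrite (rsum_ext _ (fun k => Cmod (u (xs n k)) ^ 2 * tau n k)); [exact Hs|].
      intros; rewrite Rpow_mult_distr, pow2_sqrt by (left; auto); ring.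
  - intros; rewrite <- Rmult_assoc, sqrt_sqrt by (left; auto); reflexivity. }
change (Iint f) with (CInt f (-1/2) (1/2)).
replace (CInt f (-1/2) (1/2) - quad L xs tau n f)%C with
  (CInt (fun x => f x - p x) (-1/2) (1/2)
   + - csum (fun k => (f (xs n k) - p (xs n k)) * (RtoC (tau n k) * Cconj (u (xs n k)))) (L n))%C.
- eapply Rle_trans; [apply Cmod_triangle|]; rewrite Cmod_opp, Rmult_plus_distr_r, Rmult_1_l.
  apply Rplus_le_compat.
  + replace E with ((1/2 - -1/2) * E) by field.
    apply Cmod_CInt_le_const; [lra| |auto].
    intros x _; apply ccont_minus; auto.
  + eapply Rle_trans; [apply Cmod_csum_le|].
    eapply Rle_trans; [apply (rsum_le _ (fun k => E * (tau n k * Cmod (u (xs n k)))))|].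
    * intros k Hk; rewrite !Cmod_mult, Cmod_R, Cmod_conj, (Rabs_pos_eq (tau n k)) by (left; auto).
      apply Rmult_le_compat_r; [apply Rmult_le_pos; [left; auto|apply Cmod_ge_0]|auto].
    * rewrite rsum_scal, Rmult_comm; apply Rmult_le_compat_r; assumption.
- rewrite CInt_minus; [|lra|intros x _; auto|intros x _; auto].
  rewrite <- Qp, !Q; unfold samp_form.
  rewrite (csum_ext (fun k => (f (xs n k) - p (xs n k)) * (tau n k * Cconj (u (xs n k))))%C
    (fun k => tau n k * (f (xs n k) * Cconj (u (xs n k))) + RtoC (-1) * (tau n k * (p (xs n k) * Cconj (u (xs n k)))))%C)
    by (intros; ring).
  rewrite csum_plus, csum_scal; ring.
Qed.

Lemma csum_mult (F G : nat -> C) (N M : nat) :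
  (csum F N * csum G M)%C = csum (fun j => csum (fun k => F j * G k)%C M) N.
Proof.
induction N as [|N IH]; simpl; [ring|]; rewrite csum_scal, <- IH; ring.
Qed.

(** * Approximation by Korovkin's kernel *)

(** The convolution of [f] with [|sum_j a_j e_j|^2], written through Fourier coefficients: the
    degree, at most [N - 1], is visible here, and positivity of the kernel in
    [sq_modulus_kernel_CInt]. *)
Definition sq_modulus_kernel (a : nat -> R) (N : nat) (f : R -> C) (x : R) : C :=
  csum (fun j => csum (fun k => RtoC (a j * a k) *
    (fhat f (Z.of_nat j - Z.of_nat k) * cexp2pi (Z.of_nat j - Z.of_nat k) x))%C N) N.

Definition qpoly (a : nat -> R) (N : nat) (t : R) : C :=
  csum (fun j => RtoC (a j) * cexp2pi (Z.of_nat j) t)%C N.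

Lemma fhat_CInt (f : R -> C) (m : Z) : fhat f m = CInt (fun x => f x * Cconj (cexp2pi m x))%C 0 1.
Proof. reflexivity. Qed.

Lemma ccont_shift (g : R -> C) (x s : R) : (forall y, ccont g y) -> ccont (fun t => g (x - t)) s.
Proof.
intros H; apply (ccont_comp g (fun t => x - t)); [apply H|].
apply (continuous_minus (V := R_NormedModule) (fun _ => x) (fun t => t)); [apply continuous_const|apply continuous_id].
Qed.

Lemma ccont_qpoly (a : nat -> R) (N : nat) (t : R) : ccont (qpoly a N) t.
Proof.
apply ccont_csum; intros; apply ccont_mult; [apply ccont_const|apply ccont_cexp2pi].
Qed.

Lemma trig_poly_sq_modulus_kernel (a : nat -> R) (n : nat) (f : R -> C) :
  trig_poly n (sq_modulus_kernel a (S n) f).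
Proof.
apply trig_poly_csum; intros j Hj; apply trig_poly_csum; intros k Hk.
apply trig_poly_scal, trig_poly_scal, trig_poly_cexp2pi; lia.
Qed.

Lemma sq_modulus_kernel_CInt (a : nat -> R) (N : nat) (f : R -> C) (x : R) :
  (forall s, ccont f s) ->
  sq_modulus_kernel a N f x = CInt (fun s => f s * RtoC (Cmod (qpoly a N (x - s)) ^ 2))%C 0 1.
Proof.
intros Hf.
assert (Hc : forall m, ccont_on (fun s => f s * Cconj (cexp2pi m s))%C 0 1).
{ intros m s _; apply ccont_mult; [apply Hf|apply ccont_conj, ccont_cexp2pi]. }
rewrite (CInt_ext _ (fun s => csum (fun j => csum (fun k =>
  (RtoC (a j * a k) * cexp2pi (Z.of_nat j - Z.of_nat k) x) *
  (f s * Cconj (cexp2pi (Z.of_nat j - Z.of_nat k) s)))%C N) N)); [|lra|].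
- rewrite CInt_csum; [|lra|].
  + apply csum_ext; intros j _; rewrite CInt_csum; [|lra|].
    * apply csum_ext; intros k _; rewrite CInt_scal, <- fhat_CInt; [ring|lra|apply Hc].
    * intros k _ s Hs; apply ccont_mult; [apply ccont_const|apply Hc, Hs].
  + intros j _ s Hs; apply ccont_csum; intros k _.
    apply ccont_mult; [apply ccont_const|apply Hc, Hs].
- intros s _; rewrite Cmod2_conj; unfold qpoly; rewrite csum_conj, csum_mult, <- csum_scal.
  apply csum_ext; intros j _; rewrite <- csum_scal; apply csum_ext; intros k _.
  rewrite !Cmult_conj, Cconj_RtoC, !cexp2pi_conj, RtoC_mult.
  unfold Rminus, Z.sub; rewrite !cexp2pi_add, !cexp2pi_addz, !cexp2pi_opp.
  rewrite Z.opp_add_distr, cexp2pi_addz; ring.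
Qed.

(** The integral is the operator applied to the constant 1, where only the diagonal [j = k]
    survives. *)
Lemma qpoly_Parseval (a : nat -> R) (N : nat) (x : R) :
  RInt (fun s => Cmod (qpoly a N (x - s)) ^ 2) 0 1 = rsum (fun j => a j ^ 2) N.
Proof.
apply RtoC_inj; rewrite <- CInt_RtoC; [|lra|].
- rewrite (CInt_ext _ (fun s => RtoC 1 * RtoC (Cmod (qpoly a N (x - s)) ^ 2))%C)
    by (lra || intros; symmetry; apply Cmult_1_l).
  rewrite <- (sq_modulus_kernel_CInt a N (fun _ => RtoC 1)) by (intros; apply ccont_const).
  rewrite <- csum_RtoC; apply csum_ext; intros j Hj.
  assert (Hh : forall m, fhat (fun _ => RtoC 1) m = if Z.eq_dec 0 m then RtoC 1 else RtoC 0).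
  { intros m; rewrite fhat_CInt.
    rewrite <- (cexp2pi_orthonormal 0 m 0), Rplus_0_l.
    apply CInt_ext; [lra|]; intros; rewrite cexp2pi_0; reflexivity. }
  rewrite (csum_delta _ _ j Hj).
  + rewrite Hh; destruct (Z.eq_dec _ _); [|lia].
    replace (a j ^ 2) with (a j * a j) by ring.
    replace (Z.of_nat j - Z.of_nat j)%Z with 0%Z by lia; rewrite cexp2pi_0, !RtoC_mult; ring.
  + intros k _ Hk; rewrite Hh; destruct (Z.eq_dec _ _); [lia|ring].
- intros s _; apply (continuous_Cmod2 (fun s => qpoly a N (x - s))), ccont_shift.
  intros; apply ccont_qpoly.
Qed.

(** The periodic substitute for [t ^ 2]. As [2 * versin = |1 - e_1|^2], its integral against [|q|^2]
    is again an instance of Parseval, for the polynomial [(1 - e_1) q]. *)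
Definition versin (t : R) : R := 1 - fst (cexp2pi 1 t).

Lemma versin_Cmod (t : R) : Cmod (RtoC 1 - cexp2pi 1 t)%C ^ 2 = 2 * versin t.
Proof.
rewrite Cmod2_alt; unfold versin, cexp2pi, Cminus, Cplus, Copp; simpl.
generalize (sin2_cos2 (2 * PI * 1 * t)); unfold Rsqr; lra.
Qed.

(** Since [2 * versin t = (2 sin (pi t))^2], it is enough that [t <= 2 sin (pi t)] on [0, 1/2]. With
    [y = pi t] one has [2 t <= y <= 2], and [sin y >= y - y^3 / 6 >= y / 3]. *)
Lemma versin_lower (t : R) : Rabs t <= 1/2 -> t ^ 2 <= 2 * versin t.
Proof.
assert (H : forall t, 0 <= t <= 1/2 -> t ^ 2 <= 2 * versin t).
{ clear t; intros t Ht; unfold versin, cexp2pi; simpl fst.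
  replace (2 * PI * 1 * t) with (2 * (PI * t)) by ring; rewrite cos_2a_sin.
  assert (P1 := PI_4); assert (P2 := PI2_1).
  set (y := PI * t).
  assert (Hy : 2 * t <= y <= 2).
  { unfold y; split; [apply Rmult_le_compat_r; lra|].
    apply Rle_trans with (4 * (1 / 2)); [apply Rmult_le_compat; lra|lra]. }
  assert (Hs : y - y ^ 3 / 6 <= sin y).
  { destruct (pre_sin_bound y 0) as [H1 _]; [lra|lra|].
    unfold sin_approx, sin_term in H1; simpl in H1.
    eapply Rle_trans; [|exact H1]; right; simpl; field. }
  assert (Hy3 : y ^ 3 <= 4 * y).
  { replace (y ^ 3) with (y ^ 2 * y) by ring; apply Rmult_le_compat_r; [lra|].
    replace 4 with (2 ^ 2) by ring; apply pow_incr; lra. }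
  assert (Ht' : t <= 2 * sin y) by lra.
  replace (2 * (1 - (1 - 2 * sin y * sin y))) with ((2 * sin y) ^ 2) by ring.
  apply pow_incr; lra. }
intros Ht; destruct (Rle_dec 0 t) as [H0|H0].
- apply H; rewrite Rabs_pos_eq in Ht by assumption; lra.
- replace (versin t) with (versin (- t)).
  + replace (t ^ 2) with ((- t) ^ 2) by ring; apply H.
    rewrite Rabs_left in Ht by lra; lra.
  + unfold versin; rewrite cexp2pi_opp, <- cexp2pi_conj; reflexivity.
Qed.

(* The coefficients of [(1 - e_1) q], for [a] vanishing at [N]. *)
Lemma qpoly_difference (a : nat -> R) (N : nat) (t : R) : a N = 0 ->
  ((RtoC 1 - cexp2pi 1 t) * qpoly a N t)%C
  = qpoly (fun j => match j with O => a O | S i => a (S i) - a i end) (S N) t.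
Proof.
intros HN; set (b := fun j => match j with O => a O | S i => a (S i) - a i end).
assert (H : forall M, qpoly b (S M) t
  = ((RtoC 1 - cexp2pi 1 t) * qpoly a M t + RtoC (a M) * cexp2pi (Z.of_nat M) t)%C).
{ induction M as [|M IH].
  - unfold qpoly; simpl; ring.
  - change (qpoly b (S (S M)) t) with (qpoly b (S M) t + RtoC (b (S M)) * cexp2pi (Z.of_nat (S M)) t)%C.
    rewrite IH; change (qpoly a (S M) t) with (qpoly a M t + RtoC (a M) * cexp2pi (Z.of_nat M) t)%C.
    unfold b; replace (Z.of_nat (S M)) with (1 + Z.of_nat M)%Z by lia.
    rewrite cexp2pi_addz, RtoC_minus; ring. }
rewrite H, HN; ring.
Qed.

(** The [a_j] form the first Dirichlet eigenvector of the discrete Laplacian on [n + 1] points, the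
    unit vector of least difference energy. That energy is [2 (1 - cos th) = (2 sin (th / 2))^2 <=
    th^2], and 16 comes from [pi <= 4]. The shifted sequence [s j = sin (j th)] vanishes at both
    ends, [0] and [n + 2]. *)
Lemma korovkin_weights (n : nat) : (1 <= n)%nat -> exists a : nat -> R,
  rsum (fun j => a j ^ 2) (S n) = 1 /\ a (S n) = 0 /\
  rsum (fun j => match j with O => a O | S i => a (S i) - a i end ^ 2) (S (S n)) <= 16 / INR n ^ 2.
Proof.
intros Hn; set (th := PI / INR (n + 2)); set (s := fun j => sin (INR j * th)).
assert (Hn0 : 1 <= INR n) by (apply (le_INR 1), Hn).
assert (Hn2 : INR (n + 2) = INR n + 2) by (rewrite plus_INR; simpl; ring).
assert (Hpi := PI_RGT_0).
assert (Hth : 0 < th) by (apply Rdiv_lt_0_compat; lra).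
assert (Hth' : th <= 4 / INR n).
{ unfold th, Rdiv; rewrite Hn2; apply Rmult_le_compat; try lra.
  - left; apply Rinv_0_lt_compat; lra.
  - exact PI_4.
  - apply Rinv_le_contravar; lra. }
assert (Hrec : forall j, s (S (S j)) + s j = 2 * cos th * s (S j)).
{ intros j; unfold s; rewrite !S_INR.
  replace ((INR j + 1 + 1) * th) with ((INR j + 1) * th + th) by ring.
  replace (INR j * th) with ((INR j + 1) * th - th) by ring.
  rewrite sin_plus, sin_minus; ring. }
assert (Hs0 : s O = 0) by (unfold s; simpl; rewrite Rmult_0_l; apply sin_0).
assert (Hend : s (S (S n)) = 0).
{ unfold s; replace (INR (S (S n)) * th) with PI; [apply sin_PI|].
  unfold th; replace (S (S n)) with (n + 2)%nat by lia; field; lra. }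
set (Sg := rsum (fun j => s (S j) ^ 2) (S n)).
assert (HSg : 0 < Sg).
{ unfold Sg.
  assert (H : forall m, (m <= n)%nat -> 0 < rsum (fun j => s (S j) ^ 2) (S m)); [|apply H; lia].
  induction m as [|m IH]; intros Hm.
  - change (0 < 0 + s 1%nat ^ 2); rewrite Rplus_0_l; apply pow_lt; unfold s; simpl; rewrite Rmult_1_l.
    apply sin_gt_0; [assumption|].
    unfold th; rewrite Hn2; apply Rmult_lt_reg_r with (INR n + 2); [lra|].
    unfold Rdiv; rewrite Rmult_assoc, Rinv_l by lra; nra.
  - change (rsum (fun j => s (S j) ^ 2) (S (S m))) with
      (rsum (fun j => s (S j) ^ 2) (S m) + s (S (S m)) ^ 2).
    generalize (IH ltac:(lia)) (pow2_ge_0 (s (S (S m)))); lra. }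
(* Summation by parts, with the discrete eigenvalue equation [Hrec]. *)
assert (Hdiff : forall M, rsum (fun j => (s (S j) - s j) ^ 2) (S M)
  = s (S M) * (s (S M) - s M) + 2 * (1 - cos th) * rsum (fun j => s (S j) ^ 2) M).
{ induction M as [|M IH].
  - simpl; rewrite Hs0; ring.
  - change (rsum (fun j => (s (S j) - s j) ^ 2) (S (S M))) with
      (rsum (fun j => (s (S j) - s j) ^ 2) (S M) + (s (S (S M)) - s (S M)) ^ 2).
    rewrite IH.
    change (rsum (fun j => s (S j) ^ 2) (S M)) with (rsum (fun j => s (S j) ^ 2) M + s (S M) ^ 2).
    generalize (Hrec M); intros HM.
    replace (s (S (S M))) with (2 * cos th * s (S M) - s M) by lra; ring. }
set (r := sqrt Sg).
assert (Hr : 0 < r) by (apply sqrt_lt_R0, HSg).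
assert (Hr2 : r ^ 2 = Sg) by (apply pow2_sqrt; lra).
exists (fun j => s (S j) / r); split; [|split].
- rewrite (rsum_ext _ (fun j => / Sg * s (S j) ^ 2)).
  + rewrite rsum_scal; fold Sg; field; lra.
  + intros; rewrite <- Hr2; field; lra.
- rewrite Hend; unfold Rdiv; ring.
- rewrite (rsum_ext _ (fun j => / Sg * (s (S j) - s j) ^ 2)).
  + rewrite rsum_scal, Hdiff, Hend; fold Sg.
    replace (/ Sg * (0 * (0 - s (S n)) + 2 * (1 - cos th) * Sg)) with (2 * (1 - cos th)) by (field; lra).
    replace th with (2 * (th / 2)) by field; rewrite cos_2a_sin.
    assert (H1 : 0 <= sin (th / 2) <= th / 2).
    { split; [|left; apply sin_lt_x; lra].
      apply sin_ge_0; [lra|]; unfold th; rewrite Hn2.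
      apply Rmult_le_reg_r with (2 * (INR n + 2)); [lra|].
      replace (PI / (INR n + 2) / 2 * (2 * (INR n + 2))) with PI by (field; lra); nra. }
    replace (16 / INR n ^ 2) with ((4 / INR n) ^ 2) by (field; lra).
    nra.
  + intros [|j] _; rewrite <- Hr2; [rewrite Hs0|]; field; lra.
Qed.

(** The kernel has mass 1, so the error is an average of [f s - f x] against it. Its product with
    [versin] is half of [|(1 - e_1) q|^2], whose integral is the difference energy of [a]: 8 is half
    of 16. *)
Lemma sq_modulus_kernel_approx (a : nat -> R) (n : nat) (f : R -> C) (x E D : R) :
  (1 <= n)%nat -> 0 <= D ->
  rsum (fun j => a j ^ 2) (S n) = 1 -> a (S n) = 0 ->
  rsum (fun j => match j with O => a O | S i => a (S i) - a i end ^ 2) (S (S n)) <= 16 / INR n ^ 2 ->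
  (forall s, ccont f s) -> (forall s, Cmod (f s - f x)%C <= E + D * versin (x - s)) ->
  Cmod (sq_modulus_kernel a (S n) f x - f x)%C <= E + D * (8 / INR n ^ 2).
Proof.
intros Hn HD H1 H0 H2 Hf H.
set (w := fun s => Cmod (qpoly a (S n) (x - s)) ^ 2).
assert (Hw : forall s, continuous w s).
{ intros s; apply (continuous_Cmod2 (fun s => qpoly a (S n) (x - s))), ccont_shift.
  intros; apply ccont_qpoly. }
set (w' := fun s => Cmod (qpoly (fun j => match j with O => a O | S i => a (S i) - a i end) (S (S n)) (x - s)) ^ 2).
assert (Hw' : forall s, continuous w' s).
{ intros s; apply (continuous_Cmod2 (fun s => qpoly _ (S (S n)) (x - s))), ccont_shift.
  intros; apply ccont_qpoly. }
rewrite sq_modulus_kernel_CInt by assumption.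
change (fun s => (f s * RtoC (Cmod (qpoly a (S n) (x - s)) ^ 2))%C) with (fun s => (f s * RtoC (w s))%C).
replace (f x) with (CInt (fun s => f x * RtoC (w s))%C 0 1) at 1.
- rewrite <- CInt_minus; [|lra| |].
  + assert (I1 : RInt w 0 1 = 1) by (unfold w; rewrite qpoly_Parseval; exact H1).
    assert (I2 : RInt w' 0 1 <= 16 / INR n ^ 2) by (unfold w'; rewrite qpoly_Parseval; exact H2).
    apply Rle_trans with (E * RInt w 0 1 + D / 2 * RInt w' 0 1).
    2: { rewrite I1, Rmult_1_r; apply Rplus_le_compat_l.
      replace (D * (8 / INR n ^ 2)) with (D / 2 * (16 / INR n ^ 2)) by (field; apply not_0_INR; lia).
      apply Rmult_le_compat_l; [lra|exact I2]. }
    rewrite <- RInt_lin by (lra || auto).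
    apply Cmod_CInt_le; [lra| | |].
    * intros s _; apply ccont_minus; apply ccont_mult; auto using ccont_const, ccont_RtoC.
    * intros s _; apply (continuous_plus (V := R_NormedModule) (fun y => E * w y) (fun y => D / 2 * w' y));
        apply (continuous_scal_r (V := R_NormedModule)); auto.
    * intros s _.
      replace (f s * RtoC (w s) - f x * RtoC (w s))%C with ((f s - f x) * RtoC (w s))%C by ring.
      rewrite Cmod_mult, Cmod_R, Rabs_pos_eq by apply pow2_ge_0.
      replace (w' s) with (2 * versin (x - s) * w s).
      -- replace (E * w s + D / 2 * (2 * versin (x - s) * w s))
           with ((E + D * versin (x - s)) * w s) by field.
         apply Rmult_le_compat_r; [apply pow2_ge_0|apply H].
      -- unfold w', w; rewrite <- (qpoly_difference a (S n) (x - s) H0), Cmod_mult, Rpow_mult_distr, versin_Cmod.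
         reflexivity.
  + intros s _; apply ccont_mult; auto using ccont_RtoC.
  + intros s _; apply ccont_mult; auto using ccont_const, ccont_RtoC.
- rewrite CInt_scal, CInt_RtoC by (lra || auto || (intros s _; auto using ccont_RtoC)).
  unfold w; rewrite qpoly_Parseval, H1; ring.
Qed.

Lemma periodic1_Z (f : R -> C) (k : Z) (x : R) : periodic1 f -> f (x + IZR k) = f x.
Proof.
intros Hf.
assert (H : forall (j : nat) y, f (y + INR j) = f y).
{ induction j as [|j IH]; intros y; [simpl; f_equal; ring|].
  rewrite S_INR, <- Rplus_assoc, Hf; apply IH. }
destruct (Z_le_dec 0 k) as [Hk|Hk].
- rewrite <- (Z2Nat.id k), <- INR_IZR_INZ by assumption; apply H.
- rewrite <- (H (Z.to_nat (- k)) (x + IZR k)).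
  f_equal; rewrite INR_IZR_INZ, Z2Nat.id, opp_IZR by lia; ring.
Qed.

Lemma near_integer (t : R) : exists k : Z, Rabs (t - IZR k) <= 1/2.
Proof.
exists (up (t - 1/2)); destruct (archimed (t - 1/2)) as [H1 H2].
apply Rabs_le; lra.
Qed.

Lemma versin_Z (t : R) (k : Z) : versin (t + IZR k) = versin t.
Proof. unfold versin; rewrite (periodic1_Z (cexp2pi 1)) by apply cexp2pi_periodic; reflexivity. Qed.

(** The weights are fixed before [f] and [x], so one polynomial serves all points. Periodicity moves
    each difference into [-1/2, 1/2], and passing from [y ^ 2] to [versin] costs a factor 2. *)
Lemma korovkin (n : nat) : (1 <= n)%nat -> exists a : nat -> R,
  rsum (fun j => a j ^ 2) (S n) = 1 /\
  forall (f : R -> C) (x E D : R), periodic1 f -> (forall s, ccont f s) -> 0 <= D ->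
  (forall y, Rabs y <= 1/2 -> Cmod (f (x + y)%R - f x)%C <= E + D * y ^ 2) ->
  Cmod (sq_modulus_kernel a (S n) f x - f x)%C <= E + D * (16 / INR n ^ 2).
Proof.
intros Hn; destruct (korovkin_weights n Hn) as [a [A1 [A2 A3]]].
exists a; split; [exact A1|]; intros f x E D Hp Hf HD H.
replace (D * (16 / INR n ^ 2)) with (2 * D * (8 / INR n ^ 2)) by
  (field; apply not_0_INR; lia).
apply sq_modulus_kernel_approx; try assumption; [lra|].
intros s; destruct (near_integer (x - s)) as [k Hk].
rewrite <- (versin_Z (x - s) (- k)), <- (periodic1_Z f k s Hp), opp_IZR.
replace (s + IZR k) with (x + - (x - s - IZR k)) by ring.
eapply Rle_trans; [apply H; rewrite Rabs_Ropp; exact Hk|].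
replace ((- (x - s - IZR k)) ^ 2) with ((x - s - IZR k) ^ 2) by ring.
replace (2 * D * versin (x - s + - IZR k)) with (D * (2 * versin (x - s - IZR k))) by (unfold Rminus; ring).
apply Rplus_le_compat_l, Rmult_le_compat_l; [exact HD|apply versin_lower, Hk].
Qed.

(** Divided by the constant, the error becomes a lower bound of the set under [Glb_Rbar]. This
    excludes the infimum [-oo], and [+oo] makes the right-hand side infinite. *)
Lemma quad_error_best_approx (L : nat -> nat) (xs tau : nat -> nat -> R) (A B : R)
  (hMZ : MZ_family L xs tau A B) (n : nat) (f : R -> C) : (1 <= n)%nat -> (forall x, ccont f x) ->
  Rbar_le (Finite (Cmod (Cminus (Iint f) (quad L xs tau n f))))
          (Rbar_mult (Finite (1 + sqrt (B / A))) (best_approx n f)).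
Proof.
intros Hn Hf; set (e := Cmod _); set (K := 1 + sqrt (B / A)).
assert (HK : 0 < K) by (generalize (sqrt_pos (B / A)); unfold K; lra).
assert (H : Rbar_le (Finite (e / K)) (best_approx n f)).
{ unfold best_approx; apply (Glb_Rbar_correct _); intros r [p [Hp Hr]]; simpl.
  assert (Hle : forall x, Cmod (f x - p x)%C <= r).
  { intros x; unfold sup_norm in Hr.
    generalize (proj1 (Lub_Rbar_correct (fun r => exists x, r = Cmod (f x - p x)%C)) _ (ex_intro _ x eq_refl)).
    rewrite Hr; intros Hx; exact Hx. }
  apply Rmult_le_reg_l with K; [exact HK|].
  replace (K * (e / K)) with e by (field; lra).
  apply (quad_error L xs tau A B hMZ n f p); assumption. }
destruct (best_approx n f) as [b| |]; simpl in H |- *.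
- apply Rmult_le_reg_r with (/ K); [apply Rinv_0_lt_compat, HK|].
  replace (K * b * / K) with b by (field; lra); exact H.
- destruct (Rle_dec 0 K) as [H0|H0]; [|lra].
  destruct (Rle_lt_or_eq_dec 0 K H0); [exact I|lra].
- contradiction.
Qed.

(** * Jackson's theorem *)

(** Brings a Hölder modulus into the shape [E + D * y ^ 2] that [korovkin] accepts. *)
Lemma Rpower_le_1_sqr (u alpha : R) : 0 < u -> 0 < alpha <= 1 -> Rpower u alpha <= 1 + u ^ 2.
Proof.
intros Hu Ha; destruct (Rle_dec u 1) as [H|H].
- assert (Rpower u alpha <= Rpower 1 alpha) by (apply Rle_Rpower_l; lra).
  unfold Rpower at 2 in H0; rewrite ln_1, Rmult_0_r, exp_0 in H0.
  generalize (pow2_ge_0 u); lra.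
- assert (Rpower u alpha <= Rpower u 2) by (apply Rle_Rpower; lra).
  replace 2 with (INR 2) in H0 by (simpl; ring); rewrite Rpower_pow in H0 by assumption; lra.
Qed.

(** Rescaling by [n] gives [|y|^alpha = n^(-alpha) (n |y|)^alpha <= n^(-alpha) (1 + n^2 y^2)]. So
    [E = M n^(-alpha)] and [D = E n^2], and [korovkin] returns [(1 + 16) E]. *)
Lemma jackson_holder (n : nat) (f : R -> C) (M alpha : R) : (1 <= n)%nat ->
  periodic1 f -> (forall s, ccont f s) -> 0 < alpha <= 1 -> 0 <= M ->
  (forall x y, x <> y -> Cmod (f x - f y)%C <= M * Rpower (Rabs (x - y)) alpha) ->
  exists p, trig_poly n p /\ forall x, Cmod (f x - p x)%C <= 17 * M * Rpower (INR n) (- alpha).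
Proof.
intros Hn Hp Hf Ha HM H; destruct (korovkin n Hn) as [a [_ Ka]].
exists (sq_modulus_kernel a (S n) f); split; [apply trig_poly_sq_modulus_kernel|]; intros x.
assert (Hn0 : 1 <= INR n) by (apply (le_INR 1), Hn).
assert (Hr : 0 < Rpower (INR n) (- alpha)) by apply exp_pos.
assert (Hb : 0 <= M * Rpower (INR n) (- alpha)) by (apply Rmult_le_pos; lra).
replace (f x - sq_modulus_kernel a (S n) f x)%C with (- (sq_modulus_kernel a (S n) f x - f x))%C by ring.
rewrite Cmod_opp.
replace (17 * M * Rpower (INR n) (- alpha)) with
  (M * Rpower (INR n) (- alpha) + M * Rpower (INR n) (- alpha) * INR n ^ 2 * (16 / INR n ^ 2)) by (field; lra).
apply Ka; try assumption.
- apply Rmult_le_pos; [assumption|apply pow2_ge_0].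
- intros y _; destruct (Req_dec y 0) as [->|Hy].
  + rewrite Rplus_0_r; replace (f x - f x)%C with (RtoC 0) by ring; rewrite Cmod_0; lra.
  + eapply Rle_trans; [apply H; lra|].
    replace (x + y - x) with y by ring.
    assert (Hy0 : 0 < Rabs y) by (apply Rabs_pos_lt, Hy).
    replace (Rpower (Rabs y) alpha) with (Rpower (INR n) (- alpha) * Rpower (INR n * Rabs y) alpha).
    * replace (M * Rpower (INR n) (- alpha) + M * Rpower (INR n) (- alpha) * INR n ^ 2 * y ^ 2)
        with (M * Rpower (INR n) (- alpha) * (1 + (INR n * Rabs y) ^ 2))
        by (rewrite Rpow_mult_distr, pow2_abs; ring).
      rewrite <- Rmult_assoc; apply Rmult_le_compat_l; [exact Hb|].
      apply Rpower_le_1_sqr; [apply Rmult_lt_0_compat; lra|exact Ha].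
    * rewrite <- Rpower_mult_distr by lra.
      rewrite <- Rmult_assoc, <- Rpower_plus, Rplus_opp_l, Rpower_O by lra; ring.
Qed.

Definition cderiv (f : R -> C) (x : R) (l : C) : Prop :=
  is_derive (fun t => fst (f t)) x (fst l) /\ is_derive (fun t => snd (f t)) x (snd l).

Lemma cderiv_plus (f g : R -> C) (x : R) (l m : C) :
  cderiv f x l -> cderiv g x m -> cderiv (fun t => f t + g t)%C x (l + m)%C.
Proof.
intros [f1 f2] [g1 g2]; split; simpl.
- apply (is_derive_plus (V := R_NormedModule) (fun t => fst (f t)) (fun t => fst (g t))); assumption.
- apply (is_derive_plus (V := R_NormedModule) (fun t => snd (f t)) (fun t => snd (g t))); assumption.
Qed.

Lemma cderiv_scal (c : C) (f : R -> C) (x : R) (l : C) :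
  cderiv f x l -> cderiv (fun t => c * f t)%C x (c * l)%C.
Proof.
intros [f1 f2]; split; simpl.
- apply (is_derive_minus (V := R_NormedModule) (fun t => fst c * fst (f t)) (fun t => snd c * snd (f t)));
    apply (is_derive_scal (fun t => _ (f t))); assumption.
- apply (is_derive_plus (V := R_NormedModule) (fun t => fst c * snd (f t)) (fun t => snd c * fst (f t)));
    apply (is_derive_scal (fun t => _ (f t))); assumption.
Qed.

Lemma cderiv_const (c : C) (x : R) : cderiv (fun _ => c) x (RtoC 0).
Proof. split; apply (is_derive_const (V := R_NormedModule)). Qed.

Lemma cderiv_cexp2pi (m : Z) (x : R) :
  cderiv (cexp2pi m) x (RtoC (2 * PI * IZR m) * Ci * cexp2pi m x)%C.
Proof.
split.
- evar_last; [apply is_derive_cexp2pi_fst|unfold cexp2pi; simpl; ring].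
- evar_last; [apply is_derive_cexp2pi_snd|unfold cexp2pi; simpl; ring].
Qed.

Lemma cderiv_csum (F dF : nat -> R -> C) (N : nat) (x : R) :
  (forall k, (k < N)%nat -> cderiv (F k) x (dF k x)) ->
  cderiv (fun t => csum (fun k => F k t) N) x (csum (fun k => dF k x) N).
Proof.
induction N as [|N IH]; intros H; simpl; [apply cderiv_const|].
apply (cderiv_plus (fun t => csum (fun k => F k t) N) (F N)); [apply IH; intros|]; apply H; lia.
Qed.

Lemma cderiv_ccont (f : R -> C) (x : R) (l : C) : cderiv f x l -> ccont f x.
Proof.
intros [H1 H2]; split; apply (ex_derive_continuous (V := R_NormedModule)); eexists; eassumption.
Qed.

Lemma cderiv_RtoC (g : R -> R) (x l : R) : is_derive g x l -> cderiv (fun t => RtoC (g t)) x (RtoC l).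
Proof. intros H; split; simpl; [exact H|apply (is_derive_const (V := R_NormedModule))]. Qed.

(** The coefficient of frequency [j] is divided by [2 pi i j]; the mean is subtracted because a
    non-zero constant has no periodic primitive. *)
Lemma trig_poly_primitive (n : nat) (p : R -> C) : trig_poly n p ->
  exists P, trig_poly n P /\ forall x, cderiv P x (p x - CInt p 0 1)%C.
Proof.
intros [c Hc].
exists (fun x => csum (fun j => (if Z.eq_dec (Z.of_nat j - Z.of_nat n) 0 then RtoC 0
   else c (Z.of_nat j - Z.of_nat n)%Z / (RtoC (2 * PI * IZR (Z.of_nat j - Z.of_nat n)) * Ci))
   * cexp2pi (Z.of_nat j - Z.of_nat n) x)%C (2 * n + 1)).
split.
{ exists (fun z => if Z.eq_dec z 0 then RtoC 0 else c z / (RtoC (2 * PI * IZR z) * Ci))%C; reflexivity. }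
assert (H0 : CInt p 0 1 = c 0%Z).
{ rewrite (CInt_ext _ (fun y => csum (fun j => c (Z.of_nat j - Z.of_nat n)%Z *
     (cexp2pi (Z.of_nat j - Z.of_nat n) y * Cconj (cexp2pi 0 y)))%C (2 * n + 1))); [|lra|].
  - rewrite CInt_csum; [|lra|].
    + rewrite (csum_delta _ _ n); [|lia|].
      * replace 1 with (0 + 1) by ring.
        rewrite CInt_scal, cexp2pi_orthonormal; [|lra|].
        -- replace (Z.of_nat n - Z.of_nat n)%Z with 0%Z by lia; simpl; ring.
        -- intros y _; apply ccont_mult; [|apply ccont_conj]; apply ccont_cexp2pi.
      * intros k Hk Hne; replace 1 with (0 + 1) by ring.
        rewrite CInt_scal, cexp2pi_orthonormal; [|lra|].
        -- destruct (Z.eq_dec _ _); [lia|ring].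
        -- intros y _; apply ccont_mult; [|apply ccont_conj]; apply ccont_cexp2pi.
    + intros k _ y _; apply ccont_mult; [apply ccont_const|].
      apply ccont_mult; [|apply ccont_conj]; apply ccont_cexp2pi.
  - intros y _; rewrite Hc; apply csum_ext; intros; rewrite cexp2pi_0, Cconj_RtoC; ring. }
intros x; rewrite H0, Hc.
replace (_ - c 0%Z)%C with (csum (fun j => (if Z.eq_dec (Z.of_nat j - Z.of_nat n) 0 then RtoC 0
   else c (Z.of_nat j - Z.of_nat n)%Z) * cexp2pi (Z.of_nat j - Z.of_nat n) x)%C (2 * n + 1)).
- apply (cderiv_csum (fun j y => _ * cexp2pi _ y)%C (fun j y => _ * cexp2pi _ y)%C); intros j _.
  destruct (Z.eq_dec (Z.of_nat j - Z.of_nat n) 0) as [E|E].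
  + replace (0 * cexp2pi (Z.of_nat j - Z.of_nat n) x)%C with
      (0 * (RtoC (2 * PI * IZR (Z.of_nat j - Z.of_nat n)) * Ci * cexp2pi (Z.of_nat j - Z.of_nat n) x))%C by ring.
    apply cderiv_scal, cderiv_cexp2pi.
  + assert (Hnz : RtoC (2 * PI * IZR (Z.of_nat j - Z.of_nat n)) <> RtoC 0).
    { intros K; apply RtoC_inj in K; revert K; apply Rmult_integral_contrapositive_currified;
        [generalize PI_RGT_0; lra|apply not_0_IZR, E]. }
    assert (HCi : Ci <> RtoC 0) by (intros K; inversion K; lra).
    match goal with |- cderiv (fun _ => ?d * _)%C _ (?c * _)%C =>
      replace (c * cexp2pi (Z.of_nat j - Z.of_nat n) x)%C with
      (d * (RtoC (2 * PI * IZR (Z.of_nat j - Z.of_nat n)) * Ci * cexp2pi (Z.of_nat j - Z.of_nat n) x))%C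
      by (field; split; assumption) end.
    apply cderiv_scal, cderiv_cexp2pi.
(* [F] and [G] differ only at the index [n], which carries frequency 0. *)
- set (F := fun j => (c (Z.of_nat j - Z.of_nat n)%Z * cexp2pi (Z.of_nat j - Z.of_nat n) x)%C).
  set (G := fun j => ((if Z.eq_dec (Z.of_nat j - Z.of_nat n) 0 then RtoC 0
     else c (Z.of_nat j - Z.of_nat n)%Z) * cexp2pi (Z.of_nat j - Z.of_nat n) x)%C).
  assert (HFG : csum (fun j => F j + RtoC (-1) * G j)%C (2 * n + 1) = c 0%Z).
  { rewrite (csum_delta _ _ n); [|lia|].
    - unfold F, G; replace (Z.of_nat n - Z.of_nat n)%Z with 0%Z by lia; simpl; rewrite cexp2pi_0; ring.
    - intros k _ Hk; unfold F, G; destruct (Z.eq_dec _ _); [lia|ring]. }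
  rewrite <- HFG, csum_plus, csum_scal; ring.
Qed.

(** The mean value inequality is applied to each component separately, whence the factor 2. *)
Lemma lipschitz_of_cderiv (f df : R -> C) (M : R) :
  (forall x, cderiv f x (df x)) -> (forall x, Cmod (df x) <= M) ->
  forall x y, Cmod (f x - f y)%C <= 2 * M * Rabs (x - y).
Proof.
intros H HM x y.
assert (Hfst : Rabs (fst (f x) - fst (f y)) <= M * Rabs (x - y)).
{ apply (bounded_variation (fun t => fst (f t)) (fun t => fst (df t)) M y x); intros t _; split.
  - apply H.
  - eapply Rle_trans; [apply (re_le_Cmod (df t))|apply HM]. }
assert (Hsnd : Rabs (snd (f x) - snd (f y)) <= M * Rabs (x - y)).
{ apply (bounded_variation (fun t => snd (f t)) (fun t => snd (df t)) M y x); intros t _; split.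
  - apply H.
  - eapply Rle_trans; [|apply HM]; eapply Rle_trans; [|apply Rmax_Cmod]; apply Rmax_r. }
set (z := (f x - f y)%C).
replace z with (RtoC (fst z) + Ci * RtoC (snd z))%C
  by (destruct z; unfold RtoC, Ci, Cmult, Cplus; simpl; f_equal; ring).
eapply Rle_trans; [apply Cmod_triangle|].
rewrite Cmod_mult, Cmod_Ci, !Cmod_R; unfold z; simpl; unfold Rminus in *; lra.
Qed.

Lemma holder_r_continuous (r : nat) (alpha : R) (g : R -> R) :
  0 < alpha <= 1 -> holder_r r alpha g -> forall x, continuous g x.
Proof.
intros Ha [Hd [M HM]] x; destruct r as [|r].
- apply continuity_pt_filterlim; intros eps Heps; simpl in HM.
  (* [M] comes without a sign, and the radius below divides by this constant. *)
  set (M' := Rabs M + 1).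
  assert (HM' : 0 < M') by (unfold M'; generalize (Rabs_pos M); lra).
  exists (Rpower (eps / M') (/ alpha)); split; [apply exp_pos|].
  intros y [[_ Hy] Hxy]; simpl in *; unfold R_dist in *.
  assert (H0 : 0 < Rabs (y - x)) by (apply Rabs_pos_lt; intros E; apply Hy; lra).
  assert (Hlt : Rpower (Rabs (y - x)) alpha < eps / M').
  { rewrite <- (Rpower_1 (eps / M')) by (apply Rdiv_lt_0_compat; assumption).
    rewrite <- (Rinv_l alpha), <- Rpower_mult by lra.
    apply Rlt_Rpower_l; lra. }
  specialize (HM y x ltac:(auto)).
  assert (0 < Rpower (Rabs (y - x)) alpha) by apply exp_pos.
  apply Rle_lt_trans with (M' * Rpower (Rabs (y - x)) alpha).
  + eapply Rle_trans; [exact HM|]; apply Rmult_le_compat_r; [lra|].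
    unfold M'; generalize (Rle_abs M); lra.
  + apply Rlt_le_trans with (M' * (eps / M')); [apply Rmult_lt_compat_l; assumption|right; field; lra].
- apply (ex_derive_continuous (V := R_NormedModule)), (Hd 1%nat x); lia.
Qed.

(** If the derivative is approximated within [E], subtracting the primitive [P] leaves [h] with
    [|h'| <= 2 E]. Its Lipschitz constant [4 E] enters the case [alpha = 1] of [jackson_holder],
    which gains a factor [1 / n] and makes the constant grow by [68 = 17 * 4]. *)
Lemma jackson_real (alpha : R) (Ha : 0 < alpha <= 1) (r : nat) : forall g : R -> R,
  (forall x, g (x + 1) = g x) -> holder_r r alpha g ->
  exists K, 0 <= K /\ forall n, (1 <= n)%nat -> exists p, trig_poly n p /\
    forall x, Cmod (RtoC (g x) - p x)%C <= K * Rpower (INR n) (- (INR r + alpha)).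
Proof.
induction r as [|r IH]; intros g Hg [Hd [M HM]].
- assert (Hc := holder_r_continuous 0 alpha g Ha (conj Hd (ex_intro _ M HM))).
  exists (17 * Rabs M); split; [generalize (Rabs_pos M); lra|]; intros n Hn.
  simpl INR; rewrite Rplus_0_l.
  apply jackson_holder; try assumption.
  + intros x; rewrite Hg; reflexivity.
  + intros s; apply ccont_RtoC, Hc.
  + apply Rabs_pos.
  + intros x y Hxy; rewrite <- RtoC_minus, Cmod_R.
    eapply Rle_trans; [apply (HM x y Hxy)|]; apply Rmult_le_compat_r; [left; apply exp_pos|apply Rle_abs].
- assert (Hder : forall x, ex_derive g x) by (intros x; apply (Hd 1%nat x); lia).
  assert (Hn : forall j x, Derive_n (Derive g) j x = Derive_n g (S j) x).
  { intros j x; replace (S j) with (j + 1)%nat by lia.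
    rewrite <- (Derive_n_comp g j 1); reflexivity. }
  assert (Hg' : forall x, Derive g (x + 1) = Derive g x).
  { intros x; transitivity (Derive (fun t => g (t + 1)) x).
    - symmetry; apply is_derive_unique.
      evar_last; [apply (is_derive_comp g (fun t => t + 1)); [apply Derive_correct, Hder|auto_derive; [trivial|reflexivity]]|].
      unfold scal; simpl; unfold mult; simpl; ring.
    - apply Derive_ext; exact Hg. }
  assert (Hh : holder_r r alpha (Derive g)).
  { split.
    - intros [|j] x Hj; [exact I|simpl].
      apply (ex_derive_ext (V := R_NormedModule) (Derive_n g (S j))); [intros t; symmetry; apply Hn|].
      apply (Hd (S (S j)) x); lia.
    - exists M; intros x y Hxy; rewrite !Hn; apply HM, Hxy. }
  destruct (IH (Derive g) Hg' Hh) as [K [HK HKn]].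
  assert (Hc := holder_r_continuous r alpha (Derive g) Ha Hh).
  exists (68 * K); split; [lra|]; intros n Hn1.
  destruct (HKn n Hn1) as [p [Hp Hpg]].
  set (E := K * Rpower (INR n) (- (INR r + alpha))) in Hpg.
  assert (HE : 0 <= E) by (apply Rmult_le_pos; [exact HK|left; apply exp_pos]).
  destruct (trig_poly_primitive n p Hp) as [P [HP HPd]].
  (* The derivative of a periodic function has mean zero, so the mean of its approximant [p], which
     the primitive has to drop, is at most [E]. *)
  assert (Hc0 : Cmod (CInt p 0 1) <= E).
  { assert (I0 : CInt (fun x => RtoC (Derive g x)) 0 1 = RtoC 0).
    { rewrite (CInt_derive (fun x => RtoC (g x))); [|lra| | |].
      - rewrite <- (Hg 0), Rplus_0_l; ring.
      - intros x _; exact (proj1 (cderiv_RtoC g x _ (Derive_correct _ _ (Hder x)))).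
      - intros x _; exact (proj2 (cderiv_RtoC g x _ (Derive_correct _ _ (Hder x)))).
      - intros x _; apply ccont_RtoC, Hc. }
    replace (CInt p 0 1) with (- CInt (fun x => RtoC (Derive g x) - p x) 0 1)%C.
    - rewrite Cmod_opp; replace E with ((1 - 0) * E) by ring.
      apply Cmod_CInt_le_const; [lra| |auto].
      intros x _; apply ccont_minus; [apply ccont_RtoC, Hc|apply (ccont_trig_poly n), Hp].
    - rewrite CInt_minus, I0; [ring|lra| |].
      + intros x _; apply ccont_RtoC, Hc.
      + intros x _; apply (ccont_trig_poly n), Hp. }
  set (h := fun x => (RtoC (g x) + RtoC (-1) * P x)%C).
  assert (Hhd : forall x, cderiv h x (RtoC (Derive g x) + RtoC (-1) * (p x - CInt p 0 1))%C).
  { intros x; apply cderiv_plus; [apply cderiv_RtoC, Derive_correct, Hder|apply cderiv_scal, HPd]. }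
  assert (Hlip := lipschitz_of_cderiv h _ (2 * E) Hhd).
  destruct (jackson_holder n h (2 * (2 * E)) 1 Hn1) as [q [Hq Hhq]]; try lra.
  + intros x; unfold h; rewrite Hg, (trig_poly_periodic n P HP); reflexivity.
  + intros s; eapply cderiv_ccont, Hhd.
  + intros x y Hxy; rewrite Rpower_1 by (apply Rabs_pos_lt; lra); apply Hlip.
    intros t; replace (RtoC (Derive g t) + RtoC (-1) * (p t - CInt p 0 1))%C
      with ((RtoC (Derive g t) - p t) + CInt p 0 1)%C by ring.
    eapply Rle_trans; [apply Cmod_triangle|]; specialize (Hpg t); lra.
  + exists (fun x => P x + q x)%C; split; [apply trig_poly_plus; assumption|]; intros x.
    replace (RtoC (g x) - (P x + q x))%C with (h x - q x)%C by (unfold h; ring).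
    eapply Rle_trans; [apply Hhq|]; right; unfold E.
    rewrite S_INR; replace (- (INR r + 1 + alpha)) with (- (INR r + alpha) + Ropp 1) by ring.
    rewrite Rpower_plus; ring.
Qed.

Lemma quad_error_C_sigma (L : nat -> nat) (xs tau : nat -> nat -> R) (A B : R)
  (hMZ : MZ_family L xs tau A B) (sigma : R) (f : R -> C) : C_sigma sigma f ->
  exists M : R, forall n : nat, (1 <= n)%nat ->
    Cmod (Cminus (Iint f) (quad L xs tau n f)) <= M * Rpower (INR n) (- sigma).
Proof.
intros [[Hp Hf] [r [alpha [Ha [-> [H1 H2]]]]]].
destruct (jackson_real alpha Ha r (fun x => fst (f x))) as [K1 [_ J1]];
  [intros x; rewrite Hp; reflexivity|exact H1|].
destruct (jackson_real alpha Ha r (fun x => snd (f x))) as [K2 [_ J2]];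
  [intros x; rewrite Hp; reflexivity|exact H2|].
exists ((1 + sqrt (B / A)) * (K1 + K2)); intros n Hn.
destruct (J1 n Hn) as [p1 [P1 Q1]]; destruct (J2 n Hn) as [p2 [P2 Q2]].
rewrite Rmult_assoc.
apply (quad_error L xs tau A B hMZ n f (fun x => p1 x + Ci * p2 x)%C); try assumption.
- intros x; apply continuous_ccont, Hf.
- apply trig_poly_plus, trig_poly_scal; assumption.
- intros x.
  replace (f x - (p1 x + Ci * p2 x))%C with
    ((RtoC (fst (f x)) - p1 x) + Ci * (RtoC (snd (f x)) - p2 x))%C.
  + eapply Rle_trans; [apply Cmod_triangle|]; rewrite Cmod_mult, Cmod_Ci.
    specialize (Q1 x); specialize (Q2 x); lra.
  + replace (f x) with (RtoC (fst (f x)) + Ci * RtoC (snd (f x)))%C at 3; [ring|].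
    destruct (f x); unfold RtoC, Ci, Cmult, Cplus; simpl; f_equal; ring.
Qed.

(** * Fourier partial sums *)

Definition fourier_sum (f : R -> C) (n : nat) (x : R) : C :=
  csum (fun j => fhat f (Z.of_nat j - Z.of_nat n) * cexp2pi (Z.of_nat j - Z.of_nat n) x)%C (2 * n + 1).

Lemma trig_poly_fourier_sum (f : R -> C) (n : nat) : trig_poly n (fourier_sum f n).
Proof. exists (fhat f); reflexivity. Qed.

Lemma fhat_cexp2pi (m k : Z) : fhat (cexp2pi m) k = if Z.eq_dec m k then RtoC 1 else RtoC 0.
Proof. rewrite fhat_CInt; replace 1 with (0 + 1) at 1 by ring; apply cexp2pi_orthonormal. Qed.

Lemma fhat_minus_fourier_sum (f : R -> C) (n : nat) (k : Z) : (forall x, ccont f x) ->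
  fhat (fun x => f x - fourier_sum f n x)%C k
  = if Z_le_dec (Z.abs k) (Z.of_nat n) then RtoC 0 else fhat f k.
Proof.
intros Hf; rewrite fhat_CInt.
assert (He : forall m, ccont_on (fun x => cexp2pi m x * Cconj (cexp2pi k x))%C 0 1).
{ intros m x _; apply ccont_mult; [|apply ccont_conj]; apply ccont_cexp2pi. }
rewrite (CInt_ext _ (fun x => f x * Cconj (cexp2pi k x) -
  csum (fun j => fhat f (Z.of_nat j - Z.of_nat n) * (cexp2pi (Z.of_nat j - Z.of_nat n) x * Cconj (cexp2pi k x))) (2 * n + 1))%C); [|lra|].
- rewrite CInt_minus; [|lra| |].
  + rewrite CInt_csum; [|lra|].
    * rewrite (csum_ext _ (fun j => fhat f (Z.of_nat j - Z.of_nat n) *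
        (if Z.eq_dec (Z.of_nat j - Z.of_nat n) k then RtoC 1 else RtoC 0))%C).
      -- rewrite <- fhat_CInt; destruct (Z_le_dec (Z.abs k) (Z.of_nat n)) as [Hk|Hk].
         ++ rewrite (csum_delta _ _ (Z.to_nat (k + Z.of_nat n))); [|lia|].
            ** destruct (Z.eq_dec _ _); [|lia].
               replace (Z.of_nat (Z.to_nat (k + Z.of_nat n)) - Z.of_nat n)%Z with k by lia; ring.
            ** intros i Hi Hne; destruct (Z.eq_dec _ _); [lia|ring].
         ++ rewrite (csum_ext _ (fun _ => RtoC 0)); [rewrite csum_0; ring|].
            intros i Hi; destruct (Z.eq_dec _ _); [lia|ring].
      -- intros j _; rewrite CInt_scal by (lra || apply He).
         rewrite <- fhat_CInt, fhat_cexp2pi; reflexivity.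
    * intros j _ x Hx; apply ccont_mult; [apply ccont_const|apply He, Hx].
  + intros x _; apply ccont_mult; [apply Hf|apply ccont_conj, ccont_cexp2pi].
  + intros x Hx; apply ccont_csum; intros j _; apply ccont_mult; [apply ccont_const|apply He, Hx].
- intros x _; unfold fourier_sum.
  rewrite (csum_ext (fun j => fhat f (Z.of_nat j - Z.of_nat n) * (cexp2pi (Z.of_nat j - Z.of_nat n) x * Cconj (cexp2pi k x)))%C
    (fun j => Cconj (cexp2pi k x) * (fhat f (Z.of_nat j - Z.of_nat n) * cexp2pi (Z.of_nat j - Z.of_nat n) x))%C) by (intros; ring).
  rewrite csum_scal; ring.
Qed.

Lemma rsum_S (F : nat -> R) (N : nat) : rsum F (S N) = rsum F N + F N.
Proof. reflexivity. Qed.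

Lemma rsum_split (F : nat -> R) (n m : nat) :
  rsum F (n + m) = rsum F n + rsum (fun i => F (n + i)%nat) m.
Proof.
induction m as [|m IH]; [rewrite Nat.add_0_r; simpl; ring|].
rewrite Nat.add_succ_r; simpl; rewrite IH; ring.
Qed.

Lemma rsum_mono (F : nat -> R) (n m : nat) : (forall k, 0 <= F k) -> (n <= m)%nat ->
  rsum F n <= rsum F m.
Proof.
intros HF Hnm; replace m with (n + (m - n))%nat by lia; rewrite rsum_split.
generalize (rsum_nonneg (fun i => F (n + i)%nat) (m - n) (fun k _ => HF _)); lra.
Qed.

(** The integers [j - k] with [k < K] are distinct and lie between [- K] and [j]. The induction is
    on [j]: dropping the first term of a row leaves the preceding row, shorter by one. *)
Lemma rsum_row_le (h : Z -> R) (j K : nat) : (forall z, 0 <= h z) ->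
  rsum (fun k => h (Z.of_nat j - Z.of_nat k)%Z) K
  <= h 0%Z + rsum (fun i => h (Z.of_nat (S i)) + h (- Z.of_nat (S i))%Z) (Nat.max j K).
Proof.
intros Hh.
assert (H : rsum (fun k => h (Z.of_nat j - Z.of_nat k)%Z) K
  <= h 0%Z + rsum (fun i => h (Z.of_nat (S i))) j + rsum (fun i => h (- Z.of_nat (S i))%Z) K).
{ revert K; induction j as [|j IH]; intros K.
  - change (rsum (fun i => h (Z.of_nat (S i))) 0) with 0; rewrite Rplus_0_r.
    assert (H : forall M, rsum (fun k => h (Z.of_nat 0 - Z.of_nat k)%Z) (S M)
      = h 0%Z + rsum (fun i => h (- Z.of_nat (S i))%Z) M).
    { induction M as [|M IHM]; [simpl; ring|].
      rewrite rsum_S, IHM, (rsum_S _ M); rewrite Z.sub_0_l; ring. }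
    destruct K as [|K]; [simpl; generalize (Hh 0%Z); lra|].
    rewrite H, rsum_S; generalize (Hh (- Z.of_nat (S K))%Z); lra.
  - assert (Hj := rsum_nonneg (fun i => h (Z.of_nat (S i))) (S j) (fun _ _ => Hh _)).
    destruct K as [|K]; [simpl in *; generalize (Hh 0%Z); lra|].
    rewrite (rsum_split _ 1 K), (rsum_S _ 0), rsum_S, (rsum_S _ K).
    rewrite (rsum_ext _ (fun k => h (Z.of_nat j - Z.of_nat k)%Z) K) by (intros; f_equal; lia).
    rewrite Z.sub_0_r; change (rsum _ 0) with 0.
    specialize (IH K); generalize (Hh (- Z.of_nat (S K))%Z); lra. }
eapply Rle_trans; [exact H|]; rewrite rsum_plus.
generalize (rsum_mono (fun i => h (Z.of_nat (S i))) j (Nat.max j K) (fun _ => Hh _) ltac:(lia)).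
generalize (rsum_mono (fun i => h (- Z.of_nat (S i))%Z) K (Nat.max j K) (fun _ => Hh _) ltac:(lia)).
lra.
Qed.

(** Continuity at [x] gives [eps] for [|y| < d]. Beyond [d] the maximum [W] of the difference over
    the period is at most [W / d^2 * y^2]. *)
Lemma quadratic_modulus (g : R -> C) (x eps : R) : (forall s, ccont g s) -> 0 < eps ->
  exists D, 0 <= D /\ forall y, Rabs y <= 1/2 -> Cmod (g (x + y)%R - g x)%C <= eps + D * y ^ 2.
Proof.
intros Hg Heps.
assert (Hc : forall y, continuity_pt (fun y => Cmod (g (x + y)%R - g x)%C) y).
{ intros y; apply continuity_pt_filterlim, (continuous_Cmod (fun y => g (x + y)%R - g x)%C).
  apply ccont_minus; [|apply ccont_const].
  apply (ccont_comp g (fun y => x + y)); [apply Hg|].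
  apply (continuous_plus (V := R_NormedModule) (fun _ => x) (fun y => y)); [apply continuous_const|apply continuous_id]. }
destruct (continuity_ab_maj (fun y => Cmod (g (x + y)%R - g x)%C) (-1/2) (1/2)) as [m [Hm _]];
  [lra|intros; apply Hc|].
set (W := Cmod (g (x + m)%R - g x)%C) in Hm.
assert (HW : 0 <= W) by apply Cmod_ge_0.
destruct (Hc 0 eps Heps) as [d [Hd Hd']].
exists (W / d ^ 2); split; [apply Rdiv_le_0_compat; [assumption|apply pow_lt; lra]|].
intros y Hy; destruct (Rlt_dec (Rabs y) d) as [Hlt|Hge].
- assert (0 <= W / d ^ 2 * y ^ 2).
  { apply Rmult_le_pos; [apply Rdiv_le_0_compat; [assumption|apply pow_lt; lra]|apply pow2_ge_0]. }
  destruct (Req_dec y 0) as [->|Hy0].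
  + rewrite Rplus_0_r; replace (g x - g x)%C with (RtoC 0) by ring; rewrite Cmod_0; lra.
  + specialize (Hd' y); simpl in Hd'; unfold R_dist in Hd'.
    rewrite Rplus_0_r in Hd'; replace (g x - g x)%C with (RtoC 0) in Hd' by ring.
    rewrite Cmod_0, !Rminus_0_r, (Rabs_pos_eq (Cmod _)) in Hd' by apply Cmod_ge_0.
    left; eapply Rlt_le_trans; [apply Hd'|lra].
    split; [split; [exact I|auto]|exact Hlt].
- apply Rnot_lt_le in Hge; apply Rabs_le_between in Hy.
  eapply Rle_trans; [apply Hm; lra|].
  assert (d ^ 2 <= y ^ 2) by (rewrite <- (pow2_abs y); apply pow_incr; lra).
  replace W with (W / d ^ 2 * d ^ 2) at 1 by (field; lra).
  assert (W / d ^ 2 * d ^ 2 <= W / d ^ 2 * y ^ 2).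
  { apply Rmult_le_compat_l; [apply Rdiv_le_0_compat; [assumption|apply pow_lt; lra]|assumption]. }
  lra.
Qed.

(* Korovkin's operator reproduces [f - fourier_sum f n] in the limit and, by
   [a_j a_k <= (a_j^2 + a_k^2) / 2], its values are bounded by row sums of Fourier coefficients. *)
Lemma fourier_tail (f : R -> C) (n : nat) (T : R) : periodic1 f -> (forall s, ccont f s) ->
  (forall N, rsum (fun i => Cmod (fhat f (Z.of_nat (n + S i))) + Cmod (fhat f (- Z.of_nat (n + S i))%Z)) N <= T) ->
  forall x, Cmod (f x - fourier_sum f n x)%C <= T.
Proof.
intros Hp Hf HT x; set (g := fun x => (f x - fourier_sum f n x)%C).
change (Cmod (g x) <= T).
assert (Hgp : periodic1 g).
{ intros y; unfold g; rewrite Hp, (trig_poly_periodic n _ (trig_poly_fourier_sum f n)); reflexivity. }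
assert (Hgc : forall s, ccont g s).
{ intros s; apply ccont_minus; [apply Hf|apply (ccont_trig_poly n), trig_poly_fourier_sum]. }
set (h := fun z => Cmod (fhat g z)).
assert (Hin : forall z, (Z.abs z <= Z.of_nat n)%Z -> h z = 0).
{ intros z Hz; unfold h, g; rewrite fhat_minus_fourier_sum by exact Hf.
  destruct (Z_le_dec _ _); [apply Cmod_0|contradiction]. }
assert (Hout : forall z, (Z.of_nat n < Z.abs z)%Z -> h z = Cmod (fhat f z)).
{ intros z Hz; unfold h, g; rewrite fhat_minus_fourier_sum by exact Hf.
  destruct (Z_le_dec _ _); [lia|reflexivity]. }
assert (Hh0 : forall z, 0 <= h z) by (intros; apply Cmod_ge_0).
assert (Hsym : forall N, rsum (fun i => h (Z.of_nat (S i)) + h (- Z.of_nat (S i))%Z) N <= T).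
{ intros N; eapply Rle_trans; [apply (rsum_mono _ N (n + N)); [intros; apply Rplus_le_le_0_compat; auto|lia]|].
  rewrite rsum_split, (rsum_ext _ (fun _ => 0) n).
  - rewrite rsum_0, Rplus_0_l; eapply Rle_trans; [|apply (HT N)].
    apply rsum_le; intros i _; rewrite !Hout by lia.
    replace (n + S i)%nat with (S (n + i)) by lia; lra.
  - intros i Hi; rewrite !Hin by lia; ring. }
assert (Hh00 : h 0%Z = 0) by (apply Hin; lia).
assert (Hrow : forall j K, rsum (fun k => h (Z.of_nat j - Z.of_nat k)%Z) K <= T).
{ intros j K; eapply Rle_trans; [apply rsum_row_le, Hh0|]; rewrite Hh00, Rplus_0_l; apply Hsym. }
(* Columns are rows of the reflected function [fun z => h (- z)]. *)
assert (Hcol : forall k K, rsum (fun j => h (Z.of_nat j - Z.of_nat k)%Z) K <= T).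
{ intros k K; eapply Rle_trans; [|apply (Hsym (Nat.max k K))].
  generalize (rsum_row_le (fun z => h (- z)%Z) k K (fun z => Hh0 _)); simpl Z.opp at 2; rewrite Hh00, Rplus_0_l.
  intros Hr; rewrite (rsum_ext _ (fun j => h (- (Z.of_nat k - Z.of_nat j))%Z)) by (intros; f_equal; lia).
  eapply Rle_trans; [exact Hr|]; right; apply rsum_ext; intros; rewrite Z.opp_involutive; ring. }
apply le_epsilon; intros eps Heps.
destruct (quadratic_modulus g x (eps / 2) Hgc ltac:(lra)) as [D [HD HDy]].
(* Once [m] exceeds [16 D / (eps / 2)], the error [16 D / m^2 <= 16 D / m] is below [eps / 2]. *)
destruct (nfloor_ex (16 * D / (eps / 2))) as [N [_ HN]]; [apply Rdiv_le_0_compat; lra|].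
set (m := S N); assert (Hm : 1 <= INR m) by (apply (le_INR 1); unfold m; lia).
destruct (korovkin m ltac:(unfold m; lia)) as [a [Ha Ka]].
specialize (Ka g x (eps / 2) D Hgp Hgc HD HDy).
assert (HDm : D * (16 / INR m ^ 2) <= eps / 2).
{ assert (16 * D <= eps / 2 * INR m).
  { unfold m; rewrite S_INR; apply Rmult_lt_compat_r with (r := eps / 2) in HN; [|lra].
    replace (16 * D / (eps / 2) * (eps / 2)) with (16 * D) in HN by (field; lra); lra. }
  apply Rmult_le_reg_r with (INR m ^ 2); [apply pow_lt; lra|].
  replace (D * (16 / INR m ^ 2) * INR m ^ 2) with (16 * D) by (field; lra).
  apply Rle_trans with (eps / 2 * INR m); [assumption|].
  apply Rmult_le_compat_l; [lra|]; replace (INR m ^ 2) with (INR m * INR m) by ring.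
  rewrite <- (Rmult_1_l (INR m)) at 1; apply Rmult_le_compat_r; lra. }
assert (HK : Cmod (sq_modulus_kernel a (S m) g x) <= T).
{ unfold sq_modulus_kernel; eapply Rle_trans; [apply Cmod_csum_le|].
  apply Rle_trans with (rsum (fun j => rsum (fun k =>
    / 2 * (a j ^ 2 * h (Z.of_nat j - Z.of_nat k)%Z) + / 2 * (a k ^ 2 * h (Z.of_nat j - Z.of_nat k)%Z)) (S m)) (S m)).
  - apply rsum_le; intros j _; eapply Rle_trans; [apply Cmod_csum_le|]; apply rsum_le; intros k _.
    rewrite !Cmod_mult, Cmod_cexp2pi, Rmult_1_r, Cmod_R; fold (h (Z.of_nat j - Z.of_nat k)%Z).
    replace (/ 2 * (a j ^ 2 * h (Z.of_nat j - Z.of_nat k)%Z) + / 2 * (a k ^ 2 * h (Z.of_nat j - Z.of_nat k)%Z))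
      with ((a j ^ 2 + a k ^ 2) / 2 * h (Z.of_nat j - Z.of_nat k)%Z) by field.
    apply Rmult_le_compat_r; [apply Hh0|].
    apply Rabs_le; generalize (pow2_ge_0 (a j - a k)) (pow2_ge_0 (a j + a k)); simpl; lra.
  - rewrite (rsum_ext _ (fun j => / 2 * (a j ^ 2 * rsum (fun k => h (Z.of_nat j - Z.of_nat k)%Z) (S m))
      + / 2 * rsum (fun k => a k ^ 2 * h (Z.of_nat j - Z.of_nat k)%Z) (S m)))
      by (intros; rewrite rsum_plus, !rsum_scal; reflexivity).
    rewrite rsum_plus, !rsum_scal, rsum_swap.
    assert (S1 : rsum (fun j => a j ^ 2 * rsum (fun k => h (Z.of_nat j - Z.of_nat k)%Z) (S m)) (S m) <= T).
    { apply Rle_trans with (rsum (fun j => T * a j ^ 2) (S m)); [|rewrite rsum_scal, Ha; lra].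
      apply rsum_le; intros j _; rewrite Rmult_comm; apply Rmult_le_compat_r; [apply pow2_ge_0|apply Hrow]. }
    assert (S2 : rsum (fun k => rsum (fun j => a k ^ 2 * h (Z.of_nat j - Z.of_nat k)%Z) (S m)) (S m) <= T).
    { apply Rle_trans with (rsum (fun j => T * a j ^ 2) (S m)); [|rewrite rsum_scal, Ha; lra].
      apply rsum_le; intros k _; rewrite rsum_scal, Rmult_comm; apply Rmult_le_compat_r; [apply pow2_ge_0|apply Hcol]. }
    lra. }
replace (g x) with (sq_modulus_kernel a (S m) g x + - (sq_modulus_kernel a (S m) g x - g x))%C by ring.
eapply Rle_trans; [apply Cmod_triangle|]; rewrite Cmod_opp; lra.
Qed.

(** * Sobolev functions *)

Lemma rsum_le_Series (u : nat -> R) (N : nat) : (forall k, 0 <= u k) -> ex_series u ->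
  rsum u N <= Series u.
Proof.
intros Hu Hex.
assert (E : forall k, rsum u (S k) = sum_n u k).
{ induction k as [|k IH]; [rewrite sum_O; simpl; ring|].
  rewrite sum_Sn, <- IH; reflexivity. }
apply Rle_trans with (rsum u (S N)); [apply rsum_mono; [assumption|lia]|].
rewrite E; apply (is_lim_seq_incr_compare (sum_n u)).
- apply Series_correct, Hex.
- intros k; rewrite sum_Sn; unfold plus; simpl; generalize (Hu (S k)); lra.
Qed.

(** A discrete form of comparison with the integral of [x^(-s)]. With [v = u + 1],
    [exp (- 1 / v) >= u / v] gives [ln (v / u) >= 1 / v], so [u^(1 - s) = v^(1 - s) exp ((s - 1) ln
    (v / u)) >= v^(1 - s) (1 + (s - 1) / v)]. *)
Lemma Rpower_telescope (s : R) (j : nat) : 1 < s -> (1 <= j)%nat ->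
  (s - 1) * Rpower (INR (S j)) (- s) <= Rpower (INR j) (1 - s) - Rpower (INR (S j)) (1 - s).
Proof.
intros Hs Hj; assert (Hu : 1 <= INR j) by (apply (le_INR 1), Hj).
rewrite S_INR; set (u := INR j) in *; set (v := u + 1).
assert (Hln : / v <= ln v - ln u).
{ assert (H := exp_ineq1_le (- / v)).
  replace (1 + - / v) with (u / v) in H by (unfold v; field; lra).
  assert (H' : ln (u / v) <= - / v).
  { rewrite <- (ln_exp (- / v)); apply ln_le; [apply Rdiv_lt_0_compat; unfold v; lra|exact H]. }
  unfold Rdiv in H'; rewrite ln_mult, ln_Rinv in H' by (try apply Rinv_0_lt_compat; unfold v; lra).
  lra. }
replace (Rpower u (1 - s)) with (Rpower v (1 - s) * exp ((s - 1) * (ln v - ln u))).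
- assert (H := exp_ineq1_le ((s - 1) * (ln v - ln u))).
  assert (H' : (s - 1) * / v <= (s - 1) * (ln v - ln u)) by (apply Rmult_le_compat_l; lra).
  replace (Rpower v (- s)) with (Rpower v (1 - s) * / v).
  + assert (0 < Rpower v (1 - s)) by apply exp_pos.
    replace ((s - 1) * (Rpower v (1 - s) * / v)) with (Rpower v (1 - s) * ((s - 1) * / v)) by ring.
    replace (Rpower v (1 - s) * exp ((s - 1) * (ln v - ln u)) - Rpower v (1 - s)) with
      (Rpower v (1 - s) * (exp ((s - 1) * (ln v - ln u)) - 1)) by ring.
    apply Rmult_le_compat_l; lra.
  + replace (- s) with (1 - s + - (1)) by ring; rewrite Rpower_plus, Rpower_Ropp, Rpower_1; [reflexivity|unfold v; lra].
- unfold Rpower; rewrite <- exp_plus; f_equal; ring.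
Qed.

Lemma rsum_Rpower_tail (s : R) (n N : nat) : 1 < s -> (1 <= n)%nat ->
  (s - 1) * rsum (fun i => Rpower (INR (n + S i)) (- s)) N <= Rpower (INR n) (1 - s).
Proof.
intros Hs Hn.
assert (H : (s - 1) * rsum (fun i => Rpower (INR (n + S i)) (- s)) N
  <= Rpower (INR n) (1 - s) - Rpower (INR (n + N)) (1 - s)).
{ induction N as [|N IH]; [rewrite Nat.add_0_r; simpl; lra|].
  simpl rsum; generalize (Rpower_telescope s (n + N) Hs ltac:(lia)).
  replace (n + S N)%nat with (S (n + N)) by lia; lra. }
generalize (exp_pos ((1 - s) * ln (INR (n + N)))); unfold Rpower in *; lra.
Qed.

Lemma sob_term_nonneg (sigma : R) (f : R -> C) (j : nat) : 0 <= sob_term sigma f j.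
Proof.
destruct j as [|j]; unfold sob_term; [apply pow2_ge_0|].
apply Rmult_le_pos; [apply Rplus_le_le_0_compat; apply pow2_ge_0|left; apply exp_pos].
Qed.

Lemma Rpower_sqr (x y : R) : Rpower x y ^ 2 = Rpower x (2 * y).
Proof.
replace (2 * y) with (y + y) by ring; rewrite Rpower_plus; ring.
Qed.

(** Cauchy-Schwarz with the weight [(1 + j^2)^(sigma / 2)]; the remaining sum of [j^(-2 sigma)] over
    [j > n] is at most [n^(1 - 2 sigma) / (2 sigma - 1)] by telescoping. *)
Lemma sobolev_tail (sigma : R) (f : R -> C) (n N : nat) :
  1/2 < sigma -> in_H_sigma sigma f -> (1 <= n)%nat ->
  rsum (fun i => Cmod (fhat f (Z.of_nat (n + S i))) + Cmod (fhat f (- Z.of_nat (n + S i))%Z)) N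
  <= H_norm sigma f * (/ sqrt (sigma - 1/2) * Rpower (INR n) (- sigma + 1/2)).
Proof.
intros Hs Hf Hn.
assert (Hn0 : 1 <= INR n) by (apply (le_INR 1), Hn).
set (c := fun i => Cmod (fhat f (Z.of_nat (n + S i))) + Cmod (fhat f (- Z.of_nat (n + S i))%Z)).
set (w := fun i => Rpower (1 + INR (n + S i) ^ 2) (sigma / 2)).
set (v := fun i => Rpower (1 + INR (n + S i) ^ 2) (- (sigma / 2))).
assert (Hw2 : forall i, w i ^ 2 = Rpower (1 + INR (n + S i) ^ 2) sigma).
{ intros i; unfold w; rewrite Rpower_sqr; f_equal; field. }
assert (Hv2 : forall i, v i ^ 2 <= Rpower (INR (n + S i)) (- (2 * sigma))).
{ intros i; unfold v; rewrite Rpower_sqr.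
  replace (2 * - (sigma / 2)) with (- sigma) by field.
  assert (H0 : 0 < INR (n + S i)) by (apply lt_0_INR; lia).
  rewrite !Rpower_Ropp; apply Rinv_le_contravar; [apply exp_pos|].
  rewrite <- Rpower_mult; apply Rle_Rpower_l; [lra|]; split; [apply exp_pos|].
  replace 2 with (INR 2) by (simpl; ring); rewrite Rpower_pow by assumption; lra. }
(* Grouping [m] with [- m] costs [(p + q)^2 <= 2 (p^2 + q^2)]. This 2 is moved to the other factor,
   where it turns [1 / (2 sigma - 1)] into [1 / (sigma - 1/2)]. *)
rewrite (rsum_ext _ (fun i => (/ sqrt 2 * (c i * w i)) * (sqrt 2 * v i))).
2: { intros i _; unfold w, v; rewrite Rpower_Ropp.
  fold (c i); field; split; [|apply Rgt_not_eq, sqrt_lt_R0; lra].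
  apply Rgt_not_eq, exp_pos. }
eapply Rle_trans; [apply rsum_Cauchy_Schwarz|].
assert (H2 : sqrt 2 ^ 2 = 2) by (apply pow2_sqrt; lra).
apply Rmult_le_compat; try apply sqrt_pos.
- unfold H_norm; apply sqrt_le_1_alt.
  eapply Rle_trans; [|apply (rsum_le_Series _ (n + S N)); [apply sob_term_nonneg|exact Hf]].
  replace (n + S N)%nat with (S n + N)%nat by lia; rewrite rsum_split.
  apply Rle_trans with (rsum (fun i => sob_term sigma f (S n + i)) N);
    [|generalize (rsum_nonneg (sob_term sigma f) (S n) (fun k _ => sob_term_nonneg sigma f k)); lra].
  apply rsum_le; intros i _.
  rewrite !Rpow_mult_distr, Hw2, pow_inv, H2.
  replace (S n + i)%nat with (n + S i)%nat by lia.
  unfold c, sob_term; replace (n + S i)%nat with (S (n + i)) by lia.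
  set (p := Cmod (fhat f (Z.of_nat (S (n + i))))); set (q := Cmod (fhat f (- Z.of_nat (S (n + i)))%Z)).
  rewrite <- Rmult_assoc; apply Rmult_le_compat_r; [left; apply exp_pos|].
  generalize (pow2_ge_0 (p - q)); simpl; lra.
- apply Rle_trans with (sqrt (/ (sigma - 1/2) * Rpower (INR n) (1 - 2 * sigma))).
  + apply sqrt_le_1_alt.
    apply Rle_trans with (2 * rsum (fun i => Rpower (INR (n + S i)) (- (2 * sigma))) N).
    * rewrite <- rsum_scal; apply rsum_le; intros i _; rewrite Rpow_mult_distr, H2.
      apply Rmult_le_compat_l; [lra|apply Hv2].
    * generalize (rsum_Rpower_tail (2 * sigma) n N ltac:(lra) Hn); intros H.
      apply Rmult_le_reg_l with (sigma - 1/2); [lra|].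
      replace ((sigma - 1 / 2) * (/ (sigma - 1 / 2) * Rpower (INR n) (1 - 2 * sigma)))
        with (Rpower (INR n) (1 - 2 * sigma)) by (field; lra).
      lra.
  + rewrite sqrt_mult_alt by (left; apply Rinv_0_lt_compat; lra).
    rewrite <- sqrt_inv.
    replace (Rpower (INR n) (1 - 2 * sigma)) with (Rpower (INR n) (- sigma + 1/2) ^ 2).
    * rewrite sqrt_pow2 by (left; apply exp_pos); right; reflexivity.
    * rewrite Rpower_sqr; f_equal; field.
Qed.

(** The common route of the Sobolev and the analytic estimate, which differ only in how they bound
    the tail of the coefficients. *)
Lemma quad_error_fourier_tail (L : nat -> nat) (xs tau : nat -> nat -> R) (A B : R)
  (hMZ : MZ_family L xs tau A B) (f : R -> C) (n : nat) (T : R) : (1 <= n)%nat ->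
  periodic1 f -> (forall s, ccont f s) ->
  (forall N, rsum (fun i => Cmod (fhat f (Z.of_nat (n + S i))) + Cmod (fhat f (- Z.of_nat (n + S i))%Z)) N <= T) ->
  Cmod (Cminus (Iint f) (quad L xs tau n f)) <= (1 + sqrt (B / A)) * T.
Proof.
intros Hn Hp Hf HT; apply (quad_error L xs tau A B hMZ n f (fourier_sum f n)); try assumption.
- apply trig_poly_fourier_sum.
- apply fourier_tail; assumption.
Qed.

(** * Complex differentiability and Goursat's lemma *)

Notation C_metric := (AbsRing_UniformSpace C_AbsRing).

(** Continuity for the uniform structure of the modulus, whose neighbourhoods are discs, as
    [continuous_C_eps] makes explicit. *)
Definition C_continuous (phi : C -> C) (z : C) : Prop :=
  continuous (T := C_metric) (U := C_metric) phi z.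

Lemma C_continuous_plus (f g : C -> C) (z : C) :
  C_continuous f z -> C_continuous g z -> C_continuous (fun w => f w + g w)%C z.
Proof.
exact (continuous_plus (U := C_metric) (K := C_AbsRing) (V := AbsRing_NormedModule C_AbsRing) f g z).
Qed.

Lemma C_continuous_mult (f g : C -> C) (z : C) :
  C_continuous f z -> C_continuous g z -> C_continuous (fun w => f w * g w)%C z.
Proof. exact (continuous_mult (U := C_metric) (K := C_AbsRing) f g z). Qed.

Lemma C_continuous_const (c z : C) : C_continuous (fun _ => c) z.
Proof. exact (continuous_const (U := C_metric) (V := C_metric) c z). Qed.

Lemma C_continuous_id (z : C) : C_continuous (fun w => w) z.
Proof. exact (continuous_id (U := C_metric) z). Qed.

(* Caratheodory's formulation: [phi] is the difference quotient. *)
Definition cdiff (H : C -> C) (z : C) : Prop :=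
  exists phi : C -> C, (forall w, H w = H z + phi w * (w - z))%C /\
    C_continuous phi z.

Lemma continuous_C_eps (phi : C -> C) (z : C) :
  C_continuous phi z <->
  forall eps, 0 < eps -> exists d, 0 < d /\ forall w, Cmod (w - z)%C < d -> Cmod (phi w - phi z)%C < eps.
Proof.
split.
- intros H eps Heps.
  destruct (H (fun y => Cmod (y - phi z)%C < eps)) as [d Hd].
  + exists (mkposreal eps Heps); intros y Hy; exact Hy.
  + exists d; split; [apply cond_pos|]; intros w Hw; apply Hd, Hw.
- intros H P [eps HP].
  destruct (H eps (cond_pos eps)) as [d [Hd Hd']].
  exists (mkposreal d Hd); intros w Hw; apply HP, Hd', Hw.
Qed.

Lemma ccont_eps (f : R -> C) (x : R) :
  (forall eps, 0 < eps -> exists d, 0 < d /\ forall y, Rabs (y - x) < d -> Cmod (f y - f x)%C < eps) ->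
  ccont f x.
Proof.
intros H; split; intros P [eps HP]; destruct (H eps (cond_pos eps)) as [d [Hd Hd']];
  exists (mkposreal d Hd); intros y Hy; apply HP;
  (eapply Rle_lt_trans; [|apply (Hd' y Hy)]); (eapply Rle_trans; [|apply Rmax_Cmod]).
- apply Rmax_l.
- apply Rmax_r.
Qed.

Lemma Cmod_fst_snd (z : C) : Cmod z <= Rabs (fst z) + Rabs (snd z).
Proof.
replace z with (RtoC (fst z) + Ci * RtoC (snd z))%C at 1
  by (destruct z; unfold RtoC, Ci, Cmult, Cplus; simpl; f_equal; ring).
eapply Rle_trans; [apply Cmod_triangle|]; rewrite Cmod_mult, Cmod_Ci, !Cmod_R; lra.
Qed.

Lemma cdiff_continuous (H : C -> C) (z : C) : cdiff H z ->
  C_continuous H z.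
Proof.
intros [phi [H1 H2]].
apply (continuous_ext (T := C_metric) (U := C_metric) (fun w => H z + phi w * (w + - z))%C).
{ intros w; symmetry; apply H1. }
apply C_continuous_plus; [apply C_continuous_const|].
apply C_continuous_mult; [exact H2|].
apply C_continuous_plus; [apply C_continuous_id|apply C_continuous_const].
Qed.

Lemma cdiff_ccont (H : C -> C) (g : R -> C) (x : R) :
  cdiff H (g x) -> ccont g x -> ccont (fun t => H (g t)) x.
Proof.
intros Hd [g1 g2]; apply ccont_eps; intros eps Heps.
destruct (proj1 (continuous_C_eps H (g x)) (cdiff_continuous _ _ Hd) eps Heps) as [d [Hd0 Hd1]].
assert (Hd2 : 0 < d / 2) by lra.
destruct (g1 (fun u => Rabs (u - fst (g x)) < d / 2)) as [e1 He1].
{ exists (mkposreal _ Hd2); intros y Hy; exact Hy. }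
destruct (g2 (fun u => Rabs (u - snd (g x)) < d / 2)) as [e2 He2].
{ exists (mkposreal _ Hd2); intros y Hy; exact Hy. }
exists (Rmin e1 e2); split; [apply Rmin_pos; apply cond_pos|]; intros y Hy.
apply Hd1; eapply Rle_lt_trans; [apply Cmod_fst_snd|]; simpl.
assert (E1 := He1 y (Rlt_le_trans _ _ _ Hy (Rmin_l _ _))).
assert (E2 := He2 y (Rlt_le_trans _ _ _ Hy (Rmin_r _ _))).
unfold Rminus in *; lra.
Qed.

Lemma cdiff_const (c z : C) : cdiff (fun _ => c) z.
Proof. exists (fun _ => RtoC 0); split; [intros; ring|apply C_continuous_const]. Qed.

Lemma cdiff_id (z : C) : cdiff (fun w => w) z.
Proof. exists (fun _ => RtoC 1); split; [intros; ring|apply C_continuous_const]. Qed.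

Lemma cdiff_plus (H K : C -> C) (z : C) : cdiff H z -> cdiff K z -> cdiff (fun w => H w + K w)%C z.
Proof.
intros [phi [H1 H2]] [psi [K1 K2]]; exists (fun w => phi w + psi w)%C; split.
- intros w; rewrite (H1 w), (K1 w); ring.
- apply C_continuous_plus; assumption.
Qed.

Lemma cdiff_mult (H K : C -> C) (z : C) : cdiff H z -> cdiff K z -> cdiff (fun w => H w * K w)%C z.
Proof.
intros HH HK; assert (HKc := cdiff_continuous K z HK).
destruct HH as [phi [H1 H2]]; destruct HK as [psi [K1 K2]].
exists (fun w => phi w * K w + H z * psi w)%C; split.
- intros w; rewrite (H1 w), (K1 w); ring.
- apply C_continuous_plus; apply C_continuous_mult; try assumption; apply C_continuous_const.
Qed.

Lemma cdiff_comp (H K : C -> C) (z : C) : cdiff H (K z) -> cdiff K z -> cdiff (fun w => H (K w)) z.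
Proof.
intros HH HK; assert (HKc := cdiff_continuous K z HK).
destruct HH as [phi [H1 H2]]; destruct HK as [psi [K1 K2]].
exists (fun w => phi (K w) * psi w)%C; split.
- intros w; rewrite (H1 (K w)); replace (K w - K z)%C with (psi w * (w - z))%C by (rewrite (K1 w); ring); ring.
- apply C_continuous_mult; [|assumption].
  exact (continuous_comp (U := C_metric) (V := C_metric) (W := C_metric) K phi z HKc H2).
Qed.

Lemma cdiff_of_estimate (H : C -> C) (z l : C) :
  (forall eps, 0 < eps -> exists d, 0 < d /\ forall w, Cmod (w - z)%C < d ->
     Cmod (H w - H z - l * (w - z))%C <= eps * Cmod (w - z)%C) -> cdiff H z.
Proof.
intros He.
exists (fun w => if excluded_middle_informative (w = z) then l else (H w - H z) / (w - z))%C.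
assert (Hnz : forall w : C, w <> z -> (w - z)%C <> RtoC 0).
{ intros w Hw E; apply Hw; replace w with (w - z + z)%C by ring; rewrite E; ring. }
split.
- intros w; destruct (excluded_middle_informative (w = z)) as [->|Hw]; [ring|].
  field; apply Hnz, Hw.
- apply continuous_C_eps; intros eps Heps.
  destruct (He (eps / 2) ltac:(lra)) as [d [Hd Hd']]; exists d; split; [exact Hd|]; intros w Hw.
  destruct (excluded_middle_informative (z = z)) as [_|K]; [|contradiction].
  destruct (excluded_middle_informative (w = z)) as [_|Hw'].
  + replace (l - l)%C with (RtoC 0) by ring; rewrite Cmod_0; exact Heps.
  + specialize (Hd' w Hw); assert (Hp := proj1 (Cmod_gt_0 _) (Hnz w Hw')).
    replace ((H w - H z) / (w - z) - l)%C with ((H w - H z - l * (w - z)) / (w - z))%C by (field; apply Hnz, Hw').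
    rewrite Cmod_div by (apply Hnz, Hw').
    apply Rmult_lt_reg_r with (Cmod (w - z)%C); [exact Hp|].
    unfold Rdiv; rewrite Rmult_assoc, Rinv_l, Rmult_1_r by lra.
    eapply Rle_lt_trans; [exact Hd'|]; apply Rmult_lt_compat_r; lra.
Qed.

Lemma ex_derive_cdiff (F : C -> C) (z : C) :
  ex_derive (K := C_AbsRing) (V := C_NormedModule) F z -> cdiff F z.
Proof.
intros [l [_ Hl]]; apply (cdiff_of_estimate F z l); intros eps Heps.
destruct (Hl z (fun P HP => HP) (mkposreal eps Heps)) as [d Hd].
exists d; split; [apply cond_pos|]; intros w Hw; specialize (Hd w Hw); simpl in Hd.
rewrite (Cmult_comm l); exact Hd.
Qed.

(** * The complex exponential *)

Definition cexp (z : C) : C := (exp (fst z) * cos (snd z), exp (fst z) * sin (snd z)).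

Lemma cexp_plus (z w : C) : cexp (z + w) = (cexp z * cexp w)%C.
Proof.
unfold cexp, Cmult; simpl; rewrite exp_plus, cos_plus, sin_plus; f_equal; ring.
Qed.

Lemma Rabs_sin_le (t : R) : Rabs (sin t) <= Rabs t.
Proof.
assert (H : forall t, 0 <= t -> Rabs (sin t) <= t).
{ clear t; intros t Ht; destruct (Rle_dec t 1) as [H1|H1].
  - destruct (Req_dec t 0) as [->|H0]; [rewrite sin_0, Rabs_R0; lra|].
    rewrite Rabs_pos_eq; [left; apply sin_lt_x; lra|].
    apply sin_ge_0; [lra|]; generalize PI2_1; lra.
  - apply Rabs_le; generalize (SIN_bound t); lra. }
destruct (Rle_dec 0 t) as [H0|H0].
- rewrite (Rabs_pos_eq t) by assumption; apply H, H0.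
- rewrite <- (Rabs_Ropp t), <- Rabs_Ropp, <- sin_neg, (Rabs_pos_eq (- t)) by lra; apply H; lra.
Qed.

Lemma Rabs_sin_minus_id (t : R) : Rabs t <= 1 -> Rabs (sin t - t) <= t ^ 2.
Proof.
assert (H : forall t, 0 <= t <= 1 -> Rabs (sin t - t) <= t ^ 2).
{ clear t; intros t Ht.
  destruct (pre_sin_bound t 0) as [H1 _]; [lra|lra|].
  unfold sin_approx, sin_term in H1; simpl in H1.
  assert (H2 := Rabs_sin_le t); rewrite (Rabs_pos_eq t) in H2 by lra.
  apply Rabs_le_between in H2.
  assert (t ^ 3 <= t ^ 2).
  { replace (t ^ 3) with (t ^ 2 * t) by ring; rewrite <- (Rmult_1_r (t ^ 2)) at 2.
    apply Rmult_le_compat_l; [apply pow2_ge_0|lra]. }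
  assert (0 <= t ^ 3) by (apply pow_le; lra).
  apply Rabs_le; split; [|generalize (pow2_ge_0 t); lra].
  assert (t - t ^ 3 / 6 <= sin t); [|lra].
  eapply Rle_trans; [|exact H1]; right; simpl; field. }
intros Ht; destruct (Rle_dec 0 t) as [H0|H0].
- apply H; rewrite Rabs_pos_eq in Ht; lra.
- rewrite Rabs_left in Ht by lra.
  replace (sin t - t) with (- (sin (- t) - - t)) by (rewrite sin_neg; ring).
  replace (t ^ 2) with ((- t) ^ 2) by ring; rewrite Rabs_Ropp; apply H; lra.
Qed.

(** From [exp (- x) >= 1 - x] follows [exp x * (1 - x) <= 1], hence
    [(exp x - 1 - x) * (1 - x) <= x ^ 2], and [1 - x >= 1/2]. *)
Lemma exp_minus_taylor (x : R) : Rabs x <= 1/2 -> 0 <= exp x - 1 - x <= 2 * x ^ 2.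
Proof.
intros Hx; apply Rabs_le_between in Hx; split; [generalize (exp_ineq1_le x); lra|].
assert (H := exp_ineq1_le (- x)).
assert (E : exp x * exp (- x) = 1) by (rewrite <- exp_plus, Rplus_opp_r; apply exp_0).
assert (H1 : exp x * (1 - x) <= 1).
{ rewrite <- E; apply Rmult_le_compat_l; [left; apply exp_pos|lra]. }
assert (Hx2 : 0 <= x ^ 2) by apply pow2_ge_0.
apply Rmult_le_reg_r with (1 - x); [lra|].
assert (0 <= x ^ 2 * (1 - 2 * x)) by (apply Rmult_le_pos; lra).
replace ((exp x - 1 - x) * (1 - x)) with (exp x * (1 - x) - 1 + x ^ 2) by ring.
replace (2 * x ^ 2 * (1 - x)) with (x ^ 2 + x ^ 2 * (1 - 2 * x)) by ring; lra.
Qed.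

(** Differentiability at 0 with a quadratic remainder, which [cexp_plus] carries to every point. The
    constant is generous: the bounds on the two components add up to [4 |h|^2]. *)
Lemma cexp_taylor (h : C) : Cmod h <= 1/2 -> Cmod (cexp h - RtoC 1 - h)%C <= 10 * Cmod h ^ 2.
Proof.
destruct h as [x y]; intros Hh.
assert (Hx := Rle_trans _ _ _ (Rmax_l _ _) (Rmax_Cmod (x, y))).
assert (Hy := Rle_trans _ _ _ (Rmax_r _ _) (Rmax_Cmod (x, y))); simpl in Hx, Hy.
assert (H2 : Cmod (x, y) ^ 2 = x ^ 2 + y ^ 2) by (rewrite Cmod2_alt; reflexivity).
rewrite H2; eapply Rle_trans; [apply Cmod_fst_snd|]; simpl fst; simpl snd.
destruct (exp_minus_taylor x ltac:(lra)) as [E1 E2].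
assert (Hex : exp x <= 2).
{ assert (x ^ 2 <= 1 / 4).
  { rewrite <- pow2_abs; replace (1/4) with ((1/2) ^ 2) by field; apply pow_incr; split; [apply Rabs_pos|lra]. }
  generalize (Rle_abs x); lra. }
assert (Hcos : 0 <= 1 - cos y <= y ^ 2 / 2).
{ replace y with (2 * (y / 2)) at 1 2 by field; rewrite cos_2a_sin.
  assert (H := Rabs_sin_le (y / 2)).
  assert (sin (y / 2) ^ 2 <= (y / 2) ^ 2).
  { rewrite <- pow2_abs, <- (pow2_abs (y / 2)); apply pow_incr; split; [apply Rabs_pos|exact H]. }
  generalize (pow2_ge_0 (sin (y / 2))); lra. }
assert (P1 : Rabs (exp x * cos y + - (1) + - x) <= 2 * x ^ 2 + y ^ 2).
{ replace (exp x * cos y + - (1) + - x) with ((exp x - 1 - x) - exp x * (1 - cos y)) by ring.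
  assert (0 <= exp x * (1 - cos y) <= 2 * (y ^ 2 / 2)).
  { split; [apply Rmult_le_pos; [left; apply exp_pos|lra]|].
    apply Rmult_le_compat; try lra; left; apply exp_pos. }
  apply Rabs_le; generalize (pow2_ge_0 x) (pow2_ge_0 y); lra. }
assert (P2 : Rabs (exp x * sin y + - 0 + - y) <= 2 * x ^ 2 + 3 * y ^ 2).
{ replace (exp x * sin y + - 0 + - y) with ((exp x - 1) * sin y + (sin y - y)) by ring.
  eapply Rle_trans; [apply Rabs_triang|].
  assert (S1 := Rabs_sin_minus_id y ltac:(lra)); assert (S2 := Rabs_sin_le y).
  rewrite Rabs_mult.
  assert (X1 : Rabs (exp x - 1) <= 2 * Rabs x).
  { replace (exp x - 1) with ((exp x - 1 - x) + x) by ring.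
    eapply Rle_trans; [apply Rabs_triang|]; rewrite (Rabs_pos_eq (exp x - 1 - x)) by assumption.
    assert (2 * x ^ 2 <= Rabs x).
    { rewrite <- pow2_abs; simpl; rewrite Rmult_1_r, <- Rmult_assoc.
      rewrite <- (Rmult_1_l (Rabs x)) at 3; apply Rmult_le_compat_r; [apply Rabs_pos|lra]. }
    lra. }
  assert (Rabs (exp x - 1) * Rabs (sin y) <= 2 * Rabs x * Rabs y)
    by (apply Rmult_le_compat; try apply Rabs_pos; assumption).
  assert (H3 := pow2_ge_0 (Rabs x - Rabs y)).
  assert (2 * Rabs x * Rabs y <= x ^ 2 + y ^ 2) by (rewrite <- (pow2_abs x), <- (pow2_abs y); lra).
  generalize (pow2_ge_0 x) (pow2_ge_0 y); lra. }
generalize (pow2_ge_0 x) (pow2_ge_0 y); lra.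
Qed.

Lemma cdiff_cexp (z : C) : cdiff cexp z.
Proof.
apply (cdiff_of_estimate cexp z (cexp z)); intros eps Heps.
set (K := Cmod (cexp z)); assert (HK : 0 <= K) by apply Cmod_ge_0.
assert (Hd : 0 < eps / (10 * (K + 1))) by (apply Rdiv_lt_0_compat; lra).
exists (Rmin (1/2) (eps / (10 * (K + 1)))); split; [apply Rmin_pos; lra|].
intros w Hw; set (h := (w - z)%C) in *.
assert (H1 := Rlt_le_trans _ _ _ Hw (Rmin_l _ _)); assert (H2 := Rlt_le_trans _ _ _ Hw (Rmin_r _ _)).
replace w with (z + h)%C by (unfold h; ring); rewrite cexp_plus.
replace (cexp z * cexp h - cexp z - cexp z * h)%C with (cexp z * (cexp h - RtoC 1 - h))%C by ring.
rewrite Cmod_mult; fold K; assert (Hh := Cmod_ge_0 h).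
apply Rle_trans with ((K + 1) * (10 * Cmod h ^ 2)).
- apply Rmult_le_compat; try apply Cmod_ge_0; try lra; apply cexp_taylor; lra.
- replace ((K + 1) * (10 * Cmod h ^ 2)) with (10 * (K + 1) * Cmod h * Cmod h) by ring.
  apply Rmult_le_compat_r; [exact Hh|].
  replace eps with (10 * (K + 1) * (eps / (10 * (K + 1)))) by (field; lra).
  apply Rmult_le_compat_l; lra.
Qed.

(** * Goursat's lemma on rectangles *)

(** The contour integral over the positively oriented boundary of [[a, b] x [c, d]]; the factor [Ci]
    is that of [dz = i dy] on the vertical sides. *)
Definition rect_int (H : C -> C) (a b c d : R) : C :=
  (CInt (fun x => H (x, c)) a b + Ci * CInt (fun y => H (b, y)) c d
   - CInt (fun x => H (x, d)) a b - Ci * CInt (fun y => H (a, y)) c d)%C.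

Definition cdiff_rect (H : C -> C) (a b c d : R) : Prop :=
  forall x y, a <= x <= b -> c <= y <= d -> cdiff H (x, y).

Lemma ccont_horizontal (H : C -> C) (x y : R) : cdiff H (x, y) -> ccont (fun t => H (t, y)) x.
Proof.
intros Hd; apply (cdiff_ccont H (fun t => (t, y))); [exact Hd|].
split; [apply continuous_id|apply continuous_const].
Qed.

Lemma ccont_vertical (H : C -> C) (x y : R) : cdiff H (x, y) -> ccont (fun t => H (x, t)) y.
Proof.
intros Hd; apply (cdiff_ccont H (fun t => (x, t))); [exact Hd|].
split; [apply continuous_const|apply continuous_id].
Qed.

Lemma rect_int_split_x (H : C -> C) (a m b c d : R) : a <= m <= b -> c <= d ->
  cdiff_rect H a b c d -> rect_int H a b c d = (rect_int H a m c d + rect_int H m b c d)%C.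
Proof.
intros Hm Hcd Hd; unfold rect_int.
rewrite (CInt_Chasles (fun x => H (x, c)) a m b), (CInt_Chasles (fun x => H (x, d)) a m b); try lra; [ring| |];
  intros x Hx; apply ccont_horizontal, Hd; lra.
Qed.

Lemma rect_int_split_y (H : C -> C) (a b c m d : R) : c <= m <= d -> a <= b ->
  cdiff_rect H a b c d -> rect_int H a b c d = (rect_int H a b c m + rect_int H a b m d)%C.
Proof.
intros Hm Hcd Hd; unfold rect_int.
rewrite (CInt_Chasles (fun y => H (a, y)) c m d), (CInt_Chasles (fun y => H (b, y)) c m d); try lra; [ring| |];
  intros x Hx; apply ccont_vertical, Hd; lra.
Qed.

Lemma CInt_affine (u v : C) (a b : R) : a <= b ->
  CInt (fun x => u + v * RtoC x)%C a b = (u * RtoC (b - a) + v * RtoC ((b ^ 2 - a ^ 2) / 2))%C.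
Proof.
intros Hab.
rewrite (CInt_derive (fun x => u * RtoC x + v * RtoC (x ^ 2 / 2))%C).
- rewrite !RtoC_minus.
  replace ((b ^ 2 - a ^ 2) / 2) with (b ^ 2 / 2 - a ^ 2 / 2) by field; rewrite RtoC_minus; ring.
- exact Hab.
- intros x _; unfold RtoC; simpl; auto_derive; [trivial|]; field.
- intros x _; unfold RtoC; simpl; auto_derive; [trivial|]; field.
- intros x _; apply ccont_plus; [apply ccont_const|]; apply ccont_mult; [apply ccont_const|].
  apply ccont_RtoC, continuous_id.
Qed.

Lemma rect_int_affine (u v : C) (a b c d : R) : a <= b -> c <= d ->
  rect_int (fun w => u + v * w)%C a b c d = RtoC 0.
Proof.
intros Hab Hcd; unfold rect_int.
assert (Hx : forall y, CInt (fun x => u + v * ((x, y) : C))%C a b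
  = CInt (fun x => (u + v * (Ci * RtoC y)) + v * RtoC x)%C a b).
{ intros y; apply CInt_ext; [exact Hab|]; intros x _.
  replace ((x, y) : C) with (RtoC x + Ci * RtoC y)%C
    by (unfold RtoC, Ci, Cmult, Cplus; simpl; f_equal; ring); ring. }
assert (Hy : forall x, CInt (fun y => u + v * ((x, y) : C))%C c d
  = CInt (fun y => (u + v * RtoC x) + (v * Ci) * RtoC y)%C c d).
{ intros x; apply CInt_ext; [exact Hcd|]; intros y _.
  replace ((x, y) : C) with (RtoC x + Ci * RtoC y)%C
    by (unfold RtoC, Ci, Cmult, Cplus; simpl; f_equal; ring); ring. }
rewrite !Hx, !Hy, !CInt_affine by assumption.
rewrite !RtoC_minus; ring.
Qed.

Lemma rect_int_plus (H K : C -> C) (a b c d : R) : a <= b -> c <= d ->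
  cdiff_rect H a b c d -> cdiff_rect K a b c d ->
  rect_int (fun w => H w + K w)%C a b c d = (rect_int H a b c d + rect_int K a b c d)%C.
Proof.
intros Hab Hcd HH HK; unfold rect_int.
rewrite (CInt_plus (fun x => H (x, c)) (fun x => K (x, c))),
  (CInt_plus (fun x => H (x, d)) (fun x => K (x, d))),
  (CInt_plus (fun y => H (a, y)) (fun y => K (a, y))),
  (CInt_plus (fun y => H (b, y)) (fun y => K (b, y))); try assumption; try ring;
  intros t Ht; first [apply ccont_horizontal | apply ccont_vertical];
  first [apply HH | apply HK]; lra.
Qed.

Lemma rect_int_bound (H : C -> C) (a b c d M : R) : a <= b -> c <= d -> cdiff_rect H a b c d ->
  (forall x y, a <= x <= b -> c <= y <= d -> Cmod (H (x, y)) <= M) ->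
  Cmod (rect_int H a b c d) <= 2 * ((b - a) + (d - c)) * M.
Proof.
intros Hab Hcd Hd HM.
assert (B1 : forall y, c <= y <= d -> Cmod (CInt (fun x => H (x, y)) a b) <= (b - a) * M).
{ intros y Hy; apply Cmod_CInt_le_const; [exact Hab| |auto].
  intros x Hx; apply ccont_horizontal, Hd; assumption. }
assert (B2 : forall x, a <= x <= b -> Cmod (CInt (fun y => H (x, y)) c d) <= (d - c) * M).
{ intros x Hx; apply Cmod_CInt_le_const; [exact Hcd| |auto].
  intros y Hy; apply ccont_vertical, Hd; assumption. }
unfold rect_int, Cminus.
eapply Rle_trans; [apply Cmod_triangle|]; eapply Rle_trans; [apply Rplus_le_compat_r, Cmod_triangle|].
eapply Rle_trans; [apply Rplus_le_compat_r, Rplus_le_compat_r, Cmod_triangle|].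
rewrite !Cmod_opp, !Cmod_mult, Cmod_Ci.
generalize (B1 c ltac:(lra)) (B1 d ltac:(lra)) (B2 a ltac:(lra)) (B2 b ltac:(lra)); lra.
Qed.

(** Adding [u + v * w], the negative of the tangent at [z], leaves the integral unchanged and turns
    [H] into [(phi w - phi z) * (w - z)]. With [l] the half perimeter, this is at most [eps / 2 * l]
    on a boundary of length [2 * l]. *)
Lemma rect_int_local (H : C -> C) (z : C) (eps : R) : cdiff H z -> 0 < eps ->
  exists delta, 0 < delta /\ forall a b c d, a <= fst z <= b -> c <= snd z <= d ->
    b - a < delta -> d - c < delta -> cdiff_rect H a b c d ->
    Cmod (rect_int H a b c d) <= eps * ((b - a) + (d - c)) ^ 2.
Proof.
intros [phi [H1 H2]] Heps.
destruct (proj1 (continuous_C_eps phi z) H2 (eps / 2) ltac:(lra)) as [e [He He']].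
exists (e / 2); split; [lra|]; intros a b c d Hx Hy Hba Hdc Hd.
set (u := (phi z * z - H z)%C); set (v := (- phi z)%C).
assert (Hlin : cdiff_rect (fun w => u + v * w)%C a b c d).
{ intros x y _ _; apply cdiff_plus; [apply cdiff_const|]; apply cdiff_mult; [apply cdiff_const|apply cdiff_id]. }
replace (rect_int H a b c d) with (rect_int (fun w => H w + (u + v * w))%C a b c d).
2: { rewrite rect_int_plus, rect_int_affine by (assumption || lra); ring. }
replace (eps * (b - a + (d - c)) ^ 2) with (2 * ((b - a) + (d - c)) * (eps / 2 * ((b - a) + (d - c)))) by field.
apply rect_int_bound; try lra.
- intros x y Hx' Hy'; apply cdiff_plus; [apply Hd|apply Hlin]; assumption.
- intros x y Hx' Hy'.
  replace (H (x, y) + (u + v * (x, y)))%C with ((phi (x, y) - phi z) * ((x, y) - z))%C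
    by (rewrite (H1 (x, y)); unfold u, v; ring).
  rewrite Cmod_mult.
  assert (Hw : Cmod ((x, y) - z)%C <= (b - a) + (d - c)).
  { eapply Rle_trans; [apply Cmod_fst_snd|]; simpl.
    apply Rplus_le_compat; apply Rabs_le; lra. }
  apply Rmult_le_compat; try apply Cmod_ge_0; [|exact Hw].
  left; apply He'; lra.
Qed.

(** The four quarters add up to the whole, and the squared half perimeter drops to a quarter: if no
    quarter violated the bound, the rectangle would not either. *)
Lemma rect_int_quarter (H : C -> C) (a b c d eps : R) : a <= b -> c <= d -> cdiff_rect H a b c d ->
  eps * ((b - a) + (d - c)) ^ 2 < Cmod (rect_int H a b c d) ->
  exists a' b' c' d', (a <= a' /\ a' <= b' /\ b' <= b) /\ (c <= c' /\ c' <= d' /\ d' <= d) /\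
    b' - a' = (b - a) / 2 /\ d' - c' = (d - c) / 2 /\
    eps * ((b' - a') + (d' - c')) ^ 2 < Cmod (rect_int H a' b' c' d').
Proof.
intros Hab Hcd Hd Hbad; set (m := (a + b) / 2); set (k := (c + d) / 2).
assert (Hm : a <= m <= b) by (unfold m; lra); assert (Hk : c <= k <= d) by (unfold k; lra).
apply NNPP; intros Hno.
assert (Hq : forall a' b' c' d', (a <= a' /\ a' <= b' /\ b' <= b) -> (c <= c' /\ c' <= d' /\ d' <= d) ->
    b' - a' = (b - a) / 2 -> d' - c' = (d - c) / 2 ->
    Cmod (rect_int H a' b' c' d') <= eps * ((b - a) + (d - c)) ^ 2 / 4).
{ intros a' b' c' d' Ha Hc Hb' Hd'.
  replace (eps * (b - a + (d - c)) ^ 2 / 4) with (eps * ((b' - a') + (d' - c')) ^ 2)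
    by (rewrite Hb', Hd'; field).
  apply Rnot_lt_le; intros Hlt; apply Hno; exists a', b', c', d'; repeat (split; try assumption); try apply Ha; apply Hc. }
rewrite (rect_int_split_x H a m b c d), (rect_int_split_y H a m c k d), (rect_int_split_y H m b c k d) in Hbad;
  try lra; try assumption; try (intros x y Hx Hy; apply Hd; lra).
assert (Q1 := Hq a m c k ltac:(lra) ltac:(lra) ltac:(unfold m; field) ltac:(unfold k; field)).
assert (Q2 := Hq a m k d ltac:(lra) ltac:(lra) ltac:(unfold m; field) ltac:(unfold k; field)).
assert (Q3 := Hq m b c k ltac:(lra) ltac:(lra) ltac:(unfold m; field) ltac:(unfold k; field)).
assert (Q4 := Hq m b k d ltac:(lra) ltac:(lra) ltac:(unfold m; field) ltac:(unfold k; field)).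
assert (T1 := Cmod_triangle (rect_int H a m c k) (rect_int H a m k d)).
assert (T2 := Cmod_triangle (rect_int H m b c k) (rect_int H m b k d)).
assert (T3 := Cmod_triangle (rect_int H a m c k + rect_int H a m k d) (rect_int H m b c k + rect_int H m b k d)).
lra.
Qed.

Lemma nested_intervals (a b : nat -> R) :
  (forall n, a n <= a (S n)) -> (forall n, b (S n) <= b n) -> (forall n, a n <= b n) ->
  exists x, forall n, a n <= x <= b n.
Proof.
intros Ha Hb Hab.
assert (Ha' : forall n k, a n <= a (n + k)%nat).
{ intros n k; induction k as [|k IH]; [rewrite Nat.add_0_r; lra|].
  rewrite Nat.add_succ_r; generalize (Ha (n + k)%nat); lra. }
assert (Hb' : forall n k, b (n + k)%nat <= b n).
{ intros n k; induction k as [|k IH]; [rewrite Nat.add_0_r; lra|].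
  rewrite Nat.add_succ_r; generalize (Hb (n + k)%nat); lra. }
assert (Hmn : forall m n, a m <= b n).
{ intros m n; generalize (Ha' m n) (Hb' n m) (Hab (m + n)%nat); rewrite (Nat.add_comm n m); lra. }
destruct (completeness (fun x => exists n, x = a n)) as [X [X1 X2]].
- exists (b O); intros x [n ->]; apply Hmn.
- exists (a O), O; reflexivity.
- exists X; intros n; split; [apply X1; exists n; reflexivity|].
  apply X2; intros x [m ->]; apply Hmn.
Qed.

(** If the bound [eps * s ^ 2] failed, it would fail on nested rectangles shrinking to a point of
    the original one, against [rect_int_local] at that point. *)
Lemma goursat (H : C -> C) (a b c d : R) : a <= b -> c <= d -> cdiff_rect H a b c d ->
  rect_int H a b c d = RtoC 0.
Proof.
intros Hab Hcd Hd; set (s := (b - a) + (d - c)).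
assert (Hle : forall eps, 0 < eps -> Cmod (rect_int H a b c d) <= eps * s ^ 2).
{ intros eps Heps; apply Rnot_lt_le; intros Hbad.
  set (good := fun q : (R * R) * (R * R) => let '((a', b'), (c', d')) := q in
    (a <= a' /\ a' <= b' /\ b' <= b) /\ (c <= c' /\ c' <= d' /\ d' <= d) /\
    eps * ((b' - a') + (d' - c')) ^ 2 < Cmod (rect_int H a' b' c' d')).
  set (refines := fun q q' : (R * R) * (R * R) =>
    (fst (fst q) <= fst (fst q') /\ snd (fst q') <= snd (fst q)) /\
    (fst (snd q) <= fst (snd q') /\ snd (snd q') <= snd (snd q)) /\
    snd (fst q') - fst (fst q') = (snd (fst q) - fst (fst q)) / 2 /\
    snd (snd q') - fst (snd q') = (snd (snd q) - fst (snd q)) / 2).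
  (* The implication stands inside the existential, so that every [q] has a successor and choice
     yields a plain function to iterate. *)
  assert (step : forall q, exists q', good q -> good q' /\ refines q q').
  { intros q; destruct (classic (good q)) as [Hg|Hg]; [|exists q; contradiction].
    destruct q as [[a1 b1] [c1 d1]]; destruct Hg as [G1 [G2 G3]].
    destruct (rect_int_quarter H a1 b1 c1 d1 eps) as [a2 [b2 [c2 [d2 [Q1 [Q2 [Q3 [Q4 Q5]]]]]]]];
      try lra; try (intros x y Hx Hy; apply Hd; lra).
    exists ((a2, b2), (c2, d2)); intros _; unfold good, refines; simpl; repeat split; lra. }
  set (next := fun q => proj1_sig (constructive_indefinite_description _ (step q))).
  assert (Hnext : forall q, good q -> good (next q) /\ refines q (next q)).
  { intros q; unfold next; destruct (constructive_indefinite_description _ (step q)) as [q' Hq']; exact Hq'. }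
  set (sq := fun n => Nat.iter n next ((a, b), (c, d))).
  assert (Hgood : forall n, good (sq n)).
  { induction n as [|n IH]; [unfold sq, good; simpl; repeat split; try lra; exact Hbad|apply Hnext, IH]. }
  assert (Href : forall n, refines (sq n) (sq (S n))) by (intros n; apply (Hnext (sq n)), Hgood).
  assert (Hord : forall n, fst (fst (sq n)) <= snd (fst (sq n)) /\ fst (snd (sq n)) <= snd (snd (sq n))).
  { intros n; generalize (Hgood n); destruct (sq n) as [[a1 b1] [c1 d1]]; unfold good; simpl; lra. }
  assert (Hwid : forall n, snd (fst (sq n)) - fst (fst (sq n)) = (b - a) * (1/2) ^ n /\
                           snd (snd (sq n)) - fst (snd (sq n)) = (d - c) * (1/2) ^ n).
  { induction n as [|n [IH1 IH2]]; [unfold sq; simpl; lra|].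
    destruct (Href n) as [_ [_ [R1 R2]]]; rewrite R1, R2, IH1, IH2; simpl; lra. }
  destruct (nested_intervals (fun n => fst (fst (sq n))) (fun n => snd (fst (sq n)))) as [X HX];
    [intros n; apply (Href n)|intros n; apply (Href n)|intros n; apply Hord|].
  destruct (nested_intervals (fun n => fst (snd (sq n))) (fun n => snd (snd (sq n)))) as [Y HY];
    [intros n; apply (Href n)|intros n; apply (Href n)|intros n; apply Hord|].
  destruct (rect_int_local H (X, Y) eps) as [delta [Hdel Hloc]]; [|exact Heps|].
  { apply Hd; [apply (HX O)|apply (HY O)]. }
  (* [s + 1] in place of [s] keeps the quotient meaningful for a rectangle reduced to a point. *)
  destruct (pow_lt_1_zero (1/2) ltac:(rewrite Rabs_pos_eq; lra) (delta / (s + 1))) as [n Hn].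
  { apply Rdiv_lt_0_compat; unfold s; lra. }
  specialize (Hn n (Nat.le_refl n)).
  rewrite Rabs_pos_eq in Hn by (apply pow_le; lra).
  assert (Hp : 0 < (1/2) ^ n) by (apply pow_lt; lra).
  assert (Hs : (s + 1) * (1/2) ^ n < delta).
  { apply Rmult_lt_compat_r with (r := s + 1) in Hn; [|unfold s; lra].
    replace (delta / (s + 1) * (s + 1)) with delta in Hn by (field; unfold s; lra); lra. }
  assert (B1 : 0 <= (b - a) * (1/2) ^ n) by (apply Rmult_le_pos; lra).
  assert (B2 : 0 <= (d - c) * (1/2) ^ n) by (apply Rmult_le_pos; lra).
  destruct (Hwid n) as [W1 W2]; specialize (HX n); specialize (HY n); generalize (Hgood n).
  cbv beta in HX, HY; destruct (sq n) as [[a1 b1] [c1 d1]]; unfold good; simpl in *; intros [G1 [G2 G3]].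
  apply (Rlt_not_le _ _ G3); apply Hloc; unfold s in Hs; try lra.
  intros x y Hx Hy; apply Hd; lra. }
apply Cmod_eq_0, Rle_antisym; [|apply Cmod_ge_0].
apply le_epsilon; intros eps Heps; rewrite Rplus_0_l.
assert (0 <= s ^ 2) by apply pow2_ge_0.
eapply Rle_trans; [apply (Hle (eps / (s ^ 2 + 1))); apply Rdiv_lt_0_compat; lra|].
replace eps with (eps / (s ^ 2 + 1) * (s ^ 2 + 1)) at 2 by (field; lra).
apply Rmult_le_compat_l; [|lra]; left; apply Rdiv_lt_0_compat; lra.
Qed.

(** When the top and bottom sides carry the same values, as for a function of period [i (d - c)],
    their integrals cancel. *)
Lemma goursat_vertical (H : C -> C) (a b c d : R) : a <= b -> c <= d -> cdiff_rect H a b c d ->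
  (forall x, a <= x <= b -> H (x, c) = H (x, d)) ->
  CInt (fun y => H (a, y)) c d = CInt (fun y => H (b, y)) c d.
Proof.
intros Hab Hcd Hd He; assert (G := goursat H a b c d Hab Hcd Hd); unfold rect_int in G.
rewrite (CInt_ext _ (fun x => H (x, d)) a b Hab He) in G.
set (J := CInt (fun x => H (x, d)) a b) in G; set (P := CInt (fun y => H (b, y)) c d) in *.
set (Q := CInt (fun y => H (a, y)) c d) in *.
(* Multiplication by [Ci] turns [Ci * P - Ci * Q] into [Q - P]. *)
replace Q with (P + Ci * (J + Ci * P - J - Ci * Q))%C; [rewrite G; ring|].
assert (HCi : (Ci * Ci)%C = RtoC (-1)) by (unfold Ci, RtoC, Cmult; simpl; f_equal; ring).
replace (P + Ci * (J + Ci * P - J - Ci * Q))%C with (P + (Ci * Ci) * (P - Q))%C by ring.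
rewrite HCi; ring.
Qed.

Lemma goursat_horizontal (H : C -> C) (a b c d : R) : a <= b -> c <= d -> cdiff_rect H a b c d ->
  (forall y, c <= y <= d -> H (a, y) = H (b, y)) ->
  CInt (fun x => H (x, c)) a b = CInt (fun x => H (x, d)) a b.
Proof.
intros Hab Hcd Hd He; assert (G := goursat H a b c d Hab Hcd Hd); unfold rect_int in G.
rewrite (CInt_ext _ (fun y => H (b, y)) c d Hcd He) in G.
set (P := CInt (fun x => H (x, c)) a b) in *; set (Q := CInt (fun x => H (x, d)) a b) in *.
set (J := CInt (fun y => H (b, y)) c d) in *.
replace P with (Q + (P + Ci * J - Q - Ci * J))%C by ring; rewrite G; ring.
Qed.

(** * Fourier coefficients of holomorphic functions *)

Lemma ccont_bounded (f : R -> C) (a b : R) : a <= b -> (forall s, ccont f s) ->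
  exists M, 0 <= M /\ forall x, a <= x <= b -> Cmod (f x) <= M.
Proof.
intros Hab Hf; destruct (continuity_ab_maj (fun x => Cmod (f x)) a b Hab) as [m [Hm _]].
- intros c _; apply continuity_pt_filterlim, continuous_Cmod, Hf.
- exists (Cmod (f m)); split; [apply Cmod_ge_0|exact Hm].
Qed.

Lemma fhat_bound (f : R -> C) (M : R) (m : Z) : (forall s, ccont f s) ->
  (forall x, 0 <= x <= 1 -> Cmod (f x) <= M) -> Cmod (fhat f m) <= M.
Proof.
intros Hf HM; rewrite fhat_CInt; replace M with ((1 - 0) * M) by ring.
apply Cmod_CInt_le_const; [lra| |].
- intros x _; apply ccont_mult; [apply Hf|apply ccont_conj, ccont_cexp2pi].
- intros x Hx; rewrite Cmod_mult, Cmod_conj, Cmod_cexp2pi, Rmult_1_r; auto.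
Qed.

Lemma rsum_geom_tail (q : R) (n N : nat) : 0 < q < 1 ->
  rsum (fun i => q ^ (n + S i)) N <= q ^ S n / (1 - q).
Proof.
intros Hq.
assert (H : (1 - q) * rsum (fun i => q ^ (n + S i)) N = q ^ S n - q ^ (S n + N)).
{ induction N as [|N IH]; [rewrite Nat.add_0_r; simpl; ring|].
  rewrite rsum_S, Rmult_plus_distr_l, IH.
  replace (n + S N)%nat with (S n + N)%nat by lia; replace (S n + S N)%nat with (S (S n + N)) by lia.
  simpl; ring. }
assert (0 < q ^ (S n + N)) by (apply pow_lt; lra).
apply Rmult_le_reg_l with (1 - q); [lra|].
replace ((1 - q) * (q ^ S n / (1 - q))) with (q ^ S n) by (field; lra); lra.
Qed.

Lemma cexp_2pi (m : Z) (x y : R) :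
  cexp (RtoC (2 * PI * IZR m) * (x, y))%C = (RtoC (exp (2 * PI * IZR m * x)) * cexp2pi m y)%C.
Proof.
unfold cexp, cexp2pi, RtoC, Cmult; simpl.
replace (2 * PI * IZR m * x - 0 * y) with (2 * PI * IZR m * x) by ring.
replace (2 * PI * IZR m * y + 0 * x) with (2 * PI * IZR m * y) by ring.
f_equal; ring.
Qed.

Lemma cdiff_cexp_scal (k z : C) : cdiff (fun w => cexp (k * w))%C z.
Proof.
apply (cdiff_comp cexp (fun w => k * w)%C); [apply cdiff_cexp|].
apply cdiff_mult; [apply cdiff_const|apply cdiff_id].
Qed.

Definition circle (G : C -> C) (z0 : C) (r : R) (t : R) : C := G (z0 + RtoC r * cexp2pi 1 t)%C.

Lemma Cmod_circle_point (z0 : C) (r t : R) : 0 <= r -> Cmod (z0 + RtoC r * cexp2pi 1 t - z0)%C = r.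
Proof.
intros Hr; replace (z0 + RtoC r * cexp2pi 1 t - z0)%C with (RtoC r * cexp2pi 1 t)%C by ring.
rewrite Cmod_mult, Cmod_R, Cmod_cexp2pi, Rabs_pos_eq by exact Hr; ring.
Qed.

Lemma ccont_circle (G : C -> C) (z0 : C) (rho r : R) :
  (forall w, Cmod (w - z0)%C < rho -> cdiff G w) -> 0 <= r < rho ->
  forall t, ccont (circle G z0 r) t.
Proof.
intros HG Hr t; apply (cdiff_ccont G (fun t => z0 + RtoC r * cexp2pi 1 t)%C).
- apply HG; rewrite Cmod_circle_point; lra.
- apply ccont_plus; [apply ccont_const|]; apply ccont_mult; [apply ccont_const|apply ccont_cexp2pi].
Qed.

Lemma circle_periodic (G : C -> C) (z0 : C) (r : R) : periodic1 (circle G z0 r).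
Proof. intros t; unfold circle; rewrite cexp2pi_periodic; reflexivity. Qed.

(* In the logarithmic coordinate [w = s + i t] the annulus becomes a rectangle. *)
Lemma fhat_circle (G : C -> C) (z0 : C) (rho r q : R) (m : Z) :
  (forall w, Cmod (w - z0)%C < rho -> cdiff G w) -> 0 < r < rho -> 0 < q <= 1 ->
  fhat (circle G z0 (r * q)) m = (RtoC (Rpower q (IZR m)) * fhat (circle G z0 r) m)%C.
Proof.
intros HG Hr Hq; assert (Hpi := PI_RGT_0).
set (s2 := ln r / (2 * PI)); set (s1 := ln (r * q) / (2 * PI)).
assert (Hrq : 0 < r * q) by (apply Rmult_lt_0_compat; lra).
assert (E2 : exp (2 * PI * 1 * s2) = r).
{ unfold s2; replace (2 * PI * 1 * (ln r / (2 * PI))) with (ln r) by (field; lra); apply exp_ln; lra. }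
assert (E1 : exp (2 * PI * 1 * s1) = r * q).
{ unfold s1; replace (2 * PI * 1 * (ln (r * q) / (2 * PI))) with (ln (r * q)) by (field; lra).
  apply exp_ln, Hrq. }
assert (Hs : s1 <= s2).
{ unfold s1, s2, Rdiv; apply Rmult_le_compat_r; [left; apply Rinv_0_lt_compat; lra|].
  apply ln_le; [exact Hrq|]; rewrite <- (Rmult_1_r r) at 2; apply Rmult_le_compat_l; lra. }
(* The factor [exp (- 2 pi m w)] makes the integral along [Re w = s] equal to [r'^(-m)] times the
   coefficient on the circle of radius [r' = exp (2 pi s)]. [H] has period [i], so the horizontal
   sides cancel. *)
set (H := fun w => (G (z0 + cexp (RtoC (2 * PI * 1) * w)) * cexp (RtoC (2 * PI * IZR (- m)) * w))%C).
assert (HH : forall s t, H (s, t)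
  = (circle G z0 (exp (2 * PI * 1 * s)) t * (RtoC (exp (2 * PI * IZR (- m) * s)) * Cconj (cexp2pi m t)))%C).
{ intros s t; unfold H; rewrite (cexp_2pi 1), cexp_2pi, cexp2pi_conj; reflexivity. }
assert (HI : forall s, 0 < exp (2 * PI * 1 * s) < rho ->
  CInt (fun t => H (s, t)) 0 1
  = (RtoC (exp (2 * PI * IZR (- m) * s)) * fhat (circle G z0 (exp (2 * PI * 1 * s))) m)%C).
{ intros s Hs'; rewrite fhat_CInt, <- CInt_scal; [|lra|].
  - apply CInt_ext; [lra|]; intros t _; rewrite HH; ring.
  - intros t _; apply ccont_mult; [apply (ccont_circle G z0 rho); [exact HG|lra]|].
    apply ccont_conj, ccont_cexp2pi. }
assert (HJ : CInt (fun t => H (s1, t)) 0 1 = CInt (fun t => H (s2, t)) 0 1).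
{ apply goursat_vertical; [exact Hs|lra| |].
  - intros s t Hst _; apply cdiff_mult; [|apply cdiff_cexp_scal].
    apply (cdiff_comp G (fun w => z0 + cexp (RtoC (2 * PI * 1) * w))%C).
    + apply HG; rewrite (cexp_2pi 1), Cmod_circle_point by (left; apply exp_pos).
      apply Rle_lt_trans with r; [|lra]; rewrite <- E2.
      destruct (Rle_lt_or_eq_dec s s2) as [Hlt| ->]; [lra| |lra].
      left; apply exp_increasing, Rmult_lt_compat_l; lra.
    + apply cdiff_plus; [apply cdiff_const|apply cdiff_cexp_scal].
  - intros s _; rewrite !HH; unfold circle; rewrite !cexp2pi_1, !cexp2pi_at0; reflexivity. }
assert (Hrq' : r * q <= r) by (rewrite <- (Rmult_1_r r) at 2; apply Rmult_le_compat_l; lra).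
assert (HI1 := HI s1); assert (HI2 := HI s2); rewrite E1 in HI1; rewrite E2 in HI2.
rewrite HI1, HI2 in HJ by lra.
replace (Rpower q (IZR m)) with (exp (2 * PI * IZR m * s1) * exp (2 * PI * IZR (- m) * s2)).
- rewrite RtoC_mult, <- Cmult_assoc, <- HJ, Cmult_assoc, <- RtoC_mult, <- exp_plus, opp_IZR.
  replace (2 * PI * IZR m * s1 + 2 * PI * - IZR m * s1) with 0 by ring; rewrite exp_0; ring.
- rewrite <- exp_plus; unfold Rpower; f_equal; unfold s1, s2; rewrite opp_IZR, ln_mult by lra.
  field; lra.
Qed.

Lemma Rpower_Z_nat (q : R) (k : nat) : 0 < q -> Rpower q (IZR (Z.of_nat k)) = q ^ k.
Proof. intros Hq; rewrite <- INR_IZR_INZ; apply Rpower_pow, Hq. Qed.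

(** Replaces the passage to the limit as the radius factor [q] tends to 0. *)
Lemma le_mul_small (u K : R) : 0 <= K -> (forall q, 0 < q <= 1/2 -> u <= K * q) -> u <= 0.
Proof.
intros HK H; apply Rnot_lt_le; intros Hu.
assert (Hq : 0 < Rmin (1/2) (u / (2 * (K + 1)))) by (apply Rmin_pos; [lra|apply Rdiv_lt_0_compat; lra]).
assert (H1 := H _ (conj Hq (Rmin_l _ _))).
assert (H2 : K * Rmin (1/2) (u / (2 * (K + 1))) <= K * (u / (2 * (K + 1))))
  by (apply Rmult_le_compat_l; [exact HK|apply Rmin_r]).
assert (H3 : K * (u / (2 * (K + 1))) < u).
{ replace (K * (u / (2 * (K + 1)))) with (u * (K / (2 * (K + 1)))) by (field; lra).
  rewrite <- (Rmult_1_r u) at 2; apply Rmult_lt_compat_l; [exact Hu|].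
  apply Rmult_lt_reg_r with (2 * (K + 1)); [lra|]; field_simplify; lra. }
lra.
Qed.

(* Negative coefficients vanish since [G] is bounded near the centre; the others vanish
   one after the other, by letting the radius tend to [0] in the Fourier series at angle [0]. *)
Lemma zero_on_circle (G : C -> C) (x0 rho r : R) :
  (forall w, Cmod (w - RtoC x0)%C < rho -> cdiff G w) -> (forall t : R, G (RtoC t) = RtoC 0) ->
  0 < r < rho -> forall t, circle G (RtoC x0) r t = RtoC 0.
Proof.
intros HG HR Hr.
assert (Hc : forall q, 0 < q <= 1 -> forall t, ccont (circle G (RtoC x0) (r * q)) t).
{ intros q Hq; apply (ccont_circle G (RtoC x0) rho); [exact HG|]; split; [apply Rmult_le_pos; lra|].
  apply Rle_lt_trans with r; [|lra]; rewrite <- (Rmult_1_r r) at 2; apply Rmult_le_compat_l; lra. }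
assert (Hc1 : forall t, ccont (circle G (RtoC x0) r) t) by (apply (ccont_circle G _ rho); [exact HG|lra]).
assert (HF := fun q m => fhat_circle G (RtoC x0) rho r q m HG Hr).
set (c := fhat (circle G (RtoC x0) r)) in *.
destruct (ccont_bounded (circle G (RtoC x0) r) 0 1 ltac:(lra) Hc1) as [M [HM HMb]].
assert (HcM : forall m, Cmod (c m) <= M) by (intros m; apply fhat_bound; assumption).
assert (Hneg : forall k, c (- Z.of_nat (S k))%Z = RtoC 0).
{ intros k; apply Cmod_eq_0, Rle_antisym; [|apply Cmod_ge_0].
  destruct (proj1 (continuous_C_eps G (RtoC x0)) (cdiff_continuous _ _ (HG (RtoC x0)
    ltac:(replace (RtoC x0 - RtoC x0)%C with (RtoC 0) by ring; rewrite Cmod_0; lra))) 1 ltac:(lra)) as [d [Hd Hd']].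
  (* [q0] shrinks the circle into the disc where continuity at the centre and [G x0 = 0] give
     [|G| < 1]. *)
  set (q0 := Rmin 1 (d / (2 * r))).
  assert (Hq0 : 0 < q0) by (apply Rmin_pos; [lra|apply Rdiv_lt_0_compat; lra]).
  assert (Hq1 : q0 <= 1) by apply Rmin_l.
  assert (Hq2 : r * q0 <= d / 2).
  { apply Rle_trans with (r * (d / (2 * r))); [apply Rmult_le_compat_l; [lra|apply Rmin_r]|right; field; lra]. }
  apply (le_mul_small _ q0); [lra|]; intros q Hq.
  assert (Hqq : 0 < q0 * q <= 1).
  { split; [apply Rmult_lt_0_compat; lra|]; replace 1 with (1 * 1) by ring; apply Rmult_le_compat; lra. }
  assert (Hb : Cmod (fhat (circle G (RtoC x0) (r * (q0 * q))) (- Z.of_nat (S k))%Z) <= 1).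
  { apply fhat_bound; [apply Hc, Hqq|]; intros t _; left.
    replace (circle G (RtoC x0) (r * (q0 * q)) t) with (circle G (RtoC x0) (r * (q0 * q)) t - G (RtoC x0))%C
      by (rewrite HR; ring).
    apply Hd'; rewrite Cmod_circle_point by (apply Rmult_le_pos; lra).
    apply Rle_lt_trans with (r * q0 * 1); [|lra].
    rewrite <- Rmult_assoc; apply Rmult_le_compat_l; [apply Rmult_le_pos; lra|lra]. }
  (* The coefficient of index [- (k + 1)] scales by [(q0 q)^(-(k + 1))], so boundedness by 1 means
     [|c| <= (q0 q)^(k + 1) <= q0 q]. *)
  rewrite HF, Cmod_mult, Cmod_R, Rabs_pos_eq, opp_IZR, Rpower_Ropp, Rpower_Z_nat in Hb
    by (try (left; apply exp_pos); lra).
  assert (Hpow : 0 < (q0 * q) ^ S k) by (apply pow_lt; lra).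
  apply Rmult_le_compat_l with (r := (q0 * q) ^ S k) in Hb; [|lra].
  rewrite <- Rmult_assoc, Rinv_r, Rmult_1_l, Rmult_1_r in Hb by lra.
  eapply Rle_trans; [exact Hb|].
  simpl; rewrite <- (Rmult_1_r (q0 * q)) at 3; apply Rmult_le_compat_l; [lra|].
  rewrite <- (pow1 k); apply pow_incr; lra. }
assert (Hpos : forall k, c (Z.of_nat k) = RtoC 0).
{ induction k as [k IH] using (well_founded_induction lt_wf).
  apply Cmod_eq_0, Rle_antisym; [|apply Cmod_ge_0].
  apply (le_mul_small _ (2 * M)); [lra|]; intros q Hq.
  (* At angle 0 the circle meets the real line, where [G] vanishes. By [Hneg] and [IH] the partial
     sum of order [k] reduces to [q^k c_k], and the tail is at most
     [M q^(k + 1) / (1 - q) <= 2 M q^(k + 1)]. *)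
  assert (Ht : Cmod (circle G (RtoC x0) (r * q) 0 - fourier_sum (circle G (RtoC x0) (r * q)) k 0)%C
    <= M * (q ^ S k / (1 - q))).
  { apply fourier_tail; [apply circle_periodic|apply Hc; lra|]; intros N.
    apply Rle_trans with (rsum (fun i => M * q ^ (k + S i)) N).
    - apply rsum_le; intros i _; rewrite !HF by lra.
      replace (k + S i)%nat with (S (k + i)) by lia.
      rewrite Hneg, Cmult_0_r, Cmod_0, Rplus_0_r, Cmod_mult, Cmod_R, Rpower_Z_nat by lra.
      rewrite Rabs_pos_eq, Rmult_comm by (apply pow_le; lra).
      apply Rmult_le_compat_r; [apply pow_le; lra|apply HcM].
    - rewrite rsum_scal; apply Rmult_le_compat_l; [exact HM|apply rsum_geom_tail; lra]. }
  replace (circle G (RtoC x0) (r * q) 0) with (RtoC 0) in Ht.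
  2: { unfold circle; rewrite cexp2pi_at0, Cmult_1_r, <- RtoC_plus, HR; reflexivity. }
  assert (Hs : fourier_sum (circle G (RtoC x0) (r * q)) k 0 = (RtoC (q ^ k) * c (Z.of_nat k))%C).
  { unfold fourier_sum; rewrite (csum_delta _ _ (2 * k)); [|lia|].
    - replace (Z.of_nat (2 * k) - Z.of_nat k)%Z with (Z.of_nat k) by lia.
      rewrite cexp2pi_at0, HF, Rpower_Z_nat by lra; ring.
    - intros i Hi Hne; rewrite cexp2pi_at0, HF by lra.
      replace (c (Z.of_nat i - Z.of_nat k)%Z) with (RtoC 0); [ring|symmetry].
      destruct (le_lt_dec k i) as [Hki|Hki].
      + replace (Z.of_nat i - Z.of_nat k)%Z with (Z.of_nat (i - k)) by lia; apply IH; lia.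
      + replace (Z.of_nat i - Z.of_nat k)%Z with (- Z.of_nat (S (k - i - 1)))%Z by lia; apply Hneg. }
  rewrite Hs in Ht.
  replace (RtoC 0 - RtoC (q ^ k) * c (Z.of_nat k))%C with (- (RtoC (q ^ k) * c (Z.of_nat k)))%C in Ht by ring.
  assert (Hqk : 0 < q ^ k) by (apply pow_lt; lra).
  rewrite Cmod_opp, Cmod_mult, Cmod_R, Rabs_pos_eq in Ht by lra.
  apply Rmult_le_reg_l with (q ^ k); [exact Hqk|].
  eapply Rle_trans; [exact Ht|].
  replace (q ^ k * (2 * M * q)) with (M * (2 * q ^ S k)) by (simpl; ring).
  apply Rmult_le_compat_l; [exact HM|].
  assert (Hqk' : 0 < q ^ S k) by (apply pow_lt; lra).
  apply Rmult_le_reg_r with (1 - q); [lra|].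
  replace (q ^ S k / (1 - q) * (1 - q)) with (q ^ S k * 1) by (field; lra).
  replace (2 * q ^ S k * (1 - q)) with (q ^ S k * (2 * (1 - q))) by ring.
  apply Rmult_le_compat_l; lra. }
(* With every coefficient zero, [fourier_tail] for [n = 0] applies with tail bound 0. *)
intros t; apply Cmod_eq_0, Rle_antisym; [|apply Cmod_ge_0].
replace (circle G (RtoC x0) r t) with (circle G (RtoC x0) r t - fourier_sum (circle G (RtoC x0) r) 0 t)%C.
- apply fourier_tail; [apply circle_periodic|exact Hc1|]; intros N.
  rewrite (rsum_ext _ (fun _ => 0)); [rewrite rsum_0; lra|]; intros i _.
  change (0 + S i)%nat with (S i); fold c; rewrite Hpos, Hneg, Cmod_0; ring.
- unfold fourier_sum; simpl; fold c; rewrite (Hpos O : c 0%Z = _); ring.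
Qed.

(** * Functions analytic on a strip *)

(** The disc of radius [rho0] about a real point lies in the strip, and the circle of radius [|y|]
    about [x] passes through [x + i y] at parameter 1/4 or -1/4, so [zero_on_circle] reaches every
    point off the real line. *)
Lemma strip_periodic (F : C -> C) (f : R -> C) (rho0 : R) :
  (forall z : C, Rabs (Im z) < rho0 -> cdiff F z) -> (forall t : R, F (RtoC t) = f t) -> periodic1 f ->
  forall z : C, Rabs (Im z) < rho0 -> F (z + RtoC 1)%C = F z.
Proof.
intros HF Hf Hp.
set (G := fun z => (F (z + RtoC 1) + RtoC (-1) * F z)%C).
assert (HG : forall z : C, Rabs (Im z) < rho0 -> cdiff G z).
{ intros z Hz; apply cdiff_plus; [|apply cdiff_mult; [apply cdiff_const|apply HF, Hz]].
  apply (cdiff_comp F (fun w => w + RtoC 1)%C); [apply HF|apply cdiff_plus; [apply cdiff_id|apply cdiff_const]].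
  destruct z; simpl in *; rewrite Rplus_0_r; exact Hz. }
assert (HR : forall t : R, G (RtoC t) = RtoC 0).
{ intros t; unfold G; rewrite <- RtoC_plus, !Hf, Hp; ring. }
assert (H0 : forall z : C, Rabs (Im z) < rho0 -> G z = RtoC 0).
{ intros [x y] Hy; simpl in Hy.
  destruct (Req_dec y 0) as [->|Hy0]; [apply HR|].
  assert (Hz := zero_on_circle G x rho0 (Rabs y)).
  assert (HGd : forall w : C, Cmod (w - RtoC x)%C < rho0 -> cdiff G w).
  { intros [u v] Hw; apply HG; simpl; eapply Rle_lt_trans; [|exact Hw].
    eapply Rle_trans; [|apply Rmax_Cmod]; simpl; replace (v + - 0) with v by ring; apply Rmax_r. }
  specialize (Hz HGd HR (conj (Rabs_pos_lt _ Hy0) Hy)); unfold circle in Hz.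
  destruct (Rle_dec 0 y) as [Hpos|Hneg].
  - rewrite <- (Hz (1/4)); f_equal; unfold cexp2pi, RtoC, Cplus, Cmult; simpl.
    replace (2 * PI * 1 * (1 / 4)) with (PI / 2) by field; rewrite cos_PI2, sin_PI2, Rabs_pos_eq by exact Hpos.
    f_equal; ring.
  - rewrite <- (Hz (-1/4)); f_equal; unfold cexp2pi, RtoC, Cplus, Cmult; simpl.
    replace (2 * PI * 1 * (-1 / 4)) with (- (PI / 2)) by field; rewrite cos_neg, sin_neg, cos_PI2, sin_PI2, Rabs_left by lra.
    f_equal; ring. }
intros z Hz; specialize (H0 z Hz); unfold G in H0.
replace (F (z + RtoC 1)%C) with ((F (z + RtoC 1) + RtoC (-1) * F z) + F z)%C by ring; rewrite H0; ring.
Qed.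

(** Cauchy's theorem for [F z * exp (- 2 pi i m z)] on one period of the strip, between the heights
    0 and [y]; the vertical sides cancel by [strip_periodic]. *)
Lemma fhat_strip (F : C -> C) (f : R -> C) (rho0 y : R) (m : Z) :
  (forall z : C, Rabs (Im z) < rho0 -> cdiff F z) -> (forall t : R, F (RtoC t) = f t) -> periodic1 f ->
  Rabs y < rho0 -> fhat f m = (RtoC (exp (2 * PI * IZR m * y)) * fhat (fun x => F (x, y)) m)%C.
Proof.
intros HF Hf Hp Hy; assert (Hper := strip_periodic F f rho0 HF Hf Hp).
set (H := fun z => (F z * cexp (RtoC (2 * PI * IZR m) * (- Ci * z)))%C).
assert (HH : forall x v, H (x, v) = (F (x, v) * (RtoC (exp (2 * PI * IZR m * v)) * Cconj (cexp2pi m x)))%C).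
{ intros x v; unfold H; replace (- Ci * (x, v))%C with ((v, - x) : C)
    by (unfold Ci, Copp, Cmult; simpl; f_equal; ring).
  rewrite cexp_2pi, cexp2pi_opp, cexp2pi_conj; reflexivity. }
assert (HJ : forall c d, c <= d -> Rabs c < rho0 -> Rabs d < rho0 ->
  CInt (fun x => H (x, c)) 0 1 = CInt (fun x => H (x, d)) 0 1).
{ intros c d Hcd Hc Hd.
  assert (Hv : forall v, c <= v <= d -> Rabs v < rho0).
  { intros v Hv; apply Rabs_lt_between in Hc; apply Rabs_lt_between in Hd; apply Rabs_lt_between; lra. }
  apply goursat_horizontal; [lra|exact Hcd| |].
  - intros x v _ Hv'; apply cdiff_mult; [apply HF, Hv, Hv'|].
    apply (cdiff_comp cexp (fun z => RtoC (2 * PI * IZR m) * (- Ci * z))%C); [apply cdiff_cexp|].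
    apply cdiff_mult; [apply cdiff_const|]; apply cdiff_mult; [apply cdiff_const|apply cdiff_id].
  - intros v Hv'; rewrite !HH, cexp2pi_1, cexp2pi_at0.
    rewrite <- (Hper ((0, v) : C) (Hv v Hv')).
    replace ((0, v) + RtoC 1)%C with ((1, v) : C) by (unfold RtoC, Cplus; simpl; f_equal; ring); reflexivity. }
assert (H0 : CInt (fun x => H (x, 0)) 0 1 = CInt (fun x => H (x, y)) 0 1).
{ assert (Rabs 0 < rho0) by (rewrite Rabs_R0; apply Rle_lt_trans with (Rabs y); [apply Rabs_pos|exact Hy]).
  destruct (Rle_dec 0 y); [apply HJ; assumption|symmetry; apply HJ; try assumption; lra]. }
rewrite !fhat_CInt, <- CInt_scal; [|lra|].
- transitivity (CInt (fun x => H (x, 0)) 0 1); [|rewrite H0]; apply CInt_ext; try lra; intros x _; rewrite HH.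
  + rewrite Rmult_0_r, exp_0, <- (Hf x); change ((x, 0) : C) with (RtoC x); ring.
  + ring.
- intros x _; apply ccont_mult; [apply ccont_horizontal, HF, Hy|apply ccont_conj, ccont_cexp2pi].
Qed.

(** Shifting to height [- y] for positive and to [y] for negative frequencies gives the decay
    [exp (- 2 pi k y)]. As [2 pi >= 1], this is at most [q^k] with [q = exp (- y) <= exp (- rho)],
    and the tail is bounded by a geometric series. *)
Lemma quad_error_analytic (L : nat -> nat) (xs tau : nat -> nat -> R) (A B : R)
  (hMZ : MZ_family L xs tau A B) (rho0 : R) (f : R -> C) : 0 < rho0 -> periodic1 f ->
  analytic_strip rho0 f -> forall rho, rho < rho0 ->
  exists M : R, forall n : nat, (1 <= n)%nat ->
    Cmod (Cminus (Iint f) (quad L xs tau n f)) <= M * exp (- rho * INR n).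
Proof.
intros Hrho0 Hp [F [HFd Hf]] rho Hrho.
assert (HF : forall z : C, Rabs (Im z) < rho0 -> cdiff F z) by (intros z Hz; apply ex_derive_cdiff, HFd, Hz).
(* [rho] may be zero or negative; the maximum keeps the height positive, so that [q < 1]. *)
set (y := Rmax rho (rho0 / 2)).
assert (Hy1 : rho <= y) by apply Rmax_l.
assert (Hy2 : 0 < y) by (apply Rlt_le_trans with (rho0 / 2); [lra|apply Rmax_r]).
assert (Hy3 : y < rho0) by (apply Rmax_lub_lt; lra).
assert (Hya : Rabs y < rho0) by (rewrite Rabs_pos_eq; lra).
assert (Hyb : Rabs (- y) < rho0) by (rewrite Rabs_Ropp; exact Hya).
assert (Hcont : forall v, Rabs v < rho0 -> forall x, ccont (fun x => F (x, v)) x).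
{ intros v Hv x; apply ccont_horizontal, HF, Hv. }
assert (Hfc : forall x, ccont f x).
{ intros x; replace f with (fun x => F (x, 0)) by (extensionality t; apply Hf).
  apply Hcont; rewrite Rabs_R0; exact Hrho0. }
destruct (ccont_bounded (fun x => F (x, y)) 0 1 ltac:(lra) (Hcont y Hya)) as [M1 [HM1 B1]].
destruct (ccont_bounded (fun x => F (x, - y)) 0 1 ltac:(lra) (Hcont (- y) Hyb)) as [M2 [HM2 B2]].
set (q := exp (- y)).
assert (Hq : 0 < q < 1).
{ unfold q; split; [apply exp_pos|]; rewrite <- exp_0; apply exp_increasing; lra. }
assert (Hqk : forall k, exp (- (2 * PI * INR k * y)) <= q ^ k).
{ intros k; unfold q; rewrite <- Rpower_pow by apply exp_pos; unfold Rpower; rewrite ln_exp.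
  assert (H : INR k * - y >= - (2 * PI * INR k * y)).
  { assert (0 <= INR k * y) by (apply Rmult_le_pos; [apply pos_INR|lra]).
    assert (1 * (INR k * y) <= 2 * PI * (INR k * y)) by (apply Rmult_le_compat_r; [assumption|generalize PI2_1; lra]).
    lra. }
  destruct H as [H|H]; [left; apply exp_increasing; lra|right; f_equal; lra]. }
exists ((1 + sqrt (B / A)) * ((M1 + M2) * (q / (1 - q)))); intros n Hn.
rewrite Rmult_assoc.
eapply Rle_trans; [apply (quad_error_fourier_tail L xs tau A B hMZ f n ((M1 + M2) * (q ^ S n / (1 - q)))); try assumption|].
- intros N; apply Rle_trans with (rsum (fun i => (M1 + M2) * q ^ (n + S i)) N).
  + apply rsum_le; intros i _.
    rewrite (fhat_strip F f rho0 (- y) (Z.of_nat (n + S i))), (fhat_strip F f rho0 y (- Z.of_nat (n + S i))%Z) by assumption.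
    rewrite !Cmod_mult, !Cmod_R, !Rabs_pos_eq by (left; apply exp_pos).
    rewrite opp_IZR, <- INR_IZR_INZ.
    replace (2 * PI * INR (n + S i) * - y) with (- (2 * PI * INR (n + S i) * y)) by ring.
    replace (2 * PI * - INR (n + S i) * y) with (- (2 * PI * INR (n + S i) * y)) by ring.
    rewrite <- Rmult_plus_distr_l, (Rmult_comm (M1 + M2)).
    apply Rmult_le_compat; [left; apply exp_pos|apply Rplus_le_le_0_compat; apply Cmod_ge_0|apply Hqk|].
    rewrite (Rplus_comm M1); apply Rplus_le_compat; apply fhat_bound; auto.
  + rewrite rsum_scal; apply Rmult_le_compat_l; [lra|apply rsum_geom_tail, Hq].
- apply Rmult_le_compat_l; [generalize (sqrt_pos (B / A)); lra|].
  rewrite Rmult_assoc; apply Rmult_le_compat_l; [lra|].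
  replace (q ^ S n / (1 - q)) with (q / (1 - q) * q ^ n) by (simpl; field; lra).
  apply Rmult_le_compat_l; [apply Rdiv_le_0_compat; lra|].
  unfold q; rewrite <- Rpower_pow by apply exp_pos; unfold Rpower; rewrite ln_exp.
  assert (H : INR n * - y <= - rho * INR n).
  { assert (rho * INR n <= y * INR n) by (apply Rmult_le_compat_r; [apply pos_INR|exact Hy1]); lra. }
  destruct H as [H|H]; [left; apply exp_increasing; exact H|right; f_equal; exact H].
Qed.

Theorem theorem2p7 (L : nat -> nat) (xs tau : nat -> nat -> R) (A B : R)
  (hMZ : MZ_family L xs tau A B) :
  (* (i) *)
  (forall f : R -> C, cont_periodic f ->
     forall n : nat, (1 <= n)%nat ->
       Rbar_le (Finite (Cmod (Cminus (Iint f) (quad L xs tau n f))))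
               (Rbar_mult (Finite (1 + sqrt (B / A))) (best_approx n f))) /\
  (* (i), consequence *)
  (forall (sigma : R) (f : R -> C), 0 < sigma -> C_sigma sigma f ->
     exists M : R, forall n : nat, (1 <= n)%nat ->
       Cmod (Cminus (Iint f) (quad L xs tau n f)) <= M * Rpower (INR n) (- sigma)) /\
  (* (ii) *)
  (forall (sigma : R) (f : R -> C), 1/2 < sigma -> cont_periodic f -> in_H_sigma sigma f ->
     forall n : nat, (1 <= n)%nat ->
       Cmod (Cminus (Iint f) (quad L xs tau n f))
       <= (1 + sqrt (B / A)) * H_norm sigma f
          * (/ sqrt (sigma - 1/2) * Rpower (INR n) (- sigma + 1/2))) /\
  (* (iii) *)
  (forall (rho0 : R) (f : R -> C), 0 < rho0 -> periodic1 f -> analytic_strip rho0 f ->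
     forall rho : R, rho < rho0 ->
       exists M : R, forall n : nat, (1 <= n)%nat ->
         Cmod (Cminus (Iint f) (quad L xs tau n f)) <= M * exp (- rho * INR n)).
Proof.
split; [|split; [|split]].
- intros f [_ Hf] n Hn; apply quad_error_best_approx; try assumption.
  intros x; apply continuous_ccont, Hf.
- intros sigma f _ Hf; apply (quad_error_C_sigma L xs tau A B hMZ sigma f Hf).
- intros sigma f Hs [Hp Hf] HH n Hn; rewrite Rmult_assoc.
  apply (quad_error_fourier_tail L xs tau A B hMZ); try assumption.
  + intros s; apply continuous_ccont, Hf.
  + intros N; apply sobolev_tail; assumption.
- intros rho0 f Hrho0 Hp Hf; apply (quad_error_analytic L xs tau A B hMZ rho0 f Hrho0 Hp Hf).
Qed.
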